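(* Let $X\subset\mathbb{R}^n$ be open and let $Lu(x)=a(x)\cdot D^2u(x)+b(x)\cdot Du(x)$, where $a$ (symmetric-matrix valued) and $b$ (vector valued) are $C^\infty$ on $X$ and $a(x)$ is positive definite at each point. Then for an upper semi-continuous function $u:X\to[-\infty,\infty)$ that is not identically $-\infty$ on any connected component of $X$: $u$ is $L$-subharmonic in the viscosity sense if and only if $u$ is classically $L$-subharmonic. That is, $\mathrm{SH}^{\rm visc}(X)=\mathrm{SH}^{\rm class}(X)$.
   Context: Here $a\cdot D^2u=\sum_{i,j}a_{ij}\,\partial^2u/\partial x_i\partial x_j$ and $b\cdot Du=\sum_ib_i\,\partial u/\partial x_i$. $u$ is $L$-subharmonic in the viscosity sense ($u\in\mathrm{SH}^{\rm visc}(X)$) if for every $x\in X$ and every function $\varphi$ that is $C^2$ near $x$ with $u-\varphi\le0$ near $x$ and $u(x)=\varphi(x)$, one has $L\varphi(x)\ge0$. A function $h$ is $L$-harmonic if $Lh=0$ (such functions are smooth). $u$ is classically $L$-subharmonic ($u\in\mathrm{SH}^{\rm class}(X)$) if for every compact set $K\subset X$ and every $L$-harmonic function $h$ defined on a neighborhood of $K$, $u\le h$ on $\partial K$ implies $u\le h$ on $K$. Functions in both classes are assumed not identically $-\infty$ on any connected component of $X$. *)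

(* Defs.v *)
From mathcomp Require Import all_boot all_order all_algebra.
From mathcomp Require Import all_classical all_reals all_analysis.

Set Implicit Arguments.
Unset Strict Implicit.
Unset Printing Implicit Defensive.

Import Order.TTheory GRing.Theory Num.Theory.
Import numFieldNormedType.Exports.

Local Open Scope classical_set_scope.
Local Open Scope ring_scope.

(* Functions on a subset of R^n are represented by total functions; every notion
   below only depends on their values on the set in question. *)

Definition pderiv (R : realType) (n : nat) (i : 'I_n) (f : 'rV[R]_n -> R) :
    'rV[R]_n -> R :=
  fun x => 'D_(delta_mx 0 i : 'rV[R]_n) f x.

(* Meaningful for U open: f and its iterated partial derivatives of order at
   most k exist and are continuous at every point of U. *)
Fixpoint Ck_on (R : realType) (n : nat) (k : nat) (U : set 'rV[R]_n)
    (f : 'rV[R]_n -> R) : Prop :=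
  (forall x, U x -> {for x, continuous f}) /\
  (if k is k'.+1 then
     forall i : 'I_n,
       (forall x, U x -> derivable f x (delta_mx 0 i)) /\
       Ck_on k' U (pderiv i f)
   else True).

Definition smooth_on (R : realType) (n : nat) (U : set 'rV[R]_n)
    (f : 'rV[R]_n -> R) : Prop :=
  forall k, Ck_on k U f.

Definition C2_near (R : realType) (n : nat) (x : 'rV[R]_n)
    (f : 'rV[R]_n -> R) : Prop :=
  exists U : set 'rV[R]_n, [/\ open U, U x & Ck_on 2 U f].

Definition posdefmx (R : realType) (n : nat) (A : 'M[R]_n) : Prop :=
  forall v : 'rV[R]_n, v != 0 -> 0 < (v *m A *m v^T) 0 0.

Definition Lop (R : realType) (n : nat) (a : 'rV[R]_n -> 'M[R]_n)
    (b : 'rV[R]_n -> 'rV[R]_n) (f : 'rV[R]_n -> R) (x : 'rV[R]_n) : R :=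
  \sum_(i < n) \sum_(j < n) a x i j * pderiv i (pderiv j f) x
  + \sum_(i < n) b x 0 i * pderiv i f x.

Definition boundary (T : topologicalType) (K : set T) : set T :=
  closure K `\` interior K.

(* u : X -> [-oo, +oo) is upper semicontinuous; for X open, neighborhoods in X
   and in the ambient space agree. *)
Definition usc_on (R : realType) (n : nat) (X : set 'rV[R]_n)
    (u : 'rV[R]_n -> \bar R) : Prop :=
  forall x, X x -> (u x < +oo)%E /\
    forall r : R, (u x < r%:E)%E -> \forall y \near x, (u y < r%:E)%E.

Definition not_identically_ninfty (R : realType) (n : nat) (X : set 'rV[R]_n)
    (u : 'rV[R]_n -> \bar R) : Prop :=
  forall x, X x -> exists2 y, connected_component X x y & u y != -oo%E.

Definition SHvisc (R : realType) (n : nat) (a : 'rV[R]_n -> 'M[R]_n)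
    (b : 'rV[R]_n -> 'rV[R]_n) (X : set 'rV[R]_n) (u : 'rV[R]_n -> \bar R) :
    Prop :=
  forall (x : 'rV[R]_n) (phi : 'rV[R]_n -> R),
    X x -> C2_near x phi ->
    (\forall y \near x, (u y <= (phi y)%:E)%E) ->
    u x = (phi x)%:E ->
    0 <= Lop a b phi x.

(* Classical solutions: C^2 is what it takes to write L h pointwise, and such
   an h is automatically smooth by elliptic regularity. *)
Definition Lharmonic_on (R : realType) (n : nat) (a : 'rV[R]_n -> 'M[R]_n)
    (b : 'rV[R]_n -> 'rV[R]_n) (V : set 'rV[R]_n) (h : 'rV[R]_n -> R) : Prop :=
  Ck_on 2 V h /\ forall x, V x -> Lop a b h x = 0.

Definition SHclass (R : realType) (n : nat) (a : 'rV[R]_n -> 'M[R]_n)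
    (b : 'rV[R]_n -> 'rV[R]_n) (X : set 'rV[R]_n) (u : 'rV[R]_n -> \bar R) :
    Prop :=
  forall (K V : set 'rV[R]_n) (h : 'rV[R]_n -> R),
    compact K -> open V -> K `<=` V -> V `<=` X ->
    Lharmonic_on a b V h ->
    (forall x, boundary K x -> (u x <= (h x)%:E)%E) ->
    (forall x, K x -> (u x <= (h x)%:E)%E).

(* Main.v *)
(* If [u] is a viscosity subsolution and [h] is L-harmonic near K, an interior
   positive maximum of [u - h] survives the addition of a small multiple of
   [exp (L x_0)], which is strictly subharmonic for [L] large; this contradicts
   the definition at the maximum point.

   Conversely, let [phi] touch [u] from above at [x0] with [L phi x0 < 0]. Adding
   a positive multiple of [|x - x0|^2] to the Taylor polynomial of [phi] yields a
   quadratic [P] with [L P x0 = 0] and [P - phi >= tau |x - x0|^2]. If on a cube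
   of side [r] there is a C^2 function [w] with [L w = - L P] and [|w| <= C r^3],
   then [P + w], lowered by a constant of order [r^2], is L-harmonic, lies above
   [u] on the boundary of a smaller cube and below it at [x0].

   To find [w], write [L = L0 + B], with [L0] the second order part of [L] frozen
   at [x0]. On waves [cos (q <m, x> + p)] with [m] in a lattice coset avoiding 0,
   [L0] is inverted explicitly and the second derivatives of the inverse are
   bounded; in the Wiener algebra the operator [B L0^-1] is a contraction for
   small [r]. Neither integrals nor infinite Fourier series are used: smooth
   functions on the cube are interpolated at the nodes of a grid by cosine sums
   whose norms are bounded independently of the mesh, the Neumann series is
   truncated, and [w] is a limit of trigonometric sums along an ultrafilter. *)

Require Import Defs.
From mathcomp Require Import all_boot all_order all_algebra.
From mathcomp Require Import all_classical all_reals all_analysis.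
From mathcomp Require Import ring lra zify.

Import Order.TTheory GRing.Theory Num.Theory.
Import numFieldNormedType.Exports.

Set Implicit Arguments.
Unset Strict Implicit.
Unset Printing Implicit Defensive.

Local Open Scope classical_set_scope.
Local Open Scope ring_scope.

(** * Discrete cosine transform *)

(** Every power of [r] is accounted for. With frequencies in units of [pi / r], [L0^-1] gains
    [r ^ 2], its first derivatives gain [r] and its second derivatives gain nothing. So the second
    order part of [B] is small because the leading coefficients deviate by [O(r)] from their values
    at [x0], and the first order part because of its gain. Arranging [L P x0 = 0] makes [L P] of
    size [O(r)], hence [w] of size [O(r ^ 3)], which a gap of order [r ^ 2] absorbs.

    The norm must be submultiplicative, so that coefficients act on it, and must bound the second
    derivatives of [L0^-1]. The sup norm fails the latter; sums of absolute amplitudes do both. They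
    are controlled by cosines of period [2 r], which impose no boundary condition on the cube: the
    coefficients decay like [k ^ -2] in each coordinate at the price of two derivatives, whence
    derivatives up to order [2 n].

    The symbol of [L0] vanishes at frequency 0, whereas the coefficients of [L] are expanded in
    integer frequencies. Only the right-hand side is moved to a shifted coset; products with the
    coefficients then stay there. *)

Section DiscreteCosine.
Variable R : realType.
Implicit Types (x y t : R) (N j k : nat).

(** Weights of the type II cosine transform: over the midpoints [j + 1/2] a nonconstant mode has
    mean square 1/2, whence the 2. *)
Definition dct_weight k : R := if k == 0%N then 1 else 2.

Definition dct_mode N k t : R := cos (pi * k%:R * t / N%:R).

Lemma cos_pi_nat j : cos (pi * j%:R) = (-1) ^+ j :> R.
Proof.
elim: j => [|j IH]; first by rewrite mulr0 cos0.
rewrite -natr1 mulrDr mulr1.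
by rewrite (cosDpi (pi * j%:R)) IH exprS mulN1r.
Qed.

Lemma sin_pi_nat j : sin (pi * j%:R) = 0 :> R.
Proof.
elim: j => [|j IH]; first by rewrite mulr0 sin0.
by rewrite -natr1 mulrDr mulr1 (sinDpi (pi * j%:R)) IH oppr0.
Qed.

Lemma sinB_prod x y : sin (x + y) - sin (x - y) = 2 * sin y * cos x.
Proof. by rewrite (sinB x y) (sinD x y); ring. Qed.

Lemma cosB_prod x y : cos (x - y) - cos (x + y) = 2 * sin y * sin x.
Proof. by rewrite (cosB x y) (cosD x y); ring. Qed.

Lemma cosM_prod x y : cos x * cos y = 2^-1 * cos (x + y) + 2^-1 * cos (x - y).
Proof. by rewrite (cosB x y) (cosD x y); field. Qed.

Lemma dirichlet_kernel N t :
  sin (t / 2) * \sum_(k < N.+1) dct_weight k * cos (k%:R * t) =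
  sin ((N%:R + 2^-1) * t).
Proof.
elim: N => [|N IH].
  by rewrite big_ord1 /dct_weight eqxx mul0r cos0 !mulr1 add0r mulrC.
rewrite big_ord_recr /= mulrDr IH /dct_weight /=.
have := sinB_prod (N.+1%:R * t) (t / 2).
have -> : N.+1%:R * t + t / 2 = (N.+1%:R + 2^-1) * t by ring.
have -> : N.+1%:R * t - t / 2 = (N%:R + 2^-1) * t by rewrite -natr1; field.
by move=> e; rewrite -[RHS](subrK (sin ((N%:R + 2^-1) * t))) e; ring.
Qed.

(** At this [t] the closed form is [sin (pi * a - t / 2)], a multiple of [sin (t / 2)]; the range of
    [a] keeps that sine away from zero. *)
Lemma dirichlet_kernel_pi N a : (0 < a < 2 * N.+1)%N ->
  \sum_(k < N.+1) dct_weight k * cos (k%:R * (pi * a%:R / N.+1%:R)) =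
  - (-1) ^+ a.
Proof.
move=> /andP[a0 aN]; set t := _ / _.
have N0 : (0 : R) < N.+1%:R by rewrite ltr0n.
have tE : pi * a%:R = N.+1%:R * t by rewrite /t; field; rewrite gt_eqF.
have s0 : sin (t / 2) != 0.
  rewrite gt_eqF// sin_gt0_pi//; apply/andP; split.
    by rewrite divr_gt0// /t divr_gt0// mulr_gt0 ?pi_gt0// ltr0n.
  rewrite ltr_pdivrMr// /t ltr_pdivrMr// -mulrA ltr_pM2l ?pi_gt0//.
  by rewrite -natrM ltr_nat.
apply: (mulfI s0); rewrite dirichlet_kernel.
have -> : (N%:R + 2^-1) * t = pi * a%:R - t / 2.
  by rewrite tE -natr1; field.
by rewrite sinB cos_pi_nat sin_pi_nat; ring.
Qed.

(** Summing over the modes at two fixed nodes is what makes interpolation exact. The product formula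
    yields two Dirichlet kernels, at [i + j + 1] and [i - j], whose opposite parities make them
    cancel when [i] and [j] differ. *)
Lemma dct_completeness N (i j : 'I_N.+1) :
  \sum_(k < N.+1) dct_weight k * dct_mode N.+1 k (i%:R + 2^-1)
     * dct_mode N.+1 k (j%:R + 2^-1) = N.+1%:R *+ (i == j).
Proof.
have N0 : (N.+1%:R : R) != 0 by rewrite pnatr_eq0.
wlog ij : i j / (j <= i)%N => [hw|].
  case: (leqP j i) => [/hw//|/ltnW /hw]; rewrite eq_sym => <-.
  by apply: eq_bigr => k _; rewrite mulrAC.
pose S a := \sum_(k < N.+1) dct_weight k * cos (k%:R * (pi * a%:R / N.+1%:R)).
transitivity (2^-1 * S (i + j + 1)%N + 2^-1 * S (i - j)%N).
  rewrite !mulr_sumr -big_split/=; apply: eq_bigr => k _.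
  rewrite -mulrA /dct_mode cosM_prod mulrDr; congr (_ + _).
    rewrite mulrCA; congr (_ * (_ * cos _)).
    by rewrite !natrD; field.
  rewrite mulrCA; congr (_ * (_ * cos _)).
  by rewrite natrB//; field.
have := ltn_ord i; have := ltn_ord j; move: ij.
rewrite /S; have [->|nij] := eqVneq i j => ij jN iN.
  rewrite dirichlet_kernel_pi; last first.
    by lia.
  rewrite subnn mulr1n; under eq_bigr do rewrite !mulr0 mul0r mulr0 cos0 mulr1.
  rewrite /dct_weight big_ord_recl /= sumr_const card_ord.
  rewrite -signr_odd addn1 /= addnn odd_double /= expr1.
  by rewrite -(natr1 N) -mulr_natr; field.
rewrite !dirichlet_kernel_pi.
- rewrite mulr0n -(signr_odd _ (i + j + 1)) -(signr_odd _ (i - j)) addn1 /= oddD oddB//.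
  by case: (odd i) (odd j) => [] []; rewrite /= ?expr1 ?expr0; field.
- have : (i != j :> nat) by rewrite nij.
  by lia.
- by lia.
Qed.

End DiscreteCosine.

(** * Decay of discrete cosine coefficients *)

Section CoefficientDecay.
Variable R : realType.
Implicit Types (x y t : R) (N j k : nat).

Lemma mean_value (f df : R -> R) (a b : R) : a <= b ->
  (forall t, a <= t <= b -> is_derive t 1 f (df t)) ->
  exists2 c, a <= c <= b & f b - f a = df c * (b - a).
Proof.
move=> ab fdf.
have fc : {within `[a, b], continuous f}.
  apply: derivable_within_continuous => u; rewrite in_itv/= => uab.
  by have /fdf[] := uab.
have fd t : t \in `]a, b[%R -> is_derive t 1 f (df t).
  by rewrite in_itv/= => /andP[at_ tb]; apply: fdf; rewrite !ltW.
by have [c] := MVT_segment ab fd fc; rewrite in_itv/= => cab e; exists c.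
Qed.

Lemma mean_value_le (f df : R -> R) (a b C : R) : a <= b ->
  (forall t, a <= t <= b -> is_derive t 1 f (df t)) ->
  (forall t, a <= t <= b -> `|df t| <= C) ->
  `|f b - f a| <= C * (b - a).
Proof.
move=> ab fdf dfC; have [c cab ->] := mean_value ab fdf.
by rewrite normrM (ger0_norm (x := b - a)) ?subr_ge0// ler_wpM2r ?subr_ge0// dfC.
Qed.

(** In [sin x = 2 * sin (x / 2) * cos (x / 2)] the mean value theorem bounds the sine below by
    [x / 2 * cos (x / 2)], and [2 * cos (x / 2) ^+ 2 = 1 + cos x] is at least 1. *)
Lemma sin_ge_half x : 0 <= x <= pi / 2 -> x / 2 <= sin x.
Proof.
move=> /andP[x0 xpi].
have x20 : 0 <= x / 2 by rewrite divr_ge0.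
have [c /andP[c0 cx]] := mean_value x20 (fun t _ => is_derive_sin t).
rewrite sin0 !subr0 => e.
have pi0 := @pi_gt0 R.
have cc : cos (x / 2) <= cos c.
  have := @ltr_cos R; rewrite le_eqVlt => lc.
  have [->|cx'] := eqVneq c (x / 2); first by rewrite eqxx.
  by rewrite lc ?in_itv/= ?lt_neqAle ?cx' ?cx ?orbT//; apply/andP; split; lra.
have c1 : 1 <= 2 * cos (x / 2) ^+ 2.
  have : 0 <= cos x by apply: cos_ge0_pihalf; apply/andP; split; lra.
  have -> : x = (x / 2) *+ 2 by rewrite -mulr_natr; field.
  rewrite cos_mulr2n; have -> : x / 2 *+ 2 / 2 = x / 2 by rewrite -mulr_natr; field.
  by rewrite -mulr_natl; lra.
have c0' : 0 <= cos (x / 2) by apply: cos_ge0_pihalf; apply/andP; split; lra.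
have -> : sin x = 2 * (sin (x / 2) * cos (x / 2)).
  have {1}-> : x = (x / 2) *+ 2 by rewrite -mulr_natr; field.
  by rewrite sin_mulr2n -mulr_natl; ring.
rewrite e.
have h : cos (x / 2) * (x / 2) * cos (x / 2) <= cos c * (x / 2) * cos (x / 2).
  by rewrite ler_wpM2r// ler_wpM2r// divr_ge0.
apply: le_trans (ler_wpM2l _ h); last by [].
have -> : 2 * (cos (x / 2) * (x / 2) * cos (x / 2)) =
   (2 * cos (x / 2) ^+ 2) * (x / 2) by ring.
by rewrite ler_peMl// divr_ge0.
Qed.

Lemma abel_summation (s g : nat -> R) N :
  \sum_(j < N.+1) (s j.+1 - s j) * g j =
  s N.+1 * g N - s 0%N * g 0%N - \sum_(j < N) s j.+1 * (g j.+1 - g j).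
Proof.
elim: N => [|N IH]; first by rewrite big_ord1 big_ord0; ring.
by rewrite big_ord_recr/= IH [in RHS]big_ord_recr/=; ring.
Qed.

(** Discrete antiderivatives of the cosine modes up to a factor. They vanish at [j = 0] and [j = N],
    which removes the boundary terms of the first summation by parts. *)
Definition sin_mode N k j : R := sin (pi * k%:R * j%:R / N%:R).

Lemma sin_mode_diff N k j :
  sin_mode N.+1 k j.+1 - sin_mode N.+1 k j =
  2 * sin (pi * k%:R / N.+1%:R / 2) * dct_mode N.+1 k (j%:R + 2^-1).
Proof.
rewrite /sin_mode /dct_mode -sinB_prod -natr1.
have N0 : (N.+1%:R : R) != 0 by rewrite pnatr_eq0.
by congr (sin _ - sin _); rewrite -?(natr1 j); field.
Qed.

Lemma dct_mode_diff N k j :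
  dct_mode N.+1 k (j%:R + 2^-1) - dct_mode N.+1 k (j.+1%:R + 2^-1) =
  2 * sin (pi * k%:R / N.+1%:R / 2) * sin_mode N.+1 k j.+1.
Proof.
rewrite /sin_mode /dct_mode -cosB_prod -natr1.
have N0 : (N.+1%:R : R) != 0 by rewrite pnatr_eq0.
by congr (cos _ - cos _); rewrite -?(natr1 j); field.
Qed.

Lemma dct_mode_le1 N k t : `|dct_mode N k t| <= 1.
Proof. exact: cos_max. Qed.

(** Two Abel summations, each contributing one factor [2 * sin]. The first has no boundary terms;
    those of the second give [2 * d1], so [g] is subject to no condition at the ends. *)
Lemma dct_summation_by_parts N k (g : nat -> R) (d1 d2 : R) :
  (forall j, (j <= N)%N -> `|g j.+1 - g j| <= d1) ->
  (forall j, (j < N)%N -> `|(g j.+2 - g j.+1) - (g j.+1 - g j)| <= d2) ->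
  (2 * sin (pi * k%:R / N.+2%:R / 2)) ^+ 2 *
    `|\sum_(j < N.+2) dct_mode N.+2 k (j%:R + 2^-1) * g j| <=
  2 * d1 + N%:R * d2.
Proof.
move=> g1 g2; set al := sin _.
pose v j : R := dct_mode N.+2 k (j%:R + 2^-1).
have e : (2 * al) ^+ 2 * (\sum_(j < N.+2) v j * g j) =
   - (\sum_(j < N.+1) (v j - v j.+1) * (g j.+1 - g j)).
  transitivity (2 * al * \sum_(j < N.+2) (sin_mode N.+2 k j.+1 - sin_mode N.+2 k j) * g j).
    rewrite expr2 -mulrA; congr (_ * _); rewrite mulr_sumr; apply: eq_bigr => j _.
    by rewrite sin_mode_diff mulrA.
  rewrite abel_summation.
  have -> : sin_mode N.+2 k N.+2 = 0.
    by rewrite /sin_mode mulfK ?pnatr_eq0// sin_pi_nat.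
  have -> : sin_mode N.+2 k 0%N = 0 by rewrite /sin_mode mulr0 mul0r sin0.
  rewrite !mul0r subrr sub0r mulrN mulr_sumr; congr (- _).
  by apply: eq_bigr => j _; rewrite mulrA dct_mode_diff.
rewrite -(ger0_norm (sqr_ge0 (2 * al))) -normrM e normrN.
have -> : \sum_(j < N.+1) (v j - v j.+1) * (g j.+1 - g j) =
   - (\sum_(j < N.+1) (v j.+1 - v j) * (g j.+1 - g j)).
  by rewrite -sumrN; apply: eq_bigr => j _; rewrite -mulNr opprB.
rewrite (abel_summation v (fun j => g j.+1 - g j)) normrN.
have v1 j : `|v j| <= 1 := dct_mode_le1 _ _ _.
have -> : 2 * d1 + N%:R * d2 = d1 + d1 + N%:R * d2 by ring.
apply: le_trans (ler_normB _ _) _; apply: lerD.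
  apply: le_trans (ler_normB _ _) _; rewrite !normrM; apply: lerD.
    by rewrite -[leRHS]mul1r ler_pM// g1.
  by rewrite -[leRHS]mul1r ler_pM// g1.
apply: le_trans (ler_norm_sum _ _ _) _.
have -> : N%:R * d2 = \sum_(j < N) d2 by rewrite sumr_const card_ord mulr_natl.
apply: ler_sum => j _; rewrite normrM -[leRHS]mul1r ler_pM//.
exact: g2.
Qed.

(** The hypotheses are [C^2] bounds in units of [r], so neither [r] nor the mesh enters the result.
    First and second differences over the nodes are at most [mu / N.+1] and [mu / N.+1 ^ 2];
    summation by parts turns them into a total of 3, and the factor 2 of [dct_weight] makes 6. *)
Lemma dct_coef_decay N k (g g1 g2 : R -> R) (p r mu : R) : 0 < r ->
  (forall t, p <= t <= p + r -> is_derive t 1 g (g1 t)) ->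
  (forall t, p <= t <= p + r -> is_derive t 1 g1 (g2 t)) ->
  (forall t, p <= t <= p + r -> `|g t| <= mu) ->
  (forall t, p <= t <= p + r -> `|g1 t| <= mu / r) ->
  (forall t, p <= t <= p + r -> `|g2 t| <= mu / r / r) ->
  (k < N.+1)%N ->
  `|\sum_(j < N.+1) dct_weight R k / N.+1%:R * dct_mode N.+1 k (j%:R + 2^-1) *
     g (p + r * (j%:R + 2^-1) / N.+1%:R)| <=
  6 / (if k == 0%N then 1 else k%:R ^+ 2) * mu.
Proof.
move=> r0 dg dg1 bg bg1 bg2 kN.
pose N1 : R := N.+1%:R.
have N0 : 0 < N1 by rewrite ltr0n.
have mu0 : 0 <= mu by apply: le_trans (bg p _) => //; rewrite lexx lerDl ltW.
pose pt (j : nat) : R := p + r * (j%:R + 2^-1) / N1.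
pose h : R := r / N1.
have h0 : 0 < h by rewrite divr_gt0.
have ptS j : pt j.+1 = pt j + h by rewrite /pt /h -natr1; field; rewrite gt_eqF.
have pt_in j : (j < N.+1)%N -> p <= pt j <= p + r.
  move=> jN; rewrite /pt lerDl lerD2l; apply/andP; split.
    by rewrite divr_ge0 ?(ltW N0)// mulr_ge0 ?(ltW r0)// addr_ge0.
  rewrite ler_pdivrMr// ler_pM2l// /N1.
  have : (j%:R + 1 <= N.+1%:R :> R) by rewrite natr1 ler_nat.
  lra.
have [->|k0] := eqVneq k 0%N.
  rewrite divr1; apply: le_trans (ler_norm_sum _ _ _) _.
  apply: (@le_trans _ _ (\sum_(j < N.+1) mu / N1)).
    apply: ler_sum => j _; rewrite !normrM /dct_weight eqxx normr1 mul1r.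
    rewrite normfV (ger0_norm (ltW N0)) [leRHS]mulrC -mulrA ler_wpM2l ?invr_ge0 ?(ltW N0)//.
    by rewrite -[leRHS]mul1r ler_pM// ?dct_mode_le1// bg// pt_in.
  rewrite sumr_const card_ord -[_ *+ _]mulr_natr divfK ?gt_eqF//.
  by lra.
rewrite /dct_weight (negPf k0).
(* A nonzero mode forces at least two nodes, the form in which summation by parts is stated. *)
case: N => [|N] in N1 N0 kN pt h h0 ptS pt_in *; first by case: k k0 kN.
have k1 : (1 <= k%:R :> R) by rewrite ler1n lt0n.
under eq_bigr do rewrite -mulrA.
rewrite -mulr_sumr normrM (_ : `|2 / N.+2%:R| = 2 / N1); last first.
  by rewrite ger0_norm// divr_ge0// ltW.
have incl j t : (j <= N)%N -> pt j <= t <= pt j.+1 -> p <= t <= p + r.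
  move=> jN /andP[a b]; have /andP[c _] : p <= pt j <= p + r by apply: pt_in; lia.
  have /andP[_ d] : p <= pt j.+1 <= p + r by apply: pt_in; lia.
  by rewrite (le_trans c)//= (le_trans b).
have ler_pt j : pt j <= pt j.+1 by rewrite ptS lerDl ltW.
have d1 j : (j <= N)%N -> `|g (pt j.+1) - g (pt j)| <= mu / N1.
  move=> jN.
  have -> : mu / N1 = mu / r * (pt j.+1 - pt j).
    by rewrite ptS addrAC subrr add0r /h; field; rewrite !gt_eqF.
  apply: (mean_value_le (df := g1)); rewrite ?ler_pt// => t tj.
    by apply: dg; apply: incl tj.
  by apply: bg1; apply: incl tj.
have d2 j : (j < N)%N ->
    `|(g (pt j.+2) - g (pt j.+1)) - (g (pt j.+1) - g (pt j))| <= mu / N1 / N1.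
  move=> jN.
  have -> : mu / N1 / N1 = mu / N1 / r * (pt j.+1 - pt j).
    by rewrite ptS addrAC subrr add0r /h; field; rewrite !gt_eqF.
  suff : `|(g (pt j.+1 + h) - g (pt j.+1)) - (g (pt j + h) - g (pt j))| <=
      mu / N1 / r * (pt j.+1 - pt j) by rewrite -!ptS.
  have incl2 t : pt j <= t <= pt j.+1 -> p <= t <= p + r /\ p <= t + h <= p + r.
    move=> tj; split; first by apply: incl tj; lia.
    by apply: (incl j.+1); [lia|rewrite !ptS !lerD2r -ptS].
  (* The second difference is the increment over one mesh of [g (t + h) - g t], so the mean value
     inequality is used twice. *)
  apply: (mean_value_le (f := fun t => g (t + h) - g t)
    (df := fun t => g1 (t + h) - g1 t)); rewrite ?ler_pt// => t /incl2[t1 t2].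
    apply: is_deriveB; last exact: dg.
    have := @is_derive1_comp _ g (fun t => t + h) t (g1 (t + h)) 1.
    rewrite mulr1; apply; first exact: dg.
    by apply: is_derive_eq; rewrite addr0.
  have -> : mu / N1 / r = mu / r / r * ((t + h) - t).
    by rewrite addrAC subrr add0r /h; field; rewrite !gt_eqF.
  have th : t <= t + h by rewrite lerDl ltW.
  apply: (mean_value_le (df := g2)) => // s /andP[s1 s2].
    by apply: dg1; lra.
  by apply: bg2; lra.
have := dct_summation_by_parts k d1 d2.
set S := \sum_(i < N.+2) _; set al := sin _ => H.
have al1 : k%:R / N1 <= 2 * al.
  have pi2 := @pi_ge2 R; have pi0 := @pi_gt0 R.
  have k2 : k%:R / N1 <= pi * k%:R / N1 / 2.
    have -> : pi * k%:R / N1 / 2 = pi / 2 * (k%:R / N1) by ring.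
    by rewrite ler_peMl ?divr_ge0 ?(ltW N0)//; lra.
  apply: le_trans k2 _; rewrite [leRHS]mulrC -ler_pdivrMr//; apply: sin_ge_half.
  rewrite divr_ge0 ?divr_ge0 ?mulr_ge0 ?(ltW pi0) ?(ltW N0)//=.
  rewrite ler_pM2r// ler_pdivrMr// ler_pM2l// ler_nat ltnW//.
have al2 : (k%:R / N1) ^+ 2 <= (2 * al) ^+ 2.
  by rewrite ler_pXn2r// ?nnegrE ?divr_ge0// ?(ltW N0)// (le_trans _ al1)// divr_ge0// ltW.
have H2 : (k%:R / N1) ^+ 2 * `|S| <= 3 * mu / N1.
  apply: le_trans (ler_wpM2r _ al2) _ => //; apply: le_trans H _.
  have : N%:R * (mu / N1 / N1) <= mu / N1.
    rewrite mulrA ler_pdivrMr// [leRHS]mulrC ler_wpM2r ?divr_ge0 ?(ltW N0)//.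
    by rewrite ler_nat; lia.
  have -> : 3 * mu / N1 = 2 * (mu / N1) + mu / N1 by ring.
  by rewrite lerD2l.
have -> : 2 / N1 * `|S| = 2 * N1 / k%:R ^+ 2 * ((k%:R / N1) ^+ 2 * `|S|).
  by field; rewrite ?gt_eqF//; lra.
apply: le_trans (ler_wpM2l _ H2) _.
  by rewrite divr_ge0 ?mulr_ge0 ?(ltW N0)// sqr_ge0.
have -> // : 2 * N1 / k%:R ^+ 2 * (3 * mu / N1) = 6 / k%:R ^+ 2 * mu.
by field; rewrite ?gt_eqF//; lra.
Qed.

End CoefficientDecay.

(** * Trigonometric sums *)

Section RowVectors.
Variables (R : realType) (n : nat).
Implicit Types (x y v : 'rV[R]_n) (f : 'rV[R]_n -> R).

Lemma norm_coord_le x i : `|x 0 i| <= `|x|.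
Proof.
by rewrite [leRHS]/Num.norm /= mx_normrE; apply: (le_bigmax _ (fun ij => `|x ij.1 ij.2|) (0, i)).
Qed.

Lemma norm_row_le x (C : R) : 0 <= C -> (forall i, `|x 0 i| <= C) -> `|x| <= C.
Proof.
move=> C0 xC; rewrite [leLHS]/Num.norm /= mx_normrE; apply/bigmax_leP; split => //.
by move=> [i j] _ /=; rewrite (ord1 i).
Qed.

Lemma is_derive_line f x v (t d : R) :
  is_derive (t : R) 1 (fun s : R => f (x + s *: v)) d <-> is_derive (x + t *: v) v f d.
Proof.
have e : (fun h : R => h^-1 *: ((fun s : R => f (x + s *: v)) (h *: 1 + t) - f (x + t *: v))) =
   (fun h : R => h^-1 *: (f (h *: v + (x + t *: v)) - f (x + t *: v))).
  apply/funext => h; congr (_ *: (f _ - _)).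
  by rewrite [h *: 1]mulr1 scalerDl addrCA.
have eD : derivable (fun s : R => f (x + s *: v)) t 1 = derivable f (x + t *: v) v.
  by rewrite /derivable e.
have ed : 'D_1 (fun s : R => f (x + s *: v)) t = 'D_v f (x + t *: v).
  by rewrite /derive e.
split => -[h1 h2]; apply: DeriveDef.
- by rewrite -eD.
- by rewrite -ed.
- by rewrite eD.
- by rewrite ed.
Qed.

Lemma is_derive_mulc (V : normedModType R) (f : V -> R) (c : R) (x v : V) (d : R) :
  is_derive x v f d -> is_derive x v (fun z => c * f z) (c * d).
Proof. exact: is_deriveZ. Qed.

Lemma is_derive_cos_affine (a b t : R) :
  is_derive t 1 (fun s : R => cos (a * s + b)) (- sin (a * t + b) * a).
Proof.
apply: (@is_derive1_comp _ cos (fun s : R => a * s + b)).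
by apply: is_derive_eq; rewrite addr0 [_ *: _]mulr1.
Qed.

Lemma delta_mxE0 (i j : 'I_n) : (delta_mx 0 i : 'rV[R]_n) 0 j = (j == i)%:R.
Proof. by rewrite mxE eqxx. Qed.

Definition dotv x y : R := \sum_i x 0 i * y 0 i.

Lemma dotvDl x y v : dotv (x + y) v = dotv x v + dotv y v.
Proof. by rewrite -big_split; apply: eq_bigr => i _; rewrite mxE mulrDl. Qed.

Lemma dotvNl x v : dotv (- x) v = - dotv x v.
Proof. by rewrite -sumrN; apply: eq_bigr => i _; rewrite mxE mulNr. Qed.

Lemma dotvC x y : dotv x y = dotv y x.
Proof. by apply: eq_bigr => i _; rewrite mulrC. Qed.

Lemma dotvDr x y v : dotv v (x + y) = dotv v x + dotv v y.
Proof. by rewrite dotvC dotvDl !(dotvC v). Qed.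

Lemma dotvZl a x v : dotv (a *: x) v = a * dotv x v.
Proof. by rewrite mulr_sumr; apply: eq_bigr => i _; rewrite mxE mulrA. Qed.

Lemma dotvZr a x v : dotv x (a *: v) = a * dotv x v.
Proof. by rewrite dotvC dotvZl dotvC. Qed.

Lemma dotv_delta x i : dotv x (delta_mx 0 i) = x 0 i.
Proof.
rewrite /dotv (bigD1 i)//= big1 ?addr0; first by rewrite delta_mxE0 eqxx mulr1.
by move=> j ji; rewrite delta_mxE0 (negPf ji) mulr0.
Qed.

Lemma dotv_le x y : `|dotv x y| <= n%:R * (`|x| * `|y|).
Proof.
apply: le_trans (ler_norm_sum _ _ _) _.
apply: (@le_trans _ _ (\sum_(i < n) `|x| * `|y|)).
  by apply: ler_sum => i _; rewrite normrM ler_pM// norm_coord_le.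
by rewrite sumr_const card_ord mulr_natl.
Qed.

End RowVectors.

(** * Finite sums of waves and their submultiplicative norm *)

Section TrigSums.
Variables (R : realType) (n : nat).
Implicit Types (q : R) (x y m th : 'rV[R]_n).

(* [(c, m, p)] stands for the wave [c * cos (q * <m, x> + p)]. *)
Definition wave : Type := (R * 'rV[R]_n * R)%type.
Implicit Types (w : wave) (l : seq wave).

Definition wave_at q x w : R := w.1.1 * cos (q * dotv w.1.2 x + w.2).

Definition trig q l x : R := \sum_(w <- l) wave_at q x w.

(* The square root is a compromise: cosine coefficients only decay like [1 / k^2], too slowly for a weight linear in the frequency, while a Hoelder modulus is needed to pass to the limit. *)
Definition freq_weight m : R := Num.sqrt (1 + `|m|).

Definition wave_norm w : R := `|w.1.1| * freq_weight w.1.2.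

Definition trig_norm l : R := \sum_(w <- l) wave_norm w.

Definition freqs th l : Prop :=
  forall w, w \in l -> forall i, w.1.2 0 i - th 0 i \is a Num.int.

(** For [s = 1] and [s = -1], the two waves of the product-to-sum formula. *)
Definition wave_mul (s : R) w1 w2 : wave :=
  (2^-1 * (w1.1.1 * w2.1.1), w1.1.2 + s *: w2.1.2, w1.2 + s * w2.2).

Definition trig_mul l1 l2 : seq wave :=
  [seq wave_mul 1 w1 w2 | w1 <- l1, w2 <- l2] ++
  [seq wave_mul (-1) w1 w2 | w1 <- l1, w2 <- l2].

Definition wave_scale (c : wave -> R) w : wave := (c w * w.1.1, w.1.2, w.2).

Lemma freq_weight_ge1 m : 1 <= freq_weight m.
Proof. by rewrite /freq_weight -[leLHS]sqrtr1 ler_sqrt ?lerDl ?addr_ge0. Qed.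

Lemma freq_weight_gt0 m : 0 < freq_weight m.
Proof. exact: lt_le_trans ltr01 (freq_weight_ge1 m). Qed.

(** [1 + |m1 + s m2|] is at most [(1 + |m1|) (1 + |m2|)], and the square root is multiplicative.
    This makes [trig_norm] submultiplicative. *)
Lemma freq_weightM m1 m2 (s : R) : `|s| = 1 ->
  freq_weight (m1 + s *: m2) <= freq_weight m1 * freq_weight m2.
Proof.
move=> s1; rewrite -sqrtrM ?addr_ge0// ler_sqrt ?mulr_ge0 ?addr_ge0//.
have := ler_normD m1 (s *: m2); rewrite normrZ s1 mul1r => h.
by have := mulr_ge0 (normr_ge0 m1) (normr_ge0 m2); nra.
Qed.

Lemma wave_norm_ge0 w : 0 <= wave_norm w.
Proof. by rewrite mulr_ge0// ltW// freq_weight_gt0. Qed.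

Lemma trig_norm_ge0 l : 0 <= trig_norm l.
Proof. by apply: sumr_ge0 => w _; exact: wave_norm_ge0. Qed.

Lemma trig_cat q l1 l2 x : trig q (l1 ++ l2) x = trig q l1 x + trig q l2 x.
Proof. by rewrite /trig big_cat. Qed.

Lemma trig_norm_cat l1 l2 : trig_norm (l1 ++ l2) = trig_norm l1 + trig_norm l2.
Proof. by rewrite /trig_norm big_cat. Qed.

Lemma trig_mulE q l1 l2 x : trig q (trig_mul l1 l2) x = trig q l1 x * trig q l2 x.
Proof.
rewrite /trig_mul trig_cat /trig !big_allpairs_dep mulr_suml -big_split/=.
apply: eq_bigr => w1 _; rewrite mulr_sumr -big_split/=.
apply: eq_bigr => w2 _; rewrite /wave_at /wave_mul/=.
set c1 := w1.1.1; set c2 := w2.1.1.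
set A := q * dotv w1.1.2 x + w1.2; set B := q * dotv w2.1.2 x + w2.2.
transitivity (c1 * c2 * (cos A * cos B)); last by ring.
rewrite cosM_prod !dotvDl !dotvZl.
have -> : q * (dotv w1.1.2 x + 1 * dotv w2.1.2 x) + (w1.2 + 1 * w2.2) = A + B.
  by rewrite /A /B; ring.
have -> : q * (dotv w1.1.2 x + -1 * dotv w2.1.2 x) + (w1.2 + -1 * w2.2) = A - B.
  by rewrite /A /B; ring.
by ring.
Qed.

Lemma wave_norm_mul (s : R) w1 w2 : `|s| = 1 ->
  wave_norm (wave_mul s w1 w2) <= 2^-1 * (wave_norm w1 * wave_norm w2).
Proof.
move=> s1; rewrite /wave_norm /wave_mul/= !normrM (ger0_norm (x := 2^-1))//.
rewrite -mulrA ler_wpM2l// mulrACA ler_wpM2l ?mulr_ge0//.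
exact: freq_weightM.
Qed.

Lemma trig_norm_mul l1 l2 : trig_norm (trig_mul l1 l2) <= trig_norm l1 * trig_norm l2.
Proof.
rewrite /trig_mul trig_norm_cat /trig_norm !big_allpairs_dep mulr_suml -big_split/=.
apply: ler_sum => w1 _; rewrite mulr_sumr -big_split/=.
apply: ler_sum => w2 _.
have := @wave_norm_mul 1 w1 w2 (normr1 _).
have := @wave_norm_mul (-1) w1 w2 (normrN1 _).
by set a := wave_norm _ * _; lra.
Qed.

Lemma freqs_cat th l1 l2 : freqs th l1 -> freqs th l2 -> freqs th (l1 ++ l2).
Proof. by move=> h1 h2 w; rewrite mem_cat => /orP[/h1|/h2]. Qed.

(** Sums over [th + Z^n] form a module over those with integer frequencies: multiplying by
    coefficients never leads back to frequency 0. *)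
Lemma freqs_mul th l1 l2 : freqs th l1 -> freqs 0 l2 -> freqs th (trig_mul l1 l2).
Proof.
move=> h1 h2; apply: freqs_cat => w /allpairsP[[w1 w2]/= [/h1 i1 /h2 i2 ->]] i;
  have := rpredD (i1 i) (i2 i); have := rpredB (i1 i) (i2 i);
  rewrite /= !mxE subr0 ?mul1r ?mulN1r.
  by move=> _; rewrite addrAC.
by move=> + _; rewrite addrAC.
Qed.

Lemma freqs_map th (f : wave -> wave) l : (forall w, (f w).1.2 = w.1.2) ->
  freqs th l -> freqs th (map f l).
Proof. by move=> fE h w /mapP[w' /h i ->] j; rewrite fE. Qed.

Lemma freqs_flatten th (ls : seq (seq wave)) : (forall l, l \in ls -> freqs th l) ->
  freqs th (flatten ls).
Proof. by move=> h w /flattenP[l /h]; apply. Qed.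

Lemma trig_flatten q (ls : seq (seq wave)) x :
  trig q (flatten ls) x = \sum_(l <- ls) trig q l x.
Proof. by rewrite /trig big_flatten. Qed.

Lemma trig_norm_flatten (ls : seq (seq wave)) :
  trig_norm (flatten ls) = \sum_(l <- ls) trig_norm l.
Proof. by rewrite /trig_norm big_flatten. Qed.

Lemma trig_norm_map (f : wave -> wave) (C : R) l :
  (forall w, w \in l -> wave_norm (f w) <= C * wave_norm w) ->
  trig_norm (map f l) <= C * trig_norm l.
Proof.
move=> h; rewrite /trig_norm big_map mulr_sumr big_seq [leRHS]big_seq.
exact: ler_sum.
Qed.

Lemma trig_le q l x : `|trig q l x| <= trig_norm l.
Proof.
apply: le_trans (ler_norm_sum _ _ _) _; apply: ler_sum => w _.
rewrite normrM; apply: ler_wpM2l => //.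
exact: le_trans (cos_max _) (freq_weight_ge1 _).
Qed.

(** Product of the Lipschitz bound and the trivial bound 2; interpolating between them leaves a
    square root of the frequency. *)
Lemma cos_dist_sqr_le (s t : R) : (cos s - cos t) ^+ 2 <= 2 * `|s - t|.
Proof.
have h1 : `|cos s - cos t| <= `|s - t|.
  wlog st : s t / t <= s => [hw|].
    case: (leP t s) => [/hw//|/ltW/hw]; by rewrite distrC [leRHS]distrC.
  rewrite [leRHS]ger0_norm ?subr_ge0// -[leRHS]mul1r.
  apply: (@mean_value_le _ cos (fun u => - sin u)) => // u _.
  by rewrite normrN sin_max.
have h2 : `|cos s - cos t| <= 2.
  by apply: le_trans (ler_normB _ _) _; rewrite -[leRHS]/(1 + 1) lerD ?cos_max.
by rewrite -real_normK ?num_real// expr2 ler_pM.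
Qed.

(** The phase of a wave varies by at most [q * n * |m| * |x - y|], and the square root of [|m|] left
    by [cos_dist_sqr_le] is absorbed by [freq_weight]. *)
Lemma trig_holder q l x y : 0 <= q ->
  `|trig q l x - trig q l y| <= trig_norm l * Num.sqrt (2 * q * n%:R * `|x - y|).
Proof.
move=> q0; rewrite /trig -sumrB; apply: le_trans (ler_norm_sum _ _ _) _.
rewrite /trig_norm mulr_suml; apply: ler_sum => w _.
rewrite /wave_at -mulrBr normrM /wave_norm -[leRHS]mulrA ler_wpM2l//.
set c := cos _ - cos _.
have K0 : 0 <= 2 * q * n%:R * `|x - y| by rewrite !mulr_ge0.
rewrite -sqrtrM ?addr_ge0// -sqrtr_sqr ler_sqrt ?mulr_ge0 ?addr_ge0//.
apply: le_trans (cos_dist_sqr_le _ _) _.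
have -> : q * dotv w.1.2 x + w.2 - (q * dotv w.1.2 y + w.2) = q * dotv w.1.2 (x - y).
  by rewrite dotvDr (dotvC _ (- y)) dotvNl (dotvC y); ring.
rewrite normrM (ger0_norm q0).
have -> : 2 * q * n%:R * `|x - y| = 2 * q * (n%:R * `|x - y|) by ring.
rewrite [leLHS]mulrA [leRHS]mulrCA ler_wpM2l ?mulr_ge0//.
apply: le_trans (dotv_le _ _) _; rewrite mulrCA ler_wpM2r ?mulr_ge0//.
by rewrite lerDr.
Qed.

(** Differentiation as a phase shift by [pi / 2]: derivatives remain waves, of the same
    frequency. *)
Definition wave_diff q i w : wave := (q * w.1.2 0 i * w.1.1, w.1.2, w.2 + pi / 2).

Lemma is_derive_trig q i l x :
  is_derive x (delta_mx 0 i) (trig q l) (trig q (map (wave_diff q i) l) x).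
Proof.
rewrite -[x in is_derive x]addr0 -[X in _ + X](scale0r (delta_mx 0 i)).
apply/is_derive_line.
elim: l => [|w l IH].
  rewrite /trig big_nil; under eq_fun do rewrite big_nil.
  exact: is_derive_cst.
rewrite /trig /= big_cons; under eq_fun do rewrite big_cons.
apply: (is_deriveD _ IH).
rewrite /wave_at /wave_diff/= addrA cosDpihalf.
set a := q * w.1.2 0 i; set b := q * dotv w.1.2 x + w.2.
have -> : (fun s : R => w.1.1 * cos (q * dotv w.1.2 (x + s *: delta_mx 0 i) + w.2)) =
    (fun s : R => w.1.1 * cos (a * s + b)).
  apply/funext => s /=; rewrite dotvDr dotvZr dotv_delta; congr (_ * cos _).
  by rewrite /a /b; ring.
have := is_derive_mulc w.1.1 (is_derive_cos_affine a b 0).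
rewrite mulr0 add0r => h; apply: (is_derive_eq h).
by rewrite /a; ring.
Qed.

End TrigSums.

(** * Interpolation on a cube *)

Lemma is_derive_bigsum (R : realType) (V : normedModType R) (N : nat)
    (f : 'I_N -> V -> R) (d : 'I_N -> R) (x v : V) :
  (forall j, is_derive x v (f j) (d j)) ->
  is_derive x v (fun z => \sum_(j < N) f j z) (\sum_(j < N) d j).
Proof.
move=> h; have -> : (fun z => \sum_(j < N) f j z) = \sum_(j < N) f j.
  by apply/funext => z; rewrite fct_sumE.
exact: is_derive_sum.
Qed.

(** For [k > 0] the summand without its factor 6 is at most 8 times the telescoping difference of
    [k ^ (-1/2)], so these terms sum to at most 48; the term [k = 0] adds 6. *)
Lemma decay_sum_le (R : realType) N :
  \sum_(k < N) 6 / (if k == 0%N :> nat then 1 else k%:R ^+ 2) * Num.sqrt (1 + k%:R) <=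
  54 :> R.
Proof.
pose a k : R := (Num.sqrt k.+1%:R)^-1.
have step k : Num.sqrt (1 + k.+1%:R) / k.+1%:R ^+ 2 <= 8 * (a k - a k.+1).
  rewrite /a addrC natr1; set s := Num.sqrt k.+1%:R; set t := Num.sqrt k.+2%:R.
  have s0 : 0 < s by rewrite sqrtr_gt0 ltr0n.
  have t0 : 0 < t by rewrite sqrtr_gt0 ltr0n.
  have s2 : s ^+ 2 = k.+1%:R by rewrite sqr_sqrtr.
  have t2 : t ^+ 2 = s ^+ 2 + 1 by rewrite s2 natr1 sqr_sqrtr.
  have s1 : 1 <= s ^+ 2 by rewrite s2 ler1n.
  rewrite -s2; have -> : 8 * (s^-1 - t^-1) = 8 * (t - s) / (s * t).
    by field; rewrite !gt_eqF.
  rewrite ler_pdivrMr ?exprn_gt0// mulrAC ler_pdivlMr ?mulr_gt0//.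
  have st : s <= t by rewrite -ler_sqr ?nnegrE ?ltW// t2; lra.
  have t2s : t ^+ 2 <= 2 * s ^+ 2 by lra.
  have ts2 : t <= 2 * s by rewrite -ler_sqr ?nnegrE ?mulr_ge0 ?ltW// exprMn; lra.
  have e : (t - s) * (t + s) = 1 by rewrite -subr_sqr t2; ring.
  have d0 : 0 <= t - s by rewrite subr_ge0.
  (* Multiplied by [t - s], this becomes the claim, since [(t - s) * (t + s) = 1]. *)
  suff : t * t * (t + s) <= 8 * (s ^+ 2 * s).
    move=> h; have := ler_wpM2r d0 h.
    have -> : t * t * (t + s) * (t - s) = t * t * ((t - s) * (t + s)) by ring.
    rewrite e mulr1 => h2.
    have -> : t * (s * t) = s * (t * t) by ring.
    have -> : 8 * (t - s) * (s ^+ 2) ^+ 2 = s * (8 * (s ^+ 2 * s) * (t - s)) by ring.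
    by rewrite ler_wpM2l// ltW.
  have -> : t * t = t ^+ 2 by [].
  have h3 : t + s <= 3 * s by lra.
  apply: (@le_trans _ _ (2 * s ^+ 2 * (3 * s))).
    by rewrite ler_pM ?sqr_ge0// addr_ge0// ltW.
  have : 0 <= s ^+ 2 * s by rewrite mulr_ge0 ?sqr_ge0// ltW.
  by lra.
case: N => [|N]; first by rewrite big_ord0.
rewrite big_ord_recl /= addr0 sqrtr1 divr1 mulr1.
have -> : \sum_(i < N) 6 / (lift ord0 i)%:R ^+ 2 * Num.sqrt (1 + (lift ord0 i)%:R) =
    6 * \sum_(i < N) (Num.sqrt (1 + i.+1%:R) / i.+1%:R ^+ 2) :> R.
  by rewrite mulr_sumr; apply: eq_bigr => i _; rewrite lift0 -mulrA; congr (_ * _); rewrite mulrC.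
have h : \sum_(i < N) (Num.sqrt (1 + i.+1%:R) / i.+1%:R ^+ 2) <= 8 * (a 0%N - a N).
  apply: (@le_trans _ _ (\sum_(i < N) 8 * (a i - a i.+1))).
    by apply: ler_sum => i _; exact: step.
  rewrite -mulr_sumr ler_wpM2l//; elim: N => [|N IH]; first by rewrite big_ord0 subrr.
  by rewrite big_ord_recr/=; lra.
have a0 : a 0%N = 1 by rewrite /a sqrtr1 invr1.
have aN : 0 <= a N by rewrite invr_ge0 sqrtr_ge0.
by rewrite a0 in h; lra.
Qed.

Section Interpolation.
Variables (R : realType) (n : nat) (r : R) (p : 'rV[R]_n).
Hypothesis r0 : 0 < r.
Implicit Types (x y : 'rV[R]_n) (G : 'rV[R]_n -> R) (i : 'I_n) (k N : nat).

Definition cube : set 'rV[R]_n := [set x | forall i, p 0 i <= x 0 i <= p 0 i + r].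

(** All derivatives of order [j <= m], mixed ones included, are bounded by [mu / r ^ j] on the cube:
    a [C^m] bound after rescaling the cube to unit side. *)
Fixpoint scaled_bound (m : nat) (mu : R) G : Prop :=
  (forall x, cube x -> `|G x| <= mu) /\
  (if m is m'.+1 then
     forall i, (forall x, cube x -> derivable G x (delta_mx 0 i)) /\
       scaled_bound m' (mu / r) (pderiv i G)
   else True).

Lemma scaled_bound0 m mu G : scaled_bound m mu G -> forall x, cube x -> `|G x| <= mu.
Proof. by case: m => [|m] []. Qed.

Lemma scaled_boundS m mu G : scaled_bound m.+1 mu G -> scaled_bound m mu G.
Proof.
elim: m mu G => [|m IH] mu G [h1 h2]; split => // i.
by have [h3 h4] := h2 i; split => //; apply: IH.
Qed.

Definition upd x i (t : R) : 'rV[R]_n := \row_j (if j == i then t else x 0 j).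

Lemma updC x i j (s t : R) : i != j -> upd (upd x i s) j t = upd (upd x j t) i s.
Proof.
move=> ij; apply/rowP => l; rewrite !mxE.
by case: eqVneq => [->|//]; rewrite eq_sym (negPf ij).
Qed.

Lemma upd_line x i (t : R) : upd x i t = upd x i 0 + t *: delta_mx 0 i.
Proof.
apply/rowP => j; rewrite !mxE eqxx /=.
by case: eqP => _; rewrite ?mulr1 ?mulr0 ?add0r ?addr0.
Qed.

Lemma cube_upd x i (t : R) : cube x -> p 0 i <= t <= p 0 i + r -> cube (upd x i t).
Proof. by move=> xQ tQ j; rewrite mxE; case: eqP => [->|]. Qed.

Definition node N i (j : nat) : R := p 0 i + r * (j%:R + 2^-1) / N.+1%:R.

Lemma node_itv N i j : (j < N.+1)%N -> p 0 i <= node N i j <= p 0 i + r.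
Proof.
move=> jN; have N0 : (0 : R) < N.+1%:R by rewrite ltr0n.
rewrite /node lerDl lerD2l; apply/andP; split.
  by rewrite divr_ge0 ?(ltW N0)// mulr_ge0 ?(ltW r0)// addr_ge0.
rewrite ler_pdivrMr// ler_pM2l//.
have : (j%:R + 1 <= N.+1%:R :> R) by rewrite natr1 ler_nat.
by lra.
Qed.

Definition dct_coef N i k G x : R :=
  \sum_(j < N.+1) dct_weight R k / N.+1%:R * dct_mode N.+1 k (j%:R + 2^-1) *
    G (upd x i (node N i j)).

(** A coefficient of the multidimensional transform; the coordinates outside [ks] remain as
    parameters. *)
Definition dct_coefs N (ks : seq ('I_n * nat)) G : 'rV[R]_n -> R :=
  foldr (fun ik H => dct_coef N ik.1 ik.2 H) G ks.

(** Averaging over nodes in other coordinates commutes with differentiation along [i]. *)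
Lemma dct_coefs_derive N ks G x i (t : R) : i \notin map fst ks ->
  (forall y, cube y -> derivable G y (delta_mx 0 i)) ->
  cube x -> p 0 i <= t <= p 0 i + r ->
  is_derive t 1 (fun s => dct_coefs N ks G (upd x i s))
    (dct_coefs N ks (pderiv i G) (upd x i t)).
Proof.
move=> + dG + tQ; elim: ks x => [|[i' k] ks IH] x /= iks xQ.
  under eq_fun do rewrite upd_line.
  apply/is_derive_line; rewrite -upd_line.
  by apply/derivableP/dG/cube_upd.
move: iks; rewrite inE negb_or => /andP[ii' iks].
apply: is_derive_bigsum => j; apply: is_derive_mulc.
under eq_fun do rewrite updC//.
rewrite updC//.
apply: IH => //; apply: cube_upd => //.
exact: node_itv.
Qed.

Definition decay k : R := 6 / (if k == 0%N then 1 else k%:R ^+ 2).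

Lemma decay_ge0 k : 0 <= decay k.
Proof. by rewrite divr_ge0//; case: ifP => // _; rewrite sqr_ge0. Qed.

(** One coordinate at a time: each costs two derivatives of [G], hence the order [2 * size ks], and
    contributes one decay factor. *)
Lemma dct_coefs_le N ks G mu x : uniq (map fst ks) ->
  (forall ik, ik \in ks -> (ik.2 < N.+1)%N) ->
  scaled_bound (2 * size ks) mu G -> cube x ->
  `|dct_coefs N ks G x| <= (\prod_(ik <- ks) decay ik.2) * mu.
Proof.
elim: ks G mu x => [|[i k] ks IH] G mu x.
  by move=> _ _ [h _] xQ; rewrite big_nil mul1r; exact: h.
rewrite [uniq _]/= [size _]/= mulnS add2n => /andP[iks uks] ksN bG xQ.
have ksN' ik : ik \in ks -> (ik.2 < N.+1)%N.
  by move=> h; apply: ksN; rewrite inE h orbT.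
have [_ /(_ i)[dG bG1]] := bG.
have [_ /(_ i)[dG1 bG2]] := bG1.
have bG0 := scaled_boundS (scaled_boundS bG).
have bG1' := scaled_boundS bG1.
rewrite big_cons -mulrA.
apply: (@dct_coef_decay _ N k (fun t => dct_coefs N ks G (upd x i t))
  (fun t => dct_coefs N ks (pderiv i G) (upd x i t))
  (fun t => dct_coefs N ks (pderiv i (pderiv i G)) (upd x i t)) _ r) => //.
- by move=> t tQ; apply: dct_coefs_derive.
- by move=> t tQ; apply: dct_coefs_derive.
- by move=> t tQ; apply: IH => //; apply: cube_upd.
- by move=> t tQ; rewrite -mulrA; apply: IH => //; apply: cube_upd.
- by move=> t tQ; rewrite -!mulrA (mulrA mu); apply: IH => //; apply: cube_upd.
- by apply: (ksN (i, k)); rewrite inE eqxx.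
Qed.

Fixpoint multi_indices N (S : seq 'I_n) : seq (seq ('I_n * nat)) :=
  if S is i :: S' then [seq (i, k) :: ks | k <- iota 0 N.+1, ks <- multi_indices N S']
  else [:: [::]].

Lemma multi_indices_cons N i S : multi_indices N (i :: S) =
  [seq (i, k) :: ks | k <- index_iota 0 N.+1, ks <- multi_indices N S].
Proof. by []. Qed.

Lemma multi_indicesP N S ks : ks \in multi_indices N S ->
  map fst ks = S /\ forall ik, ik \in ks -> (ik.2 < N.+1)%N.
Proof.
elim: S ks => [|i S IH] ks; first by rewrite inE => /eqP->.
rewrite multi_indices_cons => /allpairsP[[k ks']/= [kN /IH[<- h] ->]]; split => // ik.
rewrite inE => /orP[/eqP->/=|/h//].
by move: kN; rewrite mem_index_iota.
Qed.

Fixpoint set_nodes N (j : 'I_n -> nat) (S : seq 'I_n) x : 'rV[R]_n :=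
  if S is i :: S' then set_nodes N j S' (upd x i (node N i (j i))) else x.

Lemma set_nodesE N j S x i :
  set_nodes N j S x 0 i = if i \in S then node N i (j i) else x 0 i.
Proof.
elim: S x => [|i' S IH] x //=; rewrite IH inE mxE.
by case: (i \in S); rewrite ?orbT// orbF; case: eqP => [->|].
Qed.

(** By induction on the coordinates, [dct_completeness] collapses each sum over modes to the chosen
    node. *)
Lemma multi_indices_interp N (j : 'I_n -> nat) S G x : (forall i, (j i < N.+1)%N) ->
  \sum_(ks <- multi_indices N S)
    (\prod_(ik <- ks) dct_mode N.+1 ik.2 ((j ik.1)%:R + 2^-1)) * dct_coefs N ks G x =
  G (set_nodes N j S x).
Proof.
move=> jN; elim: S x => [|i S IH] x.
  by rewrite big_seq1 big_nil mul1r.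
pose y l := upd x i (node N i l).
rewrite multi_indices_cons big_allpairs_dep big_mkord.
transitivity (\sum_(l < N.+1) G (set_nodes N j S (y l)) *
   (\sum_(k < N.+1) dct_weight R k * dct_mode N.+1 k ((Ordinal (jN i))%:R + 2^-1)
     * dct_mode N.+1 k (l%:R + 2^-1) / N.+1%:R)).
  under [RHS]eq_bigr do rewrite mulr_sumr.
  rewrite [RHS]exchange_big /=; apply: eq_bigr => k _.
  transitivity (\sum_(ks <- multi_indices N S) \sum_(l < N.+1)
     (dct_weight R k * dct_mode N.+1 k ((j i)%:R + 2^-1)
     * dct_mode N.+1 k (l%:R + 2^-1) / N.+1%:R) *
      (\prod_(ik <- ks) dct_mode N.+1 ik.2 ((j ik.1)%:R + 2^-1)
        * dct_coefs N ks G (y l))).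
    apply: eq_bigr => ks _; rewrite big_cons /dct_coef mulr_sumr.
    by apply: eq_bigr => l _; rewrite -/(y l) /=; ring.
  rewrite exchange_big /=; apply: eq_bigr => l _.
  by rewrite -mulr_sumr IH mulrC.
transitivity (\sum_(l < N.+1) (if l == Ordinal (jN i) then G (set_nodes N j S (y l)) else 0)).
  apply: eq_bigr => l _; rewrite -mulr_suml dct_completeness eq_sym.
  case: eqP => _; last by rewrite mulr0n mul0r mulr0.
  by rewrite mulr1n mulfV ?mulr1// pnatr_eq0.
by rewrite -big_mkcond /= big_pred1_eq.
Qed.

(** Unit of frequency for period [2 * r]: cosines of its multiples in [x 0 i - p 0 i] are even about
    both faces of the cube. *)
Definition base_freq : R := pi / r.

Definition mode_wave (ik : 'I_n * nat) : wave R n :=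
  (1, ik.2%:R *: delta_mx 0 ik.1, - (base_freq * ik.2%:R * p 0 ik.1)).

Definition mode_product (ks : seq ('I_n * nat)) : seq (wave R n) :=
  foldr (fun ik l => trig_mul l [:: mode_wave ik]) [:: (1, 0, 0)] ks.

Lemma mode_productE ks x : trig base_freq (mode_product ks) x =
  \prod_(ik <- ks) wave_at base_freq x (mode_wave ik).
Proof.
elim: ks => [|ik ks IH] /=.
  rewrite big_nil /trig big_seq1 /wave_at /= /dotv big1 ?mulr0 ?addr0 ?cos0 ?mulr1//.
  by move=> i _; rewrite mxE mul0r.
by rewrite big_cons trig_mulE IH mulrC /trig big_seq1.
Qed.

Lemma freqs_mode_product ks : freqs 0 (mode_product ks).
Proof.
elim: ks => [|ik ks IH] /=.
  by move=> w; rewrite inE => /eqP-> i /=; rewrite subrr.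
apply: freqs_mul => // w; rewrite inE => /eqP-> i /=; rewrite !mxE subr0.
by rewrite rpredM// natr_int.
Qed.

Lemma trig_norm_mode_product ks :
  trig_norm (mode_product ks) <= \prod_(ik <- ks) Num.sqrt (1 + ik.2%:R).
Proof.
elim: ks => [|ik ks IH] /=.
  by rewrite big_nil /trig_norm big_seq1 /wave_norm /= /freq_weight normr1 normr0 addr0 sqrtr1 mulr1.
apply: le_trans (trig_norm_mul _ _) _; rewrite big_cons [leRHS]mulrC.
apply: ler_pM; rewrite ?trig_norm_ge0//.
rewrite /trig_norm big_seq1 /wave_norm /= normr1 mul1r ler_sqrt ?addr_ge0//.
rewrite lerD2l; apply: norm_row_le => // i; rewrite !mxE eqxx /=.
by case: eqP => _; rewrite ?mulr1 ?mulr0 ?normr0 ?normr_nat.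
Qed.

Definition interpolant N G (x : 'rV[R]_n) : seq (wave R n) :=
  flatten [seq [seq wave_scale (fun=> dct_coefs N ks G x) w | w <- mode_product ks]
    | ks <- multi_indices N (enum 'I_n)].

Lemma freqs_interpolant N G x : freqs 0 (interpolant N G x).
Proof.
apply: freqs_flatten => l /mapP[ks _ ->].
by apply: freqs_map => //; exact: freqs_mode_product.
Qed.

Lemma interpolantE N G x (j : 'I_n -> nat) : (forall i, (j i < N.+1)%N) ->
  let g := \row_i node N i (j i) in trig base_freq (interpolant N G x) g = G g.
Proof.
move=> jN g; rewrite /interpolant trig_flatten big_map.
have eg : g = set_nodes N j (enum 'I_n) x.
  by apply/rowP => i; rewrite set_nodesE mxE mem_enum.
rewrite [in RHS]eg -multi_indices_interp//; apply: eq_bigr => ks _.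
rewrite /trig big_map.
transitivity (dct_coefs N ks G x * trig base_freq (mode_product ks) g).
  by rewrite /trig mulr_sumr; apply: eq_bigr => w _; rewrite /wave_at/= mulrA.
rewrite mulrC mode_productE; congr (_ * _); apply: eq_bigr => -[i k] _ /=.
rewrite /wave_at /mode_wave /dct_mode mul1r /= dotvC dotvZr dotv_delta mxE; congr cos.
have rn0 : r != 0 by rewrite gt_eqF.
have Nn0 : (N.+1%:R : R) != 0 by rewrite pnatr_eq0.
by rewrite /base_freq /node; field; rewrite rn0 addrC natr1 Nn0.
Qed.

(** The sum over multi-indices factors into [n] sums over one index, each at most 54 by
    [decay_sum_le], whatever the mesh. *)
Lemma trig_norm_interpolant N G x mu : 0 <= mu -> scaled_bound (2 * n) mu G -> cube x ->
  trig_norm (interpolant N G x) <= 54 ^+ n * mu.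
Proof.
move=> mu0 bG xQ; rewrite trig_norm_flatten big_map.
apply: (@le_trans _ _ (\sum_(ks <- multi_indices N (enum 'I_n))
   (\prod_(ik <- ks) (decay ik.2 * Num.sqrt (1 + ik.2%:R))) * mu)).
  rewrite big_seq [leRHS]big_seq; apply: ler_sum => ks /multi_indicesP[ksE ksN].
  apply: (@le_trans _ _ (`|dct_coefs N ks G x| * trig_norm (mode_product ks))).
    apply: trig_norm_map => w _; rewrite /wave_norm /wave_scale /= normrM.
    by rewrite mulrA.
  have sz : size ks = n by rewrite -(size_map fst) ksE size_enum_ord.
  have h1 := @dct_coefs_le N ks G mu x.
  rewrite ksE enum_uniq sz in h1; have {}h1 := h1 isT ksN bG xQ.
  rewrite big_split /= mulrAC; apply: ler_pM; rewrite ?trig_norm_ge0//.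
  exact: trig_norm_mode_product.
rewrite -mulr_suml; apply: ler_wpM2r => //.
rewrite -[in leRHS](size_enum_ord n).
elim: (enum 'I_n) => [|i S IH]; first by rewrite big_seq1 big_nil.
rewrite multi_indices_cons big_allpairs_dep big_mkord.
under eq_bigr do under eq_bigr do rewrite big_cons.
under eq_bigr do rewrite -mulr_sumr.
rewrite -mulr_suml exprS; apply: ler_pM => //.
- by apply: sumr_ge0 => k _; rewrite mulr_ge0 ?decay_ge0.
- by apply: sumr_ge0 => ks _; apply: prodr_ge0 => ik _; rewrite mulr_ge0 ?decay_ge0.
- exact: decay_sum_le.
Qed.

End Interpolation.

(** * Differential calculus in R^n *)

Section Calculus.
Variables (R : realType) (n : nat).
Implicit Types (x y z v : 'rV[R]_n) (f : 'rV[R]_n -> R) (i : 'I_n).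

Lemma is_derive_of_bound f x v (d : R) :
  (forall e, 0 < e -> exists2 del, 0 < del &
     forall h : R, `|h| < del -> `|f (x + h *: v) - f x - h * d| <= e * `|h|) ->
  is_derive x v f d.
Proof.
move=> H.
have L : (fun h : R => h^-1 *: (f (h *: v + x) - f x)) @ 0^' --> d.
  apply/cvgrPdist_le => e e0; have [del del0 Hd] := H _ e0.
  near=> h.
  have h0 : h != 0 by near: h; exact: nbhs_dnbhs_neq.
  have hd : `|h| < del by near: h; exact: dnbhs0_lt.
  have := Hd _ hd; rewrite (addrC x) => Hh.
  have -> : d - h^-1 *: (f (h *: v + x) - f x) =
      - (h^-1 * (f (h *: v + x) - f x - h * d)).
    by rewrite mulrBr mulrA mulVf// mul1r opprB.
  by rewrite normrN normrM normfV mulrC ler_pdivrMr ?normr_gt0.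
apply: DeriveDef; first by apply/cvg_ex; exists d.
by rewrite /derive; apply: cvg_lim.
Unshelve. all: by end_near. Qed.

Definition mix x y (k : nat) : 'rV[R]_n := \row_j (if (j < k)%N then y 0 j else x 0 j).

(** The mean value theorem on each leg of the staircase [mix], which passes from [x] to [y] one
    coordinate at a time and stays in the sup-norm ball around [x] through [y]. *)
Lemma partial_mean_value f x y :
  (forall z, `|z - x| <= `|y - x| -> forall i, derivable f z (delta_mx 0 i)) ->
  exists xi : 'I_n -> 'rV[R]_n, (forall i, `|xi i - x| <= `|y - x|) /\
    f y - f x = \sum_i (y 0 i - x 0 i) * pderiv i f (xi i).
Proof.
move=> df.
have near_mix i (t : R) : `|t - x 0 i| <= `|y 0 i - x 0 i| ->
    `|upd (mix x y i) i t - x| <= `|y - x|.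
  move=> ti; apply: norm_row_le => // j; rewrite !mxE.
  have yx k : `|y 0 k - x 0 k| <= `|y - x|.
    by have := norm_coord_le (y - x) k; rewrite !mxE.
  case: eqP => [->|_]; first exact: le_trans ti (yx _).
  by case: ifP => _; rewrite ?subrr ?normr0.
have dl i (t : R) : `|t - x 0 i| <= `|y 0 i - x 0 i| ->
    is_derive t 1 (fun s => f (upd (mix x y i) i s)) (pderiv i f (upd (mix x y i) i t)).
  move=> ti; under eq_fun do rewrite upd_line.
  apply/is_derive_line; rewrite -upd_line; apply/derivableP/df.
  exact: near_mix.
have step i : exists z, `|z - x| <= `|y - x| /\
    f (mix x y i.+1) - f (mix x y i) = (y 0 i - x 0 i) * pderiv i f z.
  pose g s := f (upd (mix x y i) i s).
  have -> : f (mix x y i.+1) = g (y 0 i).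
    congr f; apply/rowP => j; rewrite !mxE ltnS leq_eqVlt -(inj_eq val_inj).
    by case: eqP => [/val_inj ->|].
  have -> : f (mix x y i) = g (x 0 i).
    congr f; apply/rowP => j; rewrite !mxE.
    by case: eqP => [->|//]; rewrite ltnn.
  have [xy|yx] := leP (x 0 i) (y 0 i).
    have [|c /andP[c1 c2] e] := mean_value (f := g)
        (df := fun t => pderiv i f (upd (mix x y i) i t)) xy.
      move=> t /andP[t1 t2]; apply: dl.
      by rewrite !ger0_norm ?subr_ge0// lerD2r.
    exists (upd (mix x y i) i c); split; last by rewrite e mulrC.
    by apply: near_mix; rewrite !ger0_norm ?subr_ge0// lerD2r.
  have [|c /andP[c1 c2] e] := mean_value (f := g)
      (df := fun t => pderiv i f (upd (mix x y i) i t)) (ltW yx).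
    move=> t /andP[t1 t2]; apply: dl.
    by rewrite !ler0_norm ?subr_le0 ?(ltW yx)// lerN2 lerD2r.
  exists (upd (mix x y i) i c); split; last by rewrite -[LHS]opprB e -mulrN opprB mulrC.
  by apply: near_mix; rewrite !ler0_norm ?subr_le0 ?(ltW yx)// lerN2 lerD2r.
have [xi hxi] := choice step.
exists xi; split => [i|]; first by have [] := hxi i.
transitivity (\sum_(i < n) (f (mix x y i.+1) - f (mix x y i))).
  rewrite -(big_mkord xpredT (fun k => f (mix x y k.+1) - f (mix x y k))).
  rewrite telescope_sumr//; congr (f _ - f _).
    by apply/rowP => j; rewrite !mxE ltn_ord.
  by apply/rowP => j; rewrite !mxE.
by apply: eq_bigr => i _; have [] := hxi i.
Qed.

Lemma ball_subE x y (e : R) : ball x e y = (`|y - x| < e).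
Proof. by rewrite -ball_normE /ball_ /= distrC. Qed.

Lemma Ck_cont k U f x : Ck_on k U f -> U x -> {for x, continuous f}.
Proof. by case: k => [|k] [h _]; apply: h. Qed.

Lemma Ck_le k U f : Ck_on k.+1 U f -> Ck_on k U f.
Proof.
elim: k f => [|k IH] f [h1 h2]; split => // i.
by have [h3 h4] := h2 i; split => //; apply: IH.
Qed.

Lemma Ck_sub k (U V : set 'rV[R]_n) f : V `<=` U -> Ck_on k U f -> Ck_on k V f.
Proof.
move=> VU; elim: k f => [|k IH] f [h1 h2]; split => //.
- by move=> x /VU; apply: h1.
- by move=> x /VU; apply: h1.
- move=> i; have [h3 h4] := h2 i; split; last exact: IH.
  by move=> x /VU; apply: h3.
Qed.

Lemma cont_close f x (e : R) : 0 < e -> {for x, continuous f} ->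
  exists2 del, 0 < del & forall y, `|y - x| < del -> `|f y - f x| <= e.
Proof.
move=> e0 /(@cvgrPdist_le _ _ _ (nbhs x)) /(_ _ e0) /nbhs_ballP[del /= del0 H].
exists del => // y yd.
by rewrite distrC; apply: H; rewrite ball_subE.
Qed.

Lemma cont_of_close f x :
  (forall e, 0 < e -> exists2 del, 0 < del & forall y, `|y - x| < del -> `|f y - f x| <= e) ->
  {for x, continuous f}.
Proof.
move=> H; apply/(@cvgrPdist_le _ _ _ (nbhs x)) => e e0; have [del del0 Hd] := H _ e0.
apply/nbhs_ballP; exists del => //= y; rewrite ball_subE => yd.
by rewrite distrC; apply: Hd.
Qed.

Lemma open_close (U : set 'rV[R]_n) x : open U -> U x ->
  exists2 del : R, 0 < del & forall y, `|y - x| < del -> U y.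
Proof.
move=> Uo Ux; have /nbhs_ballP[del /= del0 H] := open_nbhs_nbhs (conj Uo Ux).
exists del => // y yd.
by apply: H; rewrite ball_subE.
Qed.

Lemma fin_min_pos (N : nat) (d : 'I_N -> R) : (forall k, 0 < d k) ->
  exists2 del, 0 < del & forall k, del <= d k.
Proof.
(* Below every [d k], and positive also for an empty family. *)
move=> d0; exists (1 + \sum_k (d k)^-1)^-1.
  by rewrite invr_gt0 ltr_wpDr// sumr_ge0// => i _; rewrite invr_ge0 ltW.
move=> i; rewrite -[leRHS]invrK lef_pV2 ?posrE ?invr_gt0//; last first.
  by rewrite ltr_wpDr// sumr_ge0// => j _; rewrite invr_ge0 ltW.
rewrite (bigD1 i)//= addrCA lerDl addr_ge0// sumr_ge0// => j _.
by rewrite invr_ge0 ltW.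
Qed.

(** [Ck_on] speaks of partial derivatives only; their continuity and [partial_mean_value] give the
    derivative in every direction. *)
Lemma C1_is_derive U f x v : open U -> Ck_on 1 U f -> U x ->
  is_derive x v f (\sum_i v 0 i * pderiv i f x).
Proof.
move=> Uo fC Ux; apply: is_derive_of_bound => e e0.
have [r r0 rU] := open_close Uo Ux.
have K0 : 0 < n%:R * `|v| + 1 by rewrite ltr_wpDl// mulr_ge0.
have e0' : 0 < e / (n%:R * `|v| + 1) by rewrite divr_gt0.
have /choice[d dP] : forall i, exists del, 0 < del /\ forall y, `|y - x| < del ->
    `|pderiv i f y - pderiv i f x| <= e / (n%:R * `|v| + 1).
  move=> i; have [_ /(_ i)[_ pC]] := fC.
  by have [del] := cont_close e0' (@Ck_cont 0 U _ _ pC Ux); exists del.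
have [del del0 delP] := fin_min_pos (fun i => (dP i).1).
pose m := Num.min r del.
have m0 : 0 < m by rewrite lt_min r0.
have v1 : 0 < `|v| + 1 by rewrite ltr_wpDl.
exists (m / (`|v| + 1)); first by rewrite divr_gt0.
move=> h; rewrite ltr_pdivlMr// => hm.
have hv : `|x + h *: v - x| < m.
  rewrite addrAC subrr add0r normrZ; apply: le_lt_trans hm.
  by rewrite ler_wpM2l// lerDl.
have [|xi [xi1 ->]] := @partial_mean_value f x (x + h *: v).
  move=> z zx i; have [_ /(_ i)[dfi _]] := fC; apply: dfi; apply: rU.
  by apply: le_lt_trans zx _; apply: lt_le_trans hv _; rewrite ge_min lexx.
have -> : \sum_i ((x + h *: v) 0 i - x 0 i) * pderiv i f (xi i) -
    h * \sum_i v 0 i * pderiv i f x =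
    h * \sum_i v 0 i * (pderiv i f (xi i) - pderiv i f x).
  rewrite !mulr_sumr -sumrB; apply: eq_bigr => i _; rewrite !mxE.
  by ring.
rewrite normrM mulrC ler_wpM2r//; apply: le_trans (ler_norm_sum _ _ _) _.
apply: (@le_trans _ _ (\sum_(i < n) `|v| * (e / (n%:R * `|v| + 1)))).
  apply: ler_sum => i _; rewrite normrM ler_pM ?norm_coord_le//.
  apply: (dP i).2; apply: lt_le_trans (delP i).
  by apply: le_lt_trans (xi1 i) _; apply: lt_le_trans hv _; rewrite ge_min lexx orbT.
rewrite sumr_const card_ord -[_ *+ n]mulr_natl.
set K := _ + 1 in K0 *.
have -> : n%:R * (`|v| * (e / K)) = e * (n%:R * `|v| / K) by ring.
by rewrite ler_piMr ?(ltW e0)// ler_pdivrMr// mul1r lerDl.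
Qed.

(** Along the segment the second derivative stays within [e * |v| ^ 2] of its value at [x]; the
    Taylor polynomial being subtracted, two applications of the mean value inequality on [[0, 1]]
    carry this bound to the function. *)
Lemma taylor2 U f x (e : R) : open U -> Ck_on 2 U f -> U x -> 0 < e ->
  exists2 del, 0 < del & forall v, `|v| < del ->
  `|f (x + v) - (f x + \sum_i v 0 i * pderiv i f x +
     2^-1 * \sum_i \sum_j v 0 i * v 0 j * pderiv i (pderiv j f) x)| <= e * `|v| ^+ 2.
Proof.
move=> Uo fC Ux e0.
have [r r0 rU] := open_close Uo Ux.
have K0 : 0 < n%:R * n%:R + 1 :> R by rewrite ltr_wpDl// mulr_ge0.
have e0' : 0 < e / (n%:R * n%:R + 1) by rewrite divr_gt0.
have pC j : Ck_on 1 U (pderiv j f) by have [_ /(_ j)[]] := fC.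
have /choice[d0 d0P] : forall ij : 'I_n * 'I_n, exists del, 0 < del /\ forall y, `|y - x| < del ->
    `|pderiv ij.1 (pderiv ij.2 f) y - pderiv ij.1 (pderiv ij.2 f) x| <= e / (n%:R * n%:R + 1).
  move=> [i j]; have [_ /(_ i)[_ ppC]] := pC j.
  by have [del] := cont_close e0' (@Ck_cont 0 U _ _ ppC Ux); exists del.
pose d i j := d0 (i, j); have dP i j := d0P (i, j).
have /choice[d' d'P] : forall i, exists del, 0 < del /\ forall j, del <= d i j.
  by move=> i; have [del] := fin_min_pos (d := d i) (fun j => (dP i j).1); exists del.
have [del del0 delP] := fin_min_pos (fun i => (d'P i).1).
exists (Num.min r del) => [|v]; first by rewrite lt_min r0.
rewrite lt_min => /andP[vr vdel].
have inU (t : R) : 0 <= t <= 1 -> `|x + t *: v - x| <= `|v|.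
  move=> /andP[t0 t1]; rewrite addrAC subrr add0r normrZ ger0_norm//.
  by rewrite ler_piMl.
have dg g (t : R) : Ck_on 1 U g -> 0 <= t <= 1 ->
    is_derive t 1 (fun s : R => g (x + s *: v)) (\sum_i v 0 i * pderiv i g (x + t *: v)).
  move=> gC t01; apply/is_derive_line; apply: C1_is_derive Uo gC _.
  by apply: rU; apply: le_lt_trans vr; exact: inU.
pose K := \sum_i \sum_j v 0 i * v 0 j * pderiv i (pderiv j f) x.
pose g1 (t : R) := \sum_j v 0 j * pderiv j f (x + t *: v).
pose g2 (t : R) := \sum_j v 0 j * \sum_i v 0 i * pderiv i (pderiv j f) (x + t *: v).
pose E := e * `|v| ^+ 2.
have E0 : 0 <= E by rewrite mulr_ge0 ?(ltW e0)// exprn_ge0.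
have dg1 (t : R) : 0 <= t <= 1 -> is_derive t 1 g1 (g2 t).
  by move=> t01; apply: is_derive_bigsum => j; apply: is_derive_mulc; apply: dg.
have bg2 (t : R) : 0 <= t <= 1 -> `|g2 t - K| <= E.
  move=> t01; rewrite /K exchange_big /g2 -sumrB /=.
  apply: le_trans (ler_norm_sum _ _ _) _.
  apply: (@le_trans _ _ (\sum_(j < n) \sum_(i < n) `|v| ^+ 2 * (e / (n%:R * n%:R + 1)))).
    apply: ler_sum => j _; rewrite mulr_sumr -sumrB.
    apply: le_trans (ler_norm_sum _ _ _) _; apply: ler_sum => i _.
    rewrite mulrA (mulrC (v 0 j)) -mulrBr normrM; apply: ler_pM => //.
      by rewrite normrM expr2 ler_pM ?norm_coord_le.
    apply: (dP i j).2; apply: lt_le_trans ((d'P i).2 j); apply: lt_le_trans (delP i).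
    by apply: le_lt_trans vdel; exact: inU.
  rewrite !sumr_const card_ord -mulrnA -[leLHS]mulr_natr natrM /E.
  set K' := _ + 1 in K0 *.
  have -> : `|v| ^+ 2 * (e / K') * (n%:R * n%:R) = e * `|v| ^+ 2 * (n%:R * n%:R / K').
    by ring.
  by rewrite ler_piMr// ler_pdivrMr// mul1r lerDl.
pose F1 (t : R) := g1 t - g1 0 - t * K.
have dF1 (t : R) : 0 <= t <= 1 -> is_derive t 1 F1 (g2 t - K).
  move=> t01; have h := dg1 t t01.
  rewrite /F1; apply: is_deriveB.
    by rewrite -[g2 t]subr0; apply: is_deriveB.
  rewrite (_ : (fun _ => _) = (fun s : R => K * id s)); last first.
    by apply/funext => s; rewrite mulrC.
  by rewrite -[X in is_derive _ _ _ X]mulr1; apply: is_derive_mulc.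
have bF1 (t : R) : 0 <= t <= 1 -> `|F1 t| <= E.
  move=> /andP[t0 t1].
  have -> : F1 t = F1 t - F1 0 by rewrite /F1 mul0r !subrr subr0.
  apply: (@le_trans _ _ (E * (t - 0))); last by rewrite subr0 ler_piMr.
  apply: (mean_value_le (df := fun t => g2 t - K)) => // s /andP[s0 s1].
    by apply: dF1; rewrite s0 (le_trans s1).
  by apply: bg2; rewrite s0 (le_trans s1).
pose F (t : R) := f (x + t *: v) - t * g1 0 - t ^+ 2 * (2^-1 * K).
have dF (t : R) : 0 <= t <= 1 -> is_derive t 1 F (F1 t).
  move=> t01; have h := dg f t (Ck_le fC) t01.
  have -> : F1 t = g1 t - g1 0 * 1 - (2^-1 * K) * (2 * t).
    by rewrite /F1; field.
  rewrite /F; apply: is_deriveB; first apply: is_deriveB => //.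
    rewrite (_ : (fun _ => _) = (fun s : R => g1 0 * id s)); last first.
      by apply/funext => s; rewrite mulrC.
    exact: is_derive_mulc.
  rewrite (_ : (fun _ => _) = (fun s : R => 2^-1 * K * (id s * id s))); last first.
    by apply/funext => s; rewrite mulrC.
  apply: is_derive_mulc.
  have := is_deriveM (is_derive_id t (1 : R)) (is_derive_id t (1 : R)).
  by move=> hh; apply: (is_derive_eq hh); rewrite /GRing.scale /=; ring.
have -> : f (x + v) - (f x + \sum_i v 0 i * pderiv i f x + 2^-1 * K) = F 1 - F 0.
  rewrite /F scale1r scale0r addr0 expr1n expr0n /= !mul0r !mul1r /g1.
  by rewrite scale0r addr0; ring.
have -> : e * `|v| ^+ 2 = E * (1 - 0) by rewrite subr0 mulr1.
exact: (mean_value_le (df := F1)).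
Qed.

(* A Hoelder modulus common to the approximating derivatives makes the error term of the difference quotient uniform, so it survives a pointwise limit. *)
Lemma limit_is_derive (F : set_system nat) (FF : ProperFilter F)
    (f g : nat -> 'rV[R]_n -> R) (f' g' : 'rV[R]_n -> R) v (C : R) : 0 <= C ->
  (forall N x, is_derive x v (f N) (g N x)) ->
  (forall N x y, `|g N x - g N y| <= C * Num.sqrt `|x - y|) ->
  (forall x, f N x @[N --> F] --> f' x) ->
  (forall x, g N x @[N --> F] --> g' x) ->
  forall x, is_derive x v f' (g' x).
Proof.
move=> C0 df gC ff' gg' x; apply: is_derive_of_bound => e e0.
have bnd N (h : R) : `|f N (x + h *: v) - f N x - h * g N x| <=
    C * Num.sqrt (`|h| * `|v|) * `|h|.
  pose k (t : R) := f N (x + t *: (h *: v)) - t * (h * g N x).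
  have dk (t : R) : is_derive t 1 k (h * (g N (x + t *: (h *: v)) - g N x)).
    rewrite mulrBr; apply: is_deriveB.
      rewrite (_ : (fun _ => _) = (fun s : R => f N (x + s * h *: v))); last first.
        by apply/funext => s; rewrite scalerA.
      have d2 : is_derive (t * h) 1 (fun s : R => f N (x + s *: v)) (g N (x + t *: (h *: v))).
        by apply/is_derive_line; rewrite scalerA.
      have d1 : is_derive t 1 (fun s : R => s * h) h.
        rewrite (_ : (fun _ => _) = (fun s : R => h * id s)); last first.
          by apply/funext => s; rewrite mulrC.
        by rewrite -[X in is_derive _ _ _ X]mulr1; apply: is_derive_mulc.
      have := @is_derive1_comp _ (fun s : R => f N (x + s *: v)) (fun s : R => s * h) t _ _ d2 d1.
      by rewrite mulrC.
    rewrite (_ : (fun _ => _) = (fun s : R => h * g N x * id s)); last first.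
      by apply/funext => s; rewrite mulrC.
    by rewrite -[X in is_derive _ _ _ X]mulr1; apply: is_derive_mulc.
  have -> : f N (x + h *: v) - f N x - h * g N x = k 1 - k 0.
    by rewrite /k !scale1r scale0r addr0; ring.
  rewrite -[leRHS]mulr1 -[X in _ * X]subr0.
  apply: (mean_value_le (df := fun t => h * (g N (x + t *: (h *: v)) - g N x))) => //.
  move=> t /andP[t0 t1]; rewrite normrM mulrC ler_wpM2r//.
  apply: le_trans (gC _ _ _) _; rewrite ler_wpM2l// ler_sqrt ?mulr_ge0//.
  rewrite addrAC subrr add0r !normrZ (ger0_norm t0).
  by rewrite ler_piMl// mulr_ge0.
have bnd' (h : R) : `|f' (x + h *: v) - f' x - h * g' x| <=
    C * Num.sqrt (`|h| * `|v|) * `|h|.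
  apply: (@closed_cvg _ _ F FF (fun N => `|f N (x + h *: v) - f N x - h * g N x|)
     [set t : R | t <= C * Num.sqrt (`|h| * `|v|) * `|h|]).
  - exact: closed_le.
  - by near=> N; apply: bnd.
  - apply: cvg_norm; apply: cvgB; first exact: cvgB.
    exact: cvgMr.
have v1 : 0 < `|v| + 1 by rewrite ltr_wpDl.
have C1 : 0 < C + 1 by rewrite ltr_wpDl.
exists ((e / (C + 1)) ^+ 2 / (`|v| + 1)); first by rewrite divr_gt0// exprn_gt0// divr_gt0.
move=> h; rewrite ltr_pdivlMr// => hd.
apply: le_trans (bnd' h) _; rewrite ler_wpM2r//.
have s1 : Num.sqrt (`|h| * `|v|) <= e / (C + 1).
  rewrite -[leRHS]ger0_norm ?divr_ge0 ?(ltW e0) ?(ltW C1)// -[leRHS]sqrtr_sqr ler_sqrt ?sqr_ge0//.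
  by apply: le_trans (ltW hd); rewrite ler_wpM2l// lerDl.
apply: le_trans (ler_wpM2l C0 s1) _.
rewrite mulrA ler_pdivrMr// mulrC ler_pM2l// lerDl//.
Unshelve. all: by end_near. Qed.

End Calculus.

(** * A substitute for the Wiener algebra *)

Section WienerClass.
Variables (R : realType) (n : nat).
Implicit Types (x y p th : 'rV[R]_n) (G H : 'rV[R]_n -> R) (i : 'I_n) (r mu : R).

Definition open_cube r p : set 'rV[R]_n :=
  [set x | forall i, p 0 i < x 0 i < p 0 i + r].

(* A substitute for the Wiener algebra of absolutely convergent Fourier series, with frequencies in the coset [th + Z^n]: limits of finite trigonometric sums of bounded norm. *)
Definition wiener r p th mu G : Prop :=
  exists2 l : nat -> seq (wave R n),
    (forall N, trig_norm (l N) <= mu /\ freqs th (l N)) &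
    (forall x, open_cube r p x -> trig (base_freq r) (l N) x @[N --> \oo] --> G x).

Lemma open_cube_sub r p : open_cube r p `<=` cube r p.
Proof. by move=> x xc i; have /andP[a b] := xc i; rewrite !ltW. Qed.

Lemma base_freq_gt0 r : 0 < r -> 0 < base_freq r.
Proof. by move=> r0; rewrite divr_gt0 ?pi_gt0. Qed.

Lemma wiener_weaken r p th mu mu' G : mu <= mu' -> wiener r p th mu G -> wiener r p th mu' G.
Proof.
move=> mm [l lP lG]; exists l => // N; have [h1 h2] := lP N; split => //.
exact: le_trans mm.
Qed.

Lemma wiener_ext r p th mu G H : (forall x, open_cube r p x -> G x = H x) ->
  wiener r p th mu G -> wiener r p th mu H.
Proof. by move=> GH [l lP lG]; exists l => // x xc; rewrite -GH//; apply: lG. Qed.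

Lemma wienerD r p th mu1 mu2 G H : wiener r p th mu1 G -> wiener r p th mu2 H ->
  wiener r p th (mu1 + mu2) (fun x => G x + H x).
Proof.
move=> [l1 l1P l1G] [l2 l2P l2G]; exists (fun N => l1 N ++ l2 N) => [N|x xc].
  have [h1 h2] := l1P N; have [h3 h4] := l2P N.
  by split; [rewrite trig_norm_cat lerD|apply: freqs_cat].
by under eq_fun do rewrite trig_cat; apply: cvgD; [exact: l1G|exact: l2G].
Qed.

Lemma wienerM r p th mu1 mu2 G H : wiener r p th mu1 G -> wiener r p 0 mu2 H ->
  wiener r p th (mu1 * mu2) (fun x => G x * H x).
Proof.
move=> [l1 l1P l1G] [l2 l2P l2G]; exists (fun N => trig_mul (l1 N) (l2 N)) => [N|x xc].
  have [h1 h2] := l1P N; have [h3 h4] := l2P N.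
  split; last exact: freqs_mul.
  by apply: le_trans (trig_norm_mul _ _) _; apply: ler_pM; rewrite ?trig_norm_ge0.
by under eq_fun do rewrite trig_mulE; apply: cvgM; [exact: l1G|exact: l2G].
Qed.

Lemma wiener_wave r p th (m : 'rV[R]_n) (c phi : R) :
  (forall i, m 0 i - th 0 i \is a Num.int) ->
  wiener r p th (`|c| * freq_weight m) (fun x => c * cos (base_freq r * dotv m x + phi)).
Proof.
move=> mth; exists (fun=> [:: (c, m, phi)]) => [N|x _].
  split; first by rewrite /trig_norm big_seq1 /wave_norm lexx.
  by move=> w; rewrite inE => /eqP ->.
under eq_fun do rewrite /trig big_seq1 /wave_at /=.
exact: cvg_cst.
Qed.

Lemma trig_continuous (q : R) l x : 0 <= q -> {for x, continuous (@trig R n q l)}.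
Proof.
move=> q0; apply: cont_of_close => e e0.
have l1 : 0 < trig_norm l + 1 by rewrite ltr_wpDl// trig_norm_ge0.
have K0 : 0 < 2 * q * n%:R + 1 by rewrite ltr_wpDl// !mulr_ge0.
exists ((e / (trig_norm l + 1)) ^+ 2 / (2 * q * n%:R + 1)).
  by rewrite divr_gt0// exprn_gt0// divr_gt0.
move=> y; rewrite ltr_pdivlMr// => yd; apply: le_trans (trig_holder _ _ _ q0) _.
have h2 : Num.sqrt (2 * q * n%:R * `|y - x|) <= e / (trig_norm l + 1).
  rewrite -[leRHS]ger0_norm ?divr_ge0 ?(ltW e0) ?(ltW l1)// -[leRHS]sqrtr_sqr.
  rewrite ler_sqrt ?sqr_ge0//; apply: le_trans (ltW yd).
  by rewrite mulrC ler_wpM2l// lerDl.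
apply: le_trans (ler_wpM2l (trig_norm_ge0 _) h2) _.
by rewrite mulrA ler_pdivrMr// mulrC ler_wpM2l ?(ltW e0)// lerDl.
Qed.

Lemma coord_continuous i x : {for x, continuous (fun y : 'rV[R]_n => y 0 i)}.
Proof.
apply: cont_of_close => e e0; exists e => // y yx; apply: le_trans (ltW yx).
by have := norm_coord_le (y - x) i; rewrite !mxE.
Qed.

Lemma wiener_cst r p c : wiener r p 0 `|c| (fun=> c).
Proof.
have h := @wiener_wave r p 0 0 c 0.
have {}h := h (fun i => _); apply: (@wiener_ext _ _ _ _ (fun x => c * cos (base_freq r * dotv 0 x + 0))).
  by move=> x _; rewrite /dotv big1 ?mulr0 ?addr0 ?cos0 ?mulr1// => i _; rewrite mxE mul0r.
have -> : `|c| = `|c| * freq_weight (0 : 'rV[R]_n).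
  by rewrite /freq_weight normr0 addr0 sqrtr1 mulr1.
by apply: h => i; rewrite subrr.
Qed.

Lemma wiener_sum r p th (N : nat) (mu : 'I_N -> R) (G : 'I_N -> 'rV[R]_n -> R) :
  (forall k, wiener r p th (mu k) (G k)) ->
  wiener r p th (\sum_k mu k) (fun x => \sum_k G k x).
Proof.
elim: N mu G => [|N IH] mu G h.
  rewrite big_ord0; exists (fun=> [::]) => [N|x _].
    by split; [rewrite /trig_norm big_nil|].
  by under eq_fun do rewrite /trig big_nil; rewrite big_ord0; exact: cvg_cst.
rewrite big_ord_recl (_ : (fun x => _) = (fun x => G ord0 x + \sum_k G (lift ord0 k) x)).
  by apply: wienerD => //; apply: IH.
by apply/funext => x; rewrite big_ord_recl.
Qed.

(** The interpolants have a common norm bound, hence a common Hoelder modulus. Each point is within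
    [r / N.+1] of a node, where the interpolant equals [G], so continuity of [G] gives pointwise
    convergence. *)
Lemma wiener_of_scaled_bound r p mu G : 0 < r -> 0 <= mu ->
  scaled_bound r p (2 * n) mu G ->
  (forall x, open_cube r p x -> {for x, continuous G}) ->
  wiener r p 0 (54 ^+ n * mu) G.
Proof.
move=> r0 mu0 bG cG; have pc : cube r p p by move=> i; rewrite lexx lerDl ltW.
exists (fun N => interpolant r p N G p) => [N|x xc].
  by split; [exact: trig_norm_interpolant|exact: freqs_interpolant].
set nu := 54 ^+ n * mu.
have nu0 : 0 <= nu by rewrite mulr_ge0 ?exprn_ge0.
have nu1 : 0 < nu + 1 by rewrite ltr_wpDl.
pose N1 N : R := N.+1%:R.
have N0 N : 0 < N1 N by rewrite ltr0n.
pose s N i := (x 0 i - p 0 i) * N1 N / r.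
have xi0 i : 0 <= x 0 i - p 0 i by have /andP[] := xc i; rewrite subr_ge0 => /ltW.
have s0 N i : 0 <= s N i.
  by rewrite /s divr_ge0 ?(ltW r0)// mulr_ge0 ?(ltW (N0 N)).
(* Index of the mesh cell containing [x 0 i]; at most [N] because [x] lies in the open cube. *)
pose j N i := Num.truncn (s N i).
have jN N i : (j N i < N.+1)%N.
  rewrite truncn_lt_nat// ltr_pdivrMr// mulrC ltr_pM2l// ltrBlDl.
  by have /andP[] := xc i.
pose g N := \row_i node r p N i (j N i).
have gx N : `|g N - x| <= r / N1 N.
  apply: norm_row_le => [|i]; first by rewrite divr_ge0 ?ltW.
  rewrite !mxE /node -/(N1 N).
  have /andP[] := truncn_itv (s0 N i); rewrite -/(j N i).
  set J := (j N i)%:R; rewrite -natr1 => J1 J2.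
  have -> : p 0 i + r * (J + 2^-1) / N1 N - x 0 i = (r / N1 N) * (J + 2^-1 - s N i).
    by rewrite /s; field; rewrite !gt_eqF.
  rewrite normrM (ger0_norm (x := r / _)) ?divr_ge0 ?(ltW r0) ?(ltW (N0 N))//.
  rewrite ler_piMr ?divr_ge0 ?(ltW r0) ?(ltW (N0 N))// ler_norml.
  by apply/andP; split; lra.
have q0 := base_freq_gt0 r0; set q := base_freq r in q0 *.
have K0 : 0 < 2 * q * n%:R + 1 by rewrite ltr_wpDl// mulr_ge0// mulr_ge0// (ltW q0).
apply/cvgrPdist_le => e e0.
have e20 : 0 < e / 2 by rewrite divr_gt0.
have [del del0 Hd] := cont_close e20 (cG x xc).
pose eta := Num.min del ((e / 2 / (nu + 1)) ^+ 2 / (2 * q * n%:R + 1)).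
have eta0 : 0 < eta.
  by rewrite lt_min del0 divr_gt0// exprn_gt0// divr_gt0.
near=> N.
have rN : r / N1 N < eta.
  rewrite ltr_pdivrMr// mulrC -ltr_pdivrMr// /N1 -natr1.
  apply: (@lt_trans _ _ N%:R); last by rewrite ltrDl.
  by near: N; exact: nbhs_infty_gtr.
have gxe : `|g N - x| < eta := le_lt_trans (gx N) rN.
have -> : G x - trig q (interpolant r p N G p) x =
    (trig q (interpolant r p N G p) (g N) - trig q (interpolant r p N G p) x)
    - (G (g N) - G x).
  by rewrite interpolantE//; ring.
have -> : e = e / 2 + e / 2 by field.
apply: le_trans (ler_normB _ _) _; apply: lerD; last first.
  by apply: Hd; apply: lt_le_trans gxe _; rewrite ge_min lexx.
apply: le_trans (trig_holder _ _ _ (ltW q0)) _.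
have h1 := trig_norm_interpolant r0 N mu0 bG pc.
have h2 : Num.sqrt (2 * q * n%:R * `|g N - x|) <= e / 2 / (nu + 1).
  rewrite -[leRHS]ger0_norm ?divr_ge0 ?(ltW e0) ?(ltW nu1)// -[leRHS]sqrtr_sqr.
  rewrite ler_sqrt ?sqr_ge0//.
  have : `|g N - x| <= (e / 2 / (nu + 1)) ^+ 2 / (2 * q * n%:R + 1).
    by apply: le_trans (ltW gxe) _; rewrite ge_min lexx orbT.
  rewrite ler_pdivlMr// => h; apply: le_trans h.
  by rewrite mulrC ler_wpM2l// lerDl.
apply: (@le_trans _ _ (nu * (e / 2 / (nu + 1)))).
  by apply: ler_pM => //; rewrite ?trig_norm_ge0 ?sqrtr_ge0.
by rewrite mulrA ler_pdivrMr// mulrC ler_wpM2l ?(ltW e20)// lerDl.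
Unshelve. all: by end_near. Qed.

Lemma scaled_bound_cst r p m mu c : 0 < r -> `|c| <= mu -> scaled_bound r p m mu (fun=> c).
Proof.
move=> r0; elim: m mu c => [|m IH] mu c cmu; split => // i; split.
  by move=> x _; exact: derivable_cst.
have -> : pderiv i (fun=> c) = (fun=> 0) by apply/funext => x; exact: derive_cst.
by apply: IH; rewrite normr0 divr_ge0 ?(ltW r0)// (le_trans _ cmu).
Qed.

Lemma is_derive_coord x i j :
  is_derive x (delta_mx 0 i) (fun y : 'rV[R]_n => y 0 j) (i == j)%:R.
Proof.
apply: is_derive_of_bound => e e0; exists 1 => // h _.
rewrite (_ : _ - _ - _ = 0); last by rewrite !mxE eqxx (eq_sym i) /=; ring.
by rewrite normr0 mulr_ge0// ltW.
Qed.

Lemma scaled_bound_coord r p m mu j c : 0 < r -> r <= mu -> p 0 j <= c <= p 0 j + r ->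
  scaled_bound r p m mu (fun x => x 0 j - c).
Proof.
move=> r0 rmu /andP[c1 c2]; have b0 x : cube r p x -> `|x 0 j - c| <= mu.
  move=> /(_ j)/andP[h1 h2]; apply: le_trans rmu; rewrite ler_norml.
  by apply/andP; split; lra.
case: m => [|m]; split => // i.
have d x : is_derive x (delta_mx 0 i) (fun y : 'rV[R]_n => y 0 j - c) (i == j)%:R.
  by rewrite -[(i == j)%:R]subr0; apply: is_deriveB; exact: is_derive_coord.
split; first by move=> x _; have [] := d x.
have -> : pderiv i (fun x => x 0 j - c) = (fun=> (i == j)%:R).
  by apply/funext => x; have [_] := d x.
apply: scaled_bound_cst => //; apply: (@le_trans _ _ 1).
  by case: eqP; rewrite ?normr1 ?normr0.
by rewrite ler_pdivlMr// mul1r.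
Qed.

(** Each derivative brings a factor [k], which is admissible exactly when [|k| <= r^-1]. *)
Lemma scaled_bound_cos r p m mu i0 (c k phi : R) : 0 < r -> `|k| <= r^-1 -> `|c| <= mu ->
  scaled_bound r p m mu (fun x => c * cos (k * x 0 i0 + phi)).
Proof.
move=> r0 kr; elim: m mu c phi => [|m IH] mu c phi cmu.
  split => // x _; rewrite normrM -[leRHS]mulr1 ler_pM ?cos_max//.
split.
  by move=> x _; rewrite normrM -[leRHS]mulr1 ler_pM ?cos_max.
move=> i.
have d x : is_derive x (delta_mx 0 i) (fun y : 'rV[R]_n => c * cos (k * y 0 i0 + phi))
    (c * k * (i == i0)%:R * cos (k * x 0 i0 + (phi + pi / 2))).
  have -> : c * k * (i == i0)%:R * cos (k * x 0 i0 + (phi + pi / 2)) =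
      c * (- sin (k * (i == i0)%:R * 0 + (k * x 0 i0 + phi)) * (k * (i == i0)%:R)).
    by rewrite mulr0 add0r addrA cosDpihalf; ring.
  apply: is_derive_mulc.
  rewrite -[x in is_derive x]addr0 -[X in _ + X](scale0r (delta_mx 0 i)).
  apply/is_derive_line.
  have -> : (fun s : R => cos (k * (x + s *: delta_mx 0 i) 0 i0 + phi)) =
     (fun s : R => cos (k * (i == i0)%:R * s + (k * x 0 i0 + phi))).
    apply/funext => s; rewrite !mxE eqxx /= eq_sym; congr cos; ring.
  exact: is_derive_cos_affine.
split; first by move=> x _; have [] := d x.
have -> : pderiv i (fun x => c * cos (k * x 0 i0 + phi)) =
    (fun x => c * k * (i == i0)%:R * cos (k * x 0 i0 + (phi + pi / 2))).
  by apply/funext => x; have [_] := d x.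
apply: IH; rewrite !normrM -[leRHS]mulr1; apply: ler_pM => //; rewrite ?mulr_ge0//.
  by apply: ler_pM.
by case: eqP; rewrite ?normr1 ?normr0.
Qed.

Definition corner x (r : R) : 'rV[R]_n := \row_i (x 0 i - r / 2).

Lemma cube_corner x0 r x : 0 <= r -> cube r (corner x0 r) x <-> `|x - x0| <= r / 2.
Proof.
move=> r0; split => [xc|xr i].
  apply: norm_row_le => [|i]; first by rewrite divr_ge0.
  have := xc i; rewrite !mxE => /andP[h1 h2].
  by rewrite ler_norml; apply/andP; split; lra.
have := le_trans (norm_coord_le _ i) xr; rewrite !mxE ler_norml => /andP[h1 h2].
by apply/andP; split; lra.
Qed.

Lemma open_cube_corner x0 r x : open_cube r (corner x0 r) x <->
  forall i, `|x 0 i - x0 0 i| < r / 2.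
Proof.
by split => h i; have := h i; rewrite ?mxE ltr_norml => /andP[h1 h2];
  apply/andP; split; lra.
Qed.

(** Continuous derivatives are bounded near [x0]; since [r < 1], allowing [mu / r] for each
    derivative is weaker than allowing [mu]. *)
Lemma scaled_bound_of_Ck m X G x0 : open X -> X x0 -> Ck_on m X G ->
  exists C rho : R, [/\ 0 <= C, 0 < rho & forall r mu, 0 < r -> r < rho -> C <= mu ->
    scaled_bound r (corner x0 r) m mu G].
Proof.
move=> Xo Xx; elim: m G => [|m IH] G GC.
  have [del del0 Hd] := cont_close ltr01 (Ck_cont GC Xx).
  exists (`|G x0| + 1), del; split; rewrite ?addr_ge0// => r mu r0 rdel Cmu; split => // x.
  move=> /(cube_corner _ _ (ltW r0)) xr.
  apply: le_trans Cmu; rewrite -[G x](subrK (G x0)) addrC.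
  apply: le_trans (ler_normD _ _) _; rewrite lerD2l; apply: Hd.
  by apply: le_lt_trans xr _; lra.
have [GC1 GC2] := GC.
have [rX rX0 HX] := open_close Xo Xx.
have [C0 [rho0 [C00 rho00 H0]]] : exists C rho : R, [/\ 0 <= C, 0 < rho &
   forall r mu, 0 < r -> r < rho -> C <= mu -> forall x, cube r (corner x0 r) x -> `|G x| <= mu].
  have [C [rho [C0 rho0 H]]] := IH G (Ck_le GC).
  exists C, rho; split => // r mu r0 rrho Cmu x.
  by apply: scaled_bound0; apply: H.
have /choice[C CP] : forall i, exists C : R, exists rho : R, [/\ 0 <= C, 0 < rho &
    forall r mu, 0 < r -> r < rho -> C <= mu -> scaled_bound r (corner x0 r) m mu (pderiv i G)].
  by move=> i; apply: IH; have [] := GC2 i.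
have {CP}/choice[rho rhoP] := CP.
have [rh rh0 rhP] := fin_min_pos (fun i => let: And3 _ h _ := rhoP i in h).
exists (C0 + \sum_i C i), (Num.min (Num.min rh rho0) (Num.min rX 1)).
have Ci0 i : 0 <= C i by have [] := rhoP i.
split; first by rewrite addr_ge0// sumr_ge0.
  by rewrite !lt_min rh0 rho00 rX0 ltr01.
move=> r mu r0; rewrite !lt_min => /andP[/andP[r1 r2] /andP[r3 r4]] Cmu.
have mu0 : 0 <= mu by apply: le_trans Cmu; rewrite addr_ge0// sumr_ge0.
split.
  by apply: H0 => //; apply: le_trans Cmu; rewrite lerDl sumr_ge0.
move=> i; split.
  move=> x /(cube_corner _ _ (ltW r0)) xr; have [h _] := GC2 i; apply: h; apply: HX.
  by apply: le_lt_trans xr _; lra.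
have [_ _ h] := rhoP i; apply: h => //; first exact: lt_le_trans r1 (rhP i).
apply: (@le_trans _ _ mu).
  apply: le_trans Cmu; rewrite (bigD1 i)//= addrCA lerDl addr_ge0// sumr_ge0//.
by rewrite ler_pdivlMr// ler_piMr// ltW.
Qed.

Lemma pderivBc i G (c : R) : pderiv i (fun x => G x - c) = pderiv i G.
Proof.
apply/funext => x; rewrite /pderiv /derive; set v : 'rV[R]_n := delta_mx 0 i.
suff -> : (fun h : R => h^-1 *: (((fun y => G y - c) \o shift x) (h *: v) - (G x - c))) =
  (fun h : R => h^-1 *: ((G \o shift x) (h *: v) - G x)) by [].
by apply/funext => h /=; congr (_ *: _); ring.
Qed.

Lemma derivableBc v G (c : R) x : derivable G x v -> derivable (fun x => G x - c) x v.
Proof. by move=> h; apply: derivableB. Qed.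

(** Source of all smallness: with its value at the centre subtracted, [G] is [O(r)] on the cube
    while its derivatives stay bounded, which is [scaled_bound] with [mu] proportional to [r]. *)
Lemma wiener_of_Ck X G x0 : open X -> X x0 -> Ck_on (2 * n).+1 X G ->
  exists C rho : R, [/\ 0 <= C, 0 < rho & forall r, 0 < r -> r < rho ->
    wiener r (corner x0 r) 0 (C * r) (fun x => G x - G x0)].
Proof.
move=> Xo Xx GC; have [GC1 GC2] := GC.
have [rX rX0 HX] := open_close Xo Xx.
have /choice[C CP] : forall i, exists C : R, exists rho : R, [/\ 0 <= C, 0 < rho &
    forall r mu, 0 < r -> r < rho -> C <= mu -> scaled_bound r (corner x0 r) (2 * n) mu (pderiv i G)].
  by move=> i; have [_ h] := GC2 i; exact: (scaled_bound_of_Ck Xo Xx h).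
have {CP}/choice[rho rhoP] := CP.
have [rh rh0 rhP] := fin_min_pos (fun i => let: And3 _ h _ := rhoP i in h).
have Ci0 i : 0 <= C i by have [] := rhoP i.
have CD0 : 0 <= \sum_i C i by rewrite sumr_ge0.
exists (54 ^+ n * \sum_i C i), (Num.min rh rX); split.
- by rewrite mulr_ge0 ?exprn_ge0.
- by rewrite lt_min rh0.
move=> r r0; rewrite lt_min => /andP[r1 r2].
have inX x : cube r (corner x0 r) x -> X x.
  by move=> /(cube_corner _ _ (ltW r0)) xr; apply: HX; apply: le_lt_trans xr _; lra.
have pb i : scaled_bound r (corner x0 r) (2 * n) (\sum_i C i) (pderiv i G).
  have [_ _ h] := rhoP i; apply: h => //; first exact: lt_le_trans r1 (rhP i).
  by rewrite (bigD1 i)//= lerDl sumr_ge0.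
have b0 x : cube r (corner x0 r) x -> `|G x - G x0| <= (\sum_i C i) * r.
  move=> xc; have xr := (cube_corner _ _ (ltW r0)).1 xc.
  have [|xi [xi1 ->]] := @partial_mean_value _ _ G x0 x.
    move=> z zx i; have [h _] := GC2 i; apply: h; apply: inX.
    by apply/(cube_corner _ _ (ltW r0)); apply: le_trans xr.
  rewrite mulr_suml; apply: le_trans (ler_norm_sum _ _ _) _; apply: ler_sum => i _.
  rewrite normrM mulrC; apply: ler_pM => //.
    have [_ _ h] := rhoP i.
    have := h r (C i) r0 (lt_le_trans r1 (rhP i)) (lexx _).
    move=> /scaled_bound0; apply; apply/(cube_corner _ _ (ltW r0)).
    exact: le_trans (xi1 i) xr.
  have := le_trans (norm_coord_le _ i) xr; rewrite !mxE => h; lra.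
rewrite -mulrA; apply: wiener_of_scaled_bound => //.
- by rewrite mulr_ge0// ltW.
- have: forall m, (m <= 2 * n)%N -> scaled_bound r (corner x0 r) m (\sum_i C i * r)
     (fun x => G x - G x0).
    move=> [|m] mn; split => // i; first by rewrite -mulr_suml; apply: b0.
      by rewrite -mulr_suml; apply: b0.
    split => [x xc|].
      by apply: derivableBc; have [h _] := GC2 i; apply: h; apply: inX.
    rewrite pderivBc -mulr_suml mulfK ?gt_eqF//.
    have := pb i; rewrite -(subnK mn) addnS; elim: (_ - _)%N => [|k IHk].
      by rewrite add0n; exact: scaled_boundS.
    by rewrite addSn => /scaled_boundS.
  by move=> /(_ _ (leqnn _)); rewrite mulr_suml.
- move=> x xc; apply: continuousB; last exact: cst_continuous.
  by apply: (Ck_cont GC); apply: inX; exact: open_cube_sub.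
Qed.

Definition quarter_shift i : 'rV[R]_n := 4^-1 *: delta_mx 0 i.

(* The constant 1 belongs to a shifted class, which contains no zero frequency: write it as cos^2 + sin^2. *)
Lemma wiener_one_shift r p i0 : 0 < r ->
  wiener r p (quarter_shift i0) (4 * 54 ^+ n) (fun=> 1).
Proof.
move=> r0; set th := quarter_shift i0.
have pi4 : pi / 4 <= 1 :> R by have := @pihalf_lt2 R; lra.
pose k := base_freq r / 4.
have kr : `|k| <= r^-1.
  rewrite ger0_norm; last by rewrite divr_ge0// ltW// base_freq_gt0.
  rewrite /k /base_freq.
  by rewrite mulrAC ler_piMl// invr_ge0 ltW.
(* The cosine as a single wave of frequency [th]. *)
have h1 phi : wiener r p th 2 (fun x => 1 * cos (k * x 0 i0 + phi)).
  apply: (@wiener_weaken _ _ _ (`|1| * freq_weight th)).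
    rewrite normr1 mul1r /freq_weight -[leRHS]ger0_norm// -[leRHS]sqrtr_sqr.
    rewrite ler_sqrt ?sqr_ge0//.
    suff : `|th| <= 1 by rewrite expr2; lra.
    apply: norm_row_le => // i; rewrite !mxE eqxx /=.
    by case: eqP => _; rewrite ?mulr1 ?mulr0 ?normr0// ger0_norm//; lra.
  apply: wiener_ext (@wiener_wave r p th th 1 phi _) => [x _|i].
    by rewrite dotvC dotvZr dotv_delta /k; congr (_ * cos (_ + _)); ring.
  by rewrite subrr.
(* The same cosine, on the cube, expanded in integer frequencies; [pi / 4 <= 1] provides
   [|k| <= r^-1]. Each square is a product of the two expansions. *)
have h2 phi : wiener r p 0 (54 ^+ n * 1) (fun x => 1 * cos (k * x 0 i0 + phi)).
  apply: wiener_of_scaled_bound => //.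
    by apply: scaled_bound_cos; rewrite ?normr1.
  have -> : (fun x => 1 * cos (k * x 0 i0 + phi)) = trig (base_freq r) [:: (1, th, phi)].
    apply/funext => y; rewrite /trig big_seq1 /wave_at /= dotvC dotvZr dotv_delta /k.
    by congr (_ * cos (_ + _)); ring.
  by move=> x _; apply: trig_continuous; rewrite ltW// base_freq_gt0.
apply: (@wiener_ext _ _ _ _ (fun x => 1 * cos (k * x 0 i0 + 0) * (1 * cos (k * x 0 i0 + 0)) +
  1 * cos (k * x 0 i0 + - (pi / 2)) * (1 * cos (k * x 0 i0 + - (pi / 2))))).
  move=> x _; rewrite addr0 cosBpihalf !mul1r -!expr2; exact: cos2Dsin2.
have -> : 4 * 54 ^+ n = 2 * (54 ^+ n * 1) + 2 * (54 ^+ n * 1) :> R by ring.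
by apply: wienerD; apply: wienerM.
Qed.

End WienerClass.

(** * Solving the equation by a Neumann series *)

Section UltraLimits.
Variable R : realType.

(** The image ultrafilter contains a compact segment. One ultrafilter serves all bounded sequences,
    hence all points [x] and all derivatives at once, with no subsequence to extract. *)
Lemma ultra_bounded_cvg (F : set_system nat) (FU : UltraFilter F) (s : nat -> R) (C : R) :
  (forall N, `|s N| <= C) -> exists l : R, s N @[N --> F] --> l.
Proof.
move=> sC; have := @segment_compact R (- C) C; rewrite compact_ultra.
have FsU : UltraFilter (s @ F).
  split; first exact: fmap_proper_filter.
  move=> G GF sG; apply/seteqP; split => // A GA.
  have [//|nA] := in_ultra_setVsetC (s @^-1` A) FU.
  have : G (A `&` ~` A) by apply: filterI => //; apply: sG; exact: nA.
  by rewrite setICr => /filter_not_empty.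
have sF : (s @ F) [set` `[- C, C]].
  by apply: (@filterE _ F) => N /=; rewrite in_itv /= -ler_norml.
by move=> /(_ (s @ F) FsU sF)[l [_ sl]]; exists l.
Qed.

Lemma cvg_bigsum (T : Type) (F : set_system T) (FF : Filter F) (K : nat)
    (f : 'I_K -> T -> R) (l : 'I_K -> R) :
  (forall k, f k N @[N --> F] --> l k) ->
  (\sum_k f k N) @[N --> F] --> \sum_k l k.
Proof.
elim: K f l => [|K IH] f l h.
  rewrite big_ord0 (_ : (fun N => _) = (fun=> 0)); first exact: cvg_cst.
  by apply/funext => N; rewrite big_ord0.
rewrite big_ord_recl (_ : (fun N => _) = (fun N => f ord0 N + \sum_k f (lift ord0 k) N)).
  by apply: cvgD; [exact: h|apply: IH].
by apply/funext => N; rewrite big_ord_recl.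
Qed.

End UltraLimits.

Lemma sum_map_enum (R : realType) (n : nat) (T : Type) (F : 'I_n -> T) (G : T -> R) :
  \sum_(l <- [seq F i | i <- enum 'I_n]) G l = \sum_i G (F i).
Proof. by rewrite big_map big_enum. Qed.

Lemma base_freqV_le (R : realType) (r : R) : 0 < r -> (base_freq r)^-1 <= r.
Proof.
move=> r0; rewrite /base_freq invf_div ler_pdivrMr ?pi_gt0// ler_peMr ?(ltW r0)//.
by have := @pi_ge2 R; lra.
Qed.

(** * Neumann series for finite trigonometric sums *)

Section NeumannSeries.
Variables (R : realType) (n : nat) (i0 : 'I_n) (r lam : R) (a0 : 'M[R]_n).
Hypotheses (r0 : 0 < r) (lam0 : 0 < lam).
Implicit Types (x y m : 'rV[R]_n) (w : wave R n) (l g : seq (wave R n)).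

Definition qform m : R := \sum_i \sum_j a0 i j * (m 0 i * m 0 j).

Hypothesis qform_ge : forall m, lam * `|m| ^+ 2 <= qform m.

Variable q : R.
Hypotheses (q_gt0 : 0 < q) (qV_le : q^-1 <= r).

Let th := quarter_shift R i0.

(** Division by [- q ^+ 2 * qform m], the symbol of the operator with constant coefficients [a0]. *)
Definition wave_solve w : wave R n :=
  wave_scale (fun w => - (q ^+ 2 * qform w.1.2)^-1) w.

(** [1 / 4] is the distance from 0 to [1/4 + Z], where the coordinate [i0] of a frequency in
    [th + Z^n] lies. *)
Definition far w := 4^-1 <= `|w.1.2|.

Lemma int_shift_ge (t : R) : t - 4^-1 \is a Num.int -> 4^-1 <= `|t|.
Proof.
move=> /intrP[z tz]; have -> : t = z%:~R + 4^-1 by rewrite -tz subrK.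
have [z0|z0] := leP 0 z.
  have : 0 <= z%:~R :> R by rewrite ler0z.
  by move=> h; rewrite ger0_norm ?addr_ge0// lerDr.
have : z%:~R <= -1 :> R.
  rewrite -[-1]/((-1)%:~R) ler_int; lia.
by move=> h; rewrite ler0_norm; lra.
Qed.

Lemma freqs_far l w : freqs th l -> w \in l -> far w.
Proof.
move=> lth wl; have := lth w wl i0; rewrite !mxE !eqxx mulr1 => /int_shift_ge h.
exact: le_trans h (norm_coord_le _ _).
Qed.

Lemma qform_gt0 m : 4^-1 <= `|m| -> 0 < qform m.
Proof.
move=> m1; apply: lt_le_trans (qform_ge m); rewrite mulr_gt0// exprn_gt0//.
by apply: lt_le_trans m1; rewrite invr_gt0.
Qed.

Lemma wave_norm_scale (c : wave R n -> R) (K : R) w : `|c w| <= K ->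
  wave_norm (wave_scale c w) <= K * wave_norm w.
Proof.
move=> cK; rewrite /wave_norm /= normrM -mulrA ler_wpM2r// mulr_ge0//.
by rewrite ltW// freq_weight_gt0.
Qed.

(** Norm bounds for [wave_solve] followed by 0, 1 and 2 derivatives. Each derivative missing from
    two leaves a factor [1 / (q * |m|)], at most [4 * r] because [|m| >= 1/4] and [q^-1 <= r]. *)
Definition gain0 : R := 16 * r ^+ 2 / lam.
Definition gain1 : R := 4 * r / lam.
Definition gain2 : R := lam^-1.

Lemma qform_invM_le m (k : nat) : 4^-1 <= `|m| -> (k <= 2)%N ->
  `|m| ^+ k / qform m <= 4 ^+ (2 - k) / lam.
Proof.
move=> m1 k2; have A0 := qform_gt0 m1.
have m0 : 0 < `|m| by apply: lt_le_trans m1; rewrite invr_gt0.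
rewrite ler_pdivrMr// mulrAC ler_pdivlMr// -[leLHS]mul1r.
apply: (@le_trans _ _ (4 ^+ (2 - k) * (lam * `|m| ^+ 2))); last first.
  by rewrite ler_wpM2l// exprn_ge0.
have -> : `|m| ^+ 2 = `|m| ^+ (2 - k) * `|m| ^+ k by rewrite -exprD subnK.
have -> : 4 ^+ (2 - k) * (lam * (`|m| ^+ (2 - k) * `|m| ^+ k)) =
    (4 * `|m|) ^+ (2 - k) * (`|m| ^+ k * lam) by rewrite exprMn; ring.
rewrite ler_wpM2r ?mulr_ge0 ?(ltW lam0) ?exprn_ge0//.
by rewrite exprn_ege1//; lra.
Qed.

Lemma wave_norm_solve_eq w : far w ->
  wave_norm (wave_solve w) = (q ^+ 2 * qform w.1.2)^-1 * wave_norm w.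
Proof.
move=> fw; have A0 := qform_gt0 fw.
rewrite /wave_solve /wave_norm /= normrM normrN mulrA; congr (_ * _ * _).
rewrite ger0_norm// invr_ge0; apply: mulr_ge0; last exact: ltW.
by apply: exprn_ge0; exact: ltW q_gt0.
Qed.

Lemma wave_norm_solve w : far w -> wave_norm (wave_solve w) <= gain0 * wave_norm w.
Proof.
move=> fw; have A0 := qform_gt0 fw.
have := @qform_invM_le w.1.2 0 fw isT; rewrite expr0 mul1r subn0 => h.
rewrite wave_norm_solve_eq// ler_wpM2r ?wave_norm_ge0//.
rewrite invfM -exprVn /gain0.
have -> : 16 * r ^+ 2 / lam = r ^+ 2 * (4 ^+ 2 / lam) :> R by ring.
have qV0 : 0 <= q^-1 by rewrite invr_ge0 ltW// q_gt0.
apply: ler_pM => //; first by apply: exprn_ge0.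
  by rewrite invr_ge0 ltW.
by rewrite ler_pXn2r ?nnegrE// ?qV_le// ltW.
Qed.

Lemma wave_norm_diff (i : 'I_n) w :
  wave_norm (wave_diff q i w) = q * `|w.1.2 0 i| * wave_norm w.
Proof.
rewrite /wave_norm /wave_diff /= normrM (normrM q) (ger0_norm (ltW q_gt0)).
by rewrite -!mulrA.
Qed.

Lemma wave_norm_diff_solve i w : far w ->
  wave_norm (wave_diff q i (wave_solve w)) <= gain1 * wave_norm w.
Proof.
move=> fw; have A0 := qform_gt0 fw.
have := @qform_invM_le w.1.2 1 fw isT; rewrite expr1 => h.
rewrite wave_norm_diff wave_norm_solve_eq// mulrA ler_wpM2r ?wave_norm_ge0//.
have -> : q * `|(wave_solve w).1.2 0 i| / (q ^+ 2 * qform w.1.2) =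
    q^-1 * (`|w.1.2 0 i| / qform w.1.2).
  by rewrite /=; field; rewrite (gt_eqF q_gt0) (gt_eqF A0).
have -> : gain1 = r * (4 / lam) by rewrite /gain1; ring.
apply: ler_pM.
- by rewrite invr_ge0 ltW// q_gt0.
- by rewrite mulr_ge0// invr_ge0 ltW.
- exact: qV_le.
- by apply: le_trans h; rewrite ler_wpM2r ?invr_ge0 ?(ltW A0)// norm_coord_le.
Qed.

Lemma wave_norm_diff2_solve i j w : far w ->
  wave_norm (wave_diff q i (wave_diff q j (wave_solve w))) <= gain2 * wave_norm w.
Proof.
move=> fw; have A0 := qform_gt0 fw.
have := @qform_invM_le w.1.2 2 fw isT; rewrite expr0 mul1r => h.
rewrite !wave_norm_diff wave_norm_solve_eq//.
move: (wave_norm_ge0 w); move: (wave_norm w) => W W0.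
rewrite !mulrA ler_wpM2r//.
apply: le_trans h; rewrite /= [`|_| ^+ 2]expr2.
have -> : q * `|w.1.2 0 i| * q * `|w.1.2 0 j| / (q ^+ 2 * qform w.1.2) =
    `|w.1.2 0 i| * `|w.1.2 0 j| / qform w.1.2.
  by field; rewrite (gt_eqF q_gt0) (gt_eqF A0).
by rewrite ler_wpM2r ?invr_ge0 ?(ltW A0)// ler_pM// norm_coord_le.
Qed.

Definition tsolve l := map wave_solve l.
Definition tdiff i l := map (wave_diff q i) l.

Lemma trig_norm_solve l : freqs th l -> trig_norm (tsolve l) <= gain0 * trig_norm l.
Proof.
by move=> h; apply: trig_norm_map => w wl; apply/wave_norm_solve/(freqs_far h).
Qed.

Lemma trig_norm_diff_solve i l : freqs th l ->
  trig_norm (tdiff i (tsolve l)) <= gain1 * trig_norm l.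
Proof.
move=> h; rewrite /tdiff /tsolve -map_comp; apply: trig_norm_map => w wl.
exact/wave_norm_diff_solve/(freqs_far h).
Qed.

Lemma trig_norm_diff2_solve i j l : freqs th l ->
  trig_norm (tdiff i (tdiff j (tsolve l))) <= gain2 * trig_norm l.
Proof.
move=> h; rewrite /tdiff /tsolve -!map_comp; apply: trig_norm_map => w wl.
exact/wave_norm_diff2_solve/(freqs_far h).
Qed.

(** Two quarter-period shifts produce [- cos], which cancels the sign in [wave_solve]; the coset
    hypothesis keeps [qform] nonzero. *)
Lemma const_op_solve l x : freqs th l ->
  \sum_i \sum_j a0 i j * trig q (tdiff i (tdiff j (tsolve l))) x = trig q l x.
Proof.
move=> h.
transitivity (\sum_(w <- l) \sum_i \sum_j
    a0 i j * wave_at q x (wave_diff q i (wave_diff q j (wave_solve w)))).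
  rewrite [RHS]exchange_big /=; apply: eq_bigr => i _.
  rewrite [RHS]exchange_big /=; apply: eq_bigr => j _.
  by rewrite /trig /tdiff /tsolve !big_map mulr_sumr.
rewrite /trig big_seq [RHS]big_seq; apply: eq_bigr => w wl.
have A0 := qform_gt0 (freqs_far h wl).
have e i j : a0 i j * wave_at q x (wave_diff q i (wave_diff q j (wave_solve w))) =
    (a0 i j * (w.1.2 0 i * w.1.2 0 j)) * ((qform w.1.2)^-1 * wave_at q x w).
  rewrite /wave_at /= !addrA !cosDpihalf sinDpihalf.
  by field; rewrite (gt_eqF q_gt0) (gt_eqF A0).
under eq_bigr do (under eq_bigr do rewrite e; rewrite -mulr_suml).
by rewrite -mulr_suml -/(qform w.1.2) mulrA mulfV ?mul1r// gt_eqF.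
Qed.

Variables (lB : 'I_n -> 'I_n -> seq (wave R n)) (lb : 'I_n -> seq (wave R n)).
Hypothesis (fB : forall i j, freqs 0 (lB i j)) (fb : forall i, freqs 0 (lb i)).

(** The operator [- B L0^-1], with [lB] in the place of [a - a0] and [lb] in that of [b]. *)
Definition neumann_step g :=
  [seq wave_scale (fun=> -1) w | w <-
    flatten [seq flatten [seq trig_mul (tdiff i (tdiff j (tsolve g))) (lB i j)
      | j <- enum 'I_n] | i <- enum 'I_n]
    ++ flatten [seq trig_mul (tdiff i (tsolve g)) (lb i) | i <- enum 'I_n]].

(** The value at [x] of [L L0^-1 g], with the coefficients of [L] replaced by trigonometric sums. *)
Definition op_at x g : R :=
  \sum_i \sum_j (a0 i j + trig q (lB i j) x) * trig q (tdiff i (tdiff j (tsolve g))) x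
  + \sum_i trig q (lb i) x * trig q (tdiff i (tsolve g)) x.

Lemma freqs_neumann_step g : freqs th g -> freqs th (neumann_step g).
Proof.
move=> h; apply: freqs_map => //.
apply: freqs_cat; apply: freqs_flatten => l /mapP[i _ ->].
  apply: freqs_flatten => l' /mapP[j _ ->]; apply: freqs_mul => //.
  by do 3 apply: freqs_map => //.
by apply: freqs_mul => //; do 2 apply: freqs_map => //.
Qed.

Lemma op_at_step x g : freqs th g -> op_at x g = trig q g x - trig q (neumann_step g) x.
Proof.
move=> h; rewrite /op_at.
have -> : trig q (neumann_step g) x = - (\sum_i \sum_j trig q (lB i j) x *
    trig q (tdiff i (tdiff j (tsolve g))) x + \sum_i trig q (lb i) x * trig q (tdiff i (tsolve g)) x).
  rewrite /neumann_step {1}/trig big_map.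
  under eq_bigr do rewrite /wave_at /= mulN1r mulNr.
  rewrite sumrN -/(trig q _ x) trig_cat !trig_flatten !sum_map_enum.
  congr (- (_ + _)); last by apply: eq_bigr => i _; rewrite trig_mulE mulrC.
  apply: eq_bigr => i _; rewrite trig_flatten sum_map_enum.
  by apply: eq_bigr => j _; rewrite trig_mulE mulrC.
rewrite opprK -(const_op_solve x h) addrA; congr (_ + _).
rewrite -big_split /=; apply: eq_bigr => i _; rewrite -big_split /=.
by apply: eq_bigr => j _; rewrite mulrDl.
Qed.

Hypothesis small : gain2 * (\sum_i \sum_j trig_norm (lB i j)) + gain1 * (\sum_i trig_norm (lb i)) <= 2^-1.

(** Submultiplicativity bounds the two parts of the step by the two terms of [small]: in the first
    the coefficients [lB] are small, in the second [gain1] is. *)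
Lemma trig_norm_neumann_step g : freqs th g ->
  trig_norm (neumann_step g) <= 2^-1 * trig_norm g.
Proof.
move=> h; rewrite /neumann_step.
apply: (@le_trans _ _ (1 * trig_norm (flatten [seq flatten [seq trig_mul (tdiff i (tdiff j (tsolve g))) (lB i j)
      | j <- enum 'I_n] | i <- enum 'I_n]
    ++ flatten [seq trig_mul (tdiff i (tsolve g)) (lb i) | i <- enum 'I_n]))).
  by apply: trig_norm_map => w _; apply: wave_norm_scale; rewrite normrN1.
rewrite mul1r trig_norm_cat !trig_norm_flatten !sum_map_enum.
apply: le_trans (ler_wpM2r (trig_norm_ge0 g) small); rewrite mulrDl; apply: lerD.
  rewrite [gain2 * _]mulr_sumr mulr_suml; apply: ler_sum => i _.
  rewrite trig_norm_flatten sum_map_enum [gain2 * _]mulr_sumr mulr_suml; apply: ler_sum => j _.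
  apply: le_trans (trig_norm_mul _ _) _; rewrite mulrAC.
  by apply: ler_wpM2r; [exact: trig_norm_ge0|exact: trig_norm_diff2_solve].
rewrite [gain1 * _]mulr_sumr mulr_suml; apply: ler_sum => i _.
apply: le_trans (trig_norm_mul _ _) _; rewrite mulrAC.
by apply: ler_wpM2r; [exact: trig_norm_ge0|exact: trig_norm_diff_solve].
Qed.

Fixpoint neumann_sum g (k : nat) :=
  if k is k'.+1 then iter k' neumann_step g ++ neumann_sum g k' else [::].

Lemma freqs_iter_step g k : freqs th g -> freqs th (iter k neumann_step g).
Proof. by move=> h; elim: k => //= k; apply: freqs_neumann_step. Qed.

Lemma freqs_neumann_sum g k : freqs th g -> freqs th (neumann_sum g k).
Proof. by move=> h; elim: k => //= k IH; apply: freqs_cat => //; apply: freqs_iter_step. Qed.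

Lemma trig_norm_iter_step g k : freqs th g ->
  trig_norm (iter k neumann_step g) <= 2^-1 ^+ k * trig_norm g.
Proof.
move=> h; elim: k => [|k IH]; first by rewrite expr0 mul1r.
rewrite iterS; apply: le_trans (trig_norm_neumann_step (@freqs_iter_step _ k h)) _.
by rewrite exprS -mulrA ler_wpM2l.
Qed.

Lemma trig_norm_neumann_sum g k : freqs th g ->
  trig_norm (neumann_sum g k) <= 2 * trig_norm g.
Proof.
move=> h; suff : trig_norm (neumann_sum g k) <= 2 * (1 - 2^-1 ^+ k) * trig_norm g.
  move=> /le_trans; apply; apply: ler_wpM2r; first exact: trig_norm_ge0.
  have : 0 <= 2^-1 ^+ k :> R by rewrite exprn_ge0.
  by lra.
elim: k => [|k IH] /=.
  by rewrite expr0 subrr mulr0 mul0r /trig_norm big_nil.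
rewrite trig_norm_cat; have := @trig_norm_iter_step _ k h.
have -> : 2 * (1 - 2^-1 ^+ k.+1) * trig_norm g =
   2^-1 ^+ k * trig_norm g + 2 * (1 - 2^-1 ^+ k) * trig_norm g.
  by rewrite exprS; field.
by move=> h1; apply: lerD.
Qed.

Lemma op_at_cat x g1 g2 : op_at x (g1 ++ g2) = op_at x g1 + op_at x g2.
Proof.
rewrite /op_at addrACA; congr (_ + _); rewrite -big_split /=; apply: eq_bigr => i _.
  rewrite -big_split /=; apply: eq_bigr => j _.
  by rewrite /tdiff /tsolve !map_cat trig_cat mulrDr.
by rewrite /tdiff /tsolve !map_cat trig_cat mulrDr.
Qed.

(** By [op_at_step] the terms telescope, leaving an iterate whose norm is at most [2 ^ -k] times
    that of [g]. *)
Lemma op_at_neumann_sum x g k : freqs th g ->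
  op_at x (neumann_sum g k) = trig q g x - trig q (iter k neumann_step g) x.
Proof.
move=> h; elim: k => [|k IH] /=.
  rewrite subrr /op_at big1 ?add0r ?big1// => i _.
    by rewrite /trig big_nil mulr0.
  by rewrite big1// => j _; rewrite /trig big_nil mulr0.
rewrite op_at_cat IH op_at_step; last exact: freqs_iter_step.
by ring.
Qed.

End NeumannSeries.

Lemma Ck2_intro (R : realType) (n : nat) (w : 'rV[R]_n -> R) (w1 : 'I_n -> 'rV[R]_n -> R)
    (w2 : 'I_n -> 'I_n -> 'rV[R]_n -> R) (V : set 'rV[R]_n) :
  (forall x, {for x, continuous w}) ->
  (forall j x, {for x, continuous (w1 j)}) ->
  (forall i j x, {for x, continuous (w2 i j)}) ->
  (forall j x, is_derive x (delta_mx 0 j) w (w1 j x)) ->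
  (forall i j x, is_derive x (delta_mx 0 i) (w1 j) (w2 i j x)) ->
  [/\ Ck_on 2 V w, (forall j, pderiv j w = w1 j) &
      forall i j, pderiv i (pderiv j w) = w2 i j].
Proof.
move=> cw cw1 cw2 dw dw1.
have e1 j : pderiv j w = w1 j by apply/funext => x; have [] := dw j x.
have e2 i j : pderiv i (pderiv j w) = w2 i j.
  by rewrite e1; apply/funext => x; have [] := dw1 i j x.
split => //; split => [x _|j]; first exact: cw.
split => [x _|]; first by have [] := dw j x.
split => [x _|i]; first by rewrite e1; exact: cw1.
split => [x _|]; first by rewrite e1; have [] := dw1 i j x.
by split => // x _; rewrite e2; exact: cw2.
Qed.

Lemma limit_continuous (R : realType) (n : nat) (F : set_system nat) (FF : ProperFilter F)
    (g : nat -> 'rV[R]_n -> R) (g' : 'rV[R]_n -> R) (C : R) : 0 <= C ->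
  (forall N x y, `|g N x - g N y| <= C * Num.sqrt `|x - y|) ->
  (forall x, g N x @[N --> F] --> g' x) ->
  forall x, {for x, continuous g'}.
Proof.
move=> C0 gC gg' x.
have h y z : `|g' y - g' z| <= C * Num.sqrt `|y - z|.
  apply: (@closed_cvg _ _ F FF (fun N => `|g N y - g N z|)
     [set t : R | t <= C * Num.sqrt `|y - z|]).
  - exact: closed_le.
  - by apply: filterE => N; exact: gC.
  - by apply: cvg_norm; apply: cvgB.
apply: cont_of_close => e e0; have C1 : 0 < C + 1 by rewrite ltr_wpDl.
exists ((e / (C + 1)) ^+ 2); first by rewrite exprn_gt0// divr_gt0.
move=> y yx; apply: le_trans (h _ _) _.
have s1 : Num.sqrt `|y - x| <= e / (C + 1).
  rewrite -[leRHS]ger0_norm ?divr_ge0 ?(ltW e0) ?(ltW C1)// -[leRHS]sqrtr_sqr.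
  by rewrite ler_sqrt ?sqr_ge0// ltW.
apply: le_trans (ler_wpM2l C0 s1) _.
by rewrite mulrA ler_pdivrMr// mulrC ler_wpM2l ?(ltW e0)// lerDl.
Qed.

(** A single index [N] governs both the approximation of the data and the truncation of the series,
    so one limit suffices. The norm bounds of the sums and of their derivatives are uniform in [N],
    whence [w] is [C^2] everywhere; the equation holds where the data converge, in the open cube. *)
Lemma elliptic_solution (R : realType) (n : nat) (i0 : 'I_n) (r lam beta beta' nu : R)
    (p : 'rV[R]_n) (a0 : 'M[R]_n) (a : 'rV[R]_n -> 'M[R]_n) (b : 'rV[R]_n -> 'rV[R]_n)
    (f : 'rV[R]_n -> R) :
  0 < r -> 0 < lam ->
  (forall m, lam * `|m| ^+ 2 <= qform a0 m) ->
  (forall i j, wiener r p 0 beta (fun x => a x i j - a0 i j)) ->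
  (forall i, wiener r p 0 beta' (fun x => b x 0 i)) ->
  wiener r p (quarter_shift R i0) nu f ->
  gain2 lam * (n%:R * n%:R * beta) + gain1 r lam * (n%:R * beta') <= 2^-1 ->
  exists w : 'rV[R]_n -> R, [/\ Ck_on 2 setT w, (forall x, `|w x| <= gain0 r lam * (2 * nu)) &
    forall x, open_cube r p x -> Lop a b w x = f x].
Proof.
move=> r0 lam0 qge wB wb [lf lfP lfc] small.
pose q := base_freq r; pose th := quarter_shift R i0.
have q0 : 0 < q := base_freq_gt0 r0.
have qV : q^-1 <= r := base_freqV_le r0.
have /choice[lB lBP] : forall ij : 'I_n * 'I_n, exists l : nat -> seq (wave R n),
    (forall N, trig_norm (l N) <= beta /\ freqs 0 (l N)) /\
    (forall x, open_cube r p x -> trig q (l N) x @[N --> \oo] --> a x ij.1 ij.2 - a0 ij.1 ij.2).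
  by move=> [i j]; have [l h1 h2] := wB i j; exists l.
have /choice[lb lbP] : forall i : 'I_n, exists l : nat -> seq (wave R n),
    (forall N, trig_norm (l N) <= beta' /\ freqs 0 (l N)) /\
    (forall x, open_cube r p x -> trig q (l N) x @[N --> \oo] --> b x 0 i).
  by move=> i; have [l h1 h2] := wb i; exists l.
have fB N i j : freqs 0 (lB (i, j) N) by have [h _] := lBP (i, j); have [] := h N.
have fb N i : freqs 0 (lb i N) by have [h _] := lbP i; have [] := h N.
pose step N := neumann_step a0 q (fun i j => lB (i, j) N) (lb ^~ N).
pose W N := neumann_sum a0 q (fun i j => lB (i, j) N) (lb ^~ N) (lf N) N.
have C20 : 0 <= gain2 lam by rewrite invr_ge0 ltW.
have C10 : 0 <= gain1 r lam by rewrite divr_ge0 ?mulr_ge0 ?ltW.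
have C00 : 0 <= gain0 r lam by rewrite divr_ge0 ?mulr_ge0 ?exprn_ge0 ?ltW.
have smallN N : gain2 lam * (\sum_i \sum_j trig_norm (lB (i, j) N)) +
    gain1 r lam * (\sum_i trig_norm (lb i N)) <= 2^-1.
  apply: le_trans small; apply: lerD; apply: ler_wpM2l => //.
    apply: (@le_trans _ _ (\sum_(i < n) \sum_(j < n) beta)).
      apply: ler_sum => i _; apply: ler_sum => j _.
      by have [h _] := lBP (i, j); have [] := h N.
    by rewrite !sumr_const !card_ord -mulrnA -[leLHS]mulr_natl natrM.
  apply: (@le_trans _ _ (\sum_(i < n) beta')).
    by apply: ler_sum => i _; have [h _] := lbP i; have [] := h N.
  by rewrite sumr_const card_ord -[leLHS]mulr_natl.
have fth N : freqs th (lf N) by have [] := lfP N.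
have nf N : trig_norm (lf N) <= nu by have [] := lfP N.
have nu0 : 0 <= nu := le_trans (trig_norm_ge0 _) (nf 0%N).
have WP N : freqs th (W N).
  exact: (freqs_neumann_sum (fB N) (fb N) (fth N)).
have Wn N : trig_norm (W N) <= 2 * nu.
  apply: le_trans (trig_norm_neumann_sum r0 lam0 qge q0 qV (fB N) (fb N) (smallN N) N (fth N)) _.
  by rewrite ler_wpM2l.
have Wop N x : op_at a0 q (fun i j => lB (i, j) N) (lb ^~ N) x (W N) =
    trig q (lf N) x - trig q (iter N (step N) (lf N)) x.
  exact: (op_at_neumann_sum r0 lam0 qge q0 qV (fB N) (fb N) x N (fth N)).
have Rn N x : `|trig q (iter N (step N) (lf N)) x| <= 2^-1 ^+ N * nu.
  apply: le_trans (trig_le _ _ _) _.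
  apply: le_trans (trig_norm_iter_step r0 lam0 qge q0 qV (fB N) (fb N) (smallN N) N (fth N)) _.
  by rewrite ler_wpM2l// exprn_ge0.
(* [U] refines the filter at infinity, so the given limits persist along it. *)
have [U [UU subU]] := ultraFilterLemma (eventually_filter : ProperFilter \oo).
have toU (s : nat -> R) (l : R) : s N @[N --> \oo] --> l -> s N @[N --> U] --> l.
  by move=> sl; apply: cvg_trans sl => A; exact: subU.
have PU : ProperFilter U by exact: ultra_proper.
pose S0 N := tsolve a0 q (W N).
pose S1 j N := tdiff q j (S0 N).
pose S2 i j N := tdiff q i (S1 j N).
have n0 N : trig_norm (S0 N) <= gain0 r lam * (2 * nu).
  by apply: le_trans (trig_norm_solve r0 lam0 qge q0 qV (WP N)) _; rewrite ler_wpM2l.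
have n1 j N : trig_norm (S1 j N) <= gain1 r lam * (2 * nu).
  by apply: le_trans (trig_norm_diff_solve r0 lam0 qge q0 qV j (WP N)) _; rewrite ler_wpM2l.
have n2 i j N : trig_norm (S2 i j N) <= gain2 lam * (2 * nu).
  by apply: le_trans (trig_norm_diff2_solve r0 lam0 qge q0 qV i j (WP N)) _; rewrite ler_wpM2l.
have lim (l : nat -> seq (wave R n)) (K : R) : (forall N, trig_norm (l N) <= K) ->
    exists g : 'rV[R]_n -> R, forall x, trig q (l N) x @[N --> U] --> g x.
  move=> lK.
  have /choice[g gP] : forall x, exists g : R, trig q (l N) x @[N --> U] --> g.
    move=> x; apply: (@ultra_bounded_cvg _ U UU _ K) => N.
    exact: le_trans (trig_le _ _ _) (lK N).
  by exists g.
have hol (l : nat -> seq (wave R n)) (K : R) : (forall N, trig_norm (l N) <= K) ->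
    forall N x y, `|trig q (l N) x - trig q (l N) y| <=
      K * Num.sqrt (2 * q * n%:R) * Num.sqrt `|x - y|.
  move=> lK N x y; apply: le_trans (trig_holder _ _ _ (ltW q0)) _.
  rewrite sqrtrM; last by rewrite mulr_ge0// mulr_ge0// ltW.
  rewrite mulrA; apply: ler_wpM2r; first exact: sqrtr_ge0.
  by apply: ler_wpM2r; first exact: sqrtr_ge0.
have [w wl] := lim _ _ n0.
have /choice[w1 w1l] : forall j, exists g : 'rV[R]_n -> R, forall x,
    trig q (S1 j N) x @[N --> U] --> g x by move=> j; apply: lim (n1 j).
have /choice[w2' w2l'] : forall ij : 'I_n * 'I_n, exists g : 'rV[R]_n -> R, forall x,
    trig q (S2 ij.1 ij.2 N) x @[N --> U] --> g x by move=> ij; apply: lim (n2 ij.1 ij.2).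
pose w2 i j := w2' (i, j).
have w2l i j x : trig q (S2 i j N) x @[N --> U] --> w2 i j x := w2l' (i, j) x.
have K0 (K : R) : 0 <= K -> 0 <= K * (2 * nu) * Num.sqrt (2 * q * n%:R).
  by move=> K0; rewrite !mulr_ge0// sqrtr_ge0.
have [C2w e1 e2] : [/\ Ck_on 2 setT w, (forall j, pderiv j w = w1 j) &
    forall i j, pderiv i (pderiv j w) = w2 i j].
  apply: Ck2_intro.
  - exact: (limit_continuous PU (K0 _ C00) (hol _ _ n0) wl).
  - move=> j; exact: (limit_continuous PU (K0 _ C10) (hol _ _ (n1 j)) (w1l j)).
  - move=> i j; exact: (limit_continuous PU (K0 _ C20) (hol _ _ (n2 i j)) (w2l i j)).
  - move=> j; apply: (limit_is_derive PU (K0 _ C10) _ (hol _ _ (n1 j)) wl (w1l j)) => N x.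
    exact: is_derive_trig.
  - move=> i j; apply: (limit_is_derive PU (K0 _ C20) _ (hol _ _ (n2 i j)) (w1l j) (w2l i j)) => N x.
    exact: is_derive_trig.
exists w; split => //.
  move=> x; apply: (@closed_cvg _ _ U _ (fun N => `|trig q (S0 N) x|)
     [set t : R | t <= gain0 r lam * (2 * nu)]).
  - exact: closed_le.
  - by apply: filterE => N; exact: le_trans (trig_le _ _ _) (n0 N).
  - by apply: cvg_norm; exact: wl.
move=> x xc.
have L : op_at a0 q (fun i j => lB (i, j) N) (lb ^~ N) x (W N) @[N --> U] --> Lop a b w x.
  rewrite /Lop /op_at; apply: cvgD; apply: cvg_bigsum => i.
    apply: cvg_bigsum => j; apply: cvgM; last by rewrite e2; exact: w2l.
    rewrite -[a x i j](subrK (a0 i j)) addrC; apply: cvgD; first exact: cvg_cst.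
    by apply: toU; have [_ h] := lBP (i, j); exact: h.
  apply: cvgM; last by rewrite e1; exact: w1l.
  by apply: toU; have [_ h] := lbP i; exact: h.
(* The same sequence computed by telescoping: the data minus a remainder of size at most
   [2 ^ -N * nu]. *)
have L2 : op_at a0 q (fun i j => lB (i, j) N) (lb ^~ N) x (W N) @[N --> U] --> f x.
  under eq_fun do rewrite Wop.
  rewrite -[f x]subr0; apply: cvgB; first by apply: toU; exact: lfc.
  apply: toU; apply/cvgr0Pnorm_le => e e0.
  have : (fun N => 2^-1 ^+ N * nu) @ \oo --> (0 * nu : R).
    apply: cvgM; last exact: cvg_cst.
    by apply: cvg_expr; rewrite ger0_norm; lra.
  rewrite mul0r => /cvgr0Pnorm_le/(_ _ e0); apply: filterS => N.
  rewrite ger0_norm ?mulr_ge0 ?exprn_ge0// => h.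
  exact: le_trans (Rn N x) h.
exact: (cvg_unique _ L L2).
Qed.

(** * Elliptic operators *)

Section EllipticOperator.
Variables (R : realType) (n : nat).
Implicit Types (x y v : 'rV[R]_n) (f g : 'rV[R]_n -> R) (U V : set 'rV[R]_n).

Lemma posdefmx_qform (A : 'M[R]_n) v : (v *m A *m v^T) 0 0 = qform A v.
Proof.
rewrite mxE; under eq_bigr do rewrite !mxE mulr_suml.
rewrite exchange_big /=; apply: eq_bigr => i _; apply: eq_bigr => j _.
by ring.
Qed.

Lemma qformZ (A : 'M[R]_n) (c : R) v : qform A (c *: v) = c ^+ 2 * qform A v.
Proof.
rewrite mulr_sumr; apply: eq_bigr => i _; rewrite mulr_sumr; apply: eq_bigr => j _.
by rewrite !mxE; ring.
Qed.

Lemma qform_delta (A : 'M[R]_n) i : qform A (delta_mx 0 i) = A i i.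
Proof.
rewrite /qform (bigD1 i)//= [X in _ + X]big1 => [|k ki].
  rewrite addr0 (bigD1 i)//= big1 => [|l li].
    by rewrite !delta_mxE0 !eqxx !mulr1 addr0.
  by rewrite !delta_mxE0 (negPf li) !mulr0.
by rewrite big1// => l _; rewrite !delta_mxE0 (negPf ki) mul0r mulr0.
Qed.

Lemma delta_neq0 (i : 'I_n) : (delta_mx 0 i : 'rV[R]_n) != 0.
Proof. by apply/eqP => /rowP/(_ i); rewrite !mxE !eqxx => /eqP; rewrite oner_eq0. Qed.

(** The form attains a positive minimum on the compact unit sphere of the sup norm; homogeneity of
    degree two does the rest. *)
Lemma posdefmx_coercive (i0 : 'I_n) (A : 'M[R]_n) : posdefmx A ->
  exists2 lam : R, 0 < lam & forall v, lam * `|v| ^+ 2 <= qform A v.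
Proof.
move=> pA; pose S := [set v : 'rV[R]_n | `|v| = 1].
have Sc : compact S.
  apply: bounded_closed_compact.
    by exists 1; split => // M M1 v /= ->; rewrite ltW.
  rewrite (_ : S = (fun v : 'rV[R]_n => `|v|) @^-1` [set 1]); last by [].
  apply: preimage_closed; last exact: closed_eq.
  by move=> v _; exact: norm_continuous.
(* The coordinate [i0] provides a point of the sphere, as the minimum requires. *)
have Sd : S (`|delta_mx 0 i0 : 'rV[R]_n|^-1 *: delta_mx 0 i0).
  rewrite /S /= normrZ normfV normr_id mulVf//.
  by rewrite normr_eq0 delta_neq0.
have qc v : {for v, continuous (qform A)}.
  apply: (@cvg_bigsum R _ (nbhs v) (nbhs_filter v)) => i.
  apply: (@cvg_bigsum R _ (nbhs v) (nbhs_filter v)) => j.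
  apply: cvgM; first exact: cvg_cst.
  by apply: cvgM; exact: coord_continuous.
have [c Sc1 cmin] := EVT_min_rV (ex_intro _ _ Sd) Sc (continuous_subspaceT qc).
have c0 : c != 0.
  by apply/eqP => c0; move: Sc1; rewrite inE /S /= c0 normr0 => /esym/eqP; rewrite oner_eq0.
exists (qform A c); first by rewrite -posdefmx_qform; exact: pA.
move=> v; have [->|v0] := eqVneq v 0.
  by have := qformZ A 0 0; rewrite scale0r expr0n mul0r => ->; rewrite normr0 expr0n mulr0.
have v1 : `|v| != 0 by rewrite normr_eq0.
have -> : v = `|v| *: (`|v|^-1 *: v) by rewrite scalerA mulfV// scale1r.
rewrite qformZ normrZ normr_id [`|_ *: v|]normrZ normfV normr_id mulVf// mulr1.
rewrite mulrC ler_wpM2l ?exprn_ge0//; apply: cmin.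
by rewrite inE /S /= normrZ normfV normr_id mulVf.
Qed.

Lemma near_open U x : open U -> U x -> \forall y \near x, U y.
Proof. by move=> Uo Ux; exact: open_nbhs_nbhs. Qed.

Lemma continuous_ext_on U f g x : open U -> (forall y, U y -> f y = g y) -> U x ->
  {for x, continuous f} -> {for x, continuous g}.
Proof.
move=> Uo fg Ux fc; apply: cont_of_close => e e0.
have [d1 d10 H1] := cont_close e0 fc; have [d2 d20 H2] := open_close Uo Ux.
exists (Num.min d1 d2) => [|y]; first by rewrite lt_min d10.
by rewrite lt_min => /andP[y1 /H2 Uy]; rewrite -!fg//; exact: H1.
Qed.

(** Functions being total, the derivative of a sum is known to be the sum of the derivatives only on
    [U]; this lets the induction in [Ck_onD] replace one by the other. *)
Lemma Ck_on_ext k U f g : open U -> (forall x, U x -> f x = g x) ->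
  Ck_on k U f -> Ck_on k U g.
Proof.
move=> Uo; elim: k f g => [|k IH] f g fg [h1 h2].
  split => // x Ux; exact: continuous_ext_on Uo fg Ux (h1 x Ux).
have nfg x : U x -> {near x, f =1 g}.
  by move=> Ux; apply: filterS (near_open Uo Ux) => y Uy; exact: fg.
split => [x Ux|i]; first exact: continuous_ext_on Uo fg Ux (h1 x Ux).
have [h3 h4] := h2 i; split => [x Ux|].
  exact: near_eq_derivable (nfg x Ux) (h3 x Ux).
apply: IH h4 => x Ux; rewrite /pderiv; apply: near_eq_derive.
exact: nfg.
Qed.

Lemma Ck_le1 k U f : Ck_on k.+1 U f -> Ck_on 1 U f.
Proof. by elim: k => // k IH /Ck_le. Qed.

Lemma pderivD U f g i x : Ck_on 1 U f -> Ck_on 1 U g -> U x ->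
  pderiv i (fun y => f y + g y) x = pderiv i f x + pderiv i g x.
Proof.
move=> [_ /(_ i)[df _]] [_ /(_ i)[dg _]] Ux.
exact: (deriveD (df x Ux) (dg x Ux)).
Qed.

Lemma Ck_onD k U f g : open U -> Ck_on k U f -> Ck_on k U g ->
  Ck_on k U (fun y => f y + g y).
Proof.
move=> Uo; elim: k f g => [|k IH] f g fC gC; have [f1 f2] := fC; have [g1 g2] := gC;
  (split => [x Ux|]; first exact: (continuousD (f1 x Ux) (g1 x Ux))) => // i.
have [f3 f4] := f2 i; have [g3 g4] := g2 i; split => [x Ux|].
  by apply: derivableD; [exact: f3|exact: g3].
apply: (Ck_on_ext Uo _ (IH _ _ f4 g4)) => x Ux.
by rewrite (pderivD _ (Ck_le1 fC) (Ck_le1 gC) Ux).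
Qed.

Lemma LopD a b U f g x : open U -> Ck_on 2 U f -> Ck_on 2 U g -> U x ->
  Lop a b (fun y => f y + g y) x = Lop a b f x + Lop a b g x.
Proof.
move=> Uo fC gC Ux; rewrite /Lop addrACA; congr (_ + _); rewrite -big_split /=.
  apply: eq_bigr => i _; rewrite -big_split /=; apply: eq_bigr => j _.
  rewrite -mulrDr; congr (_ * _).
  have [_ /(_ j)[_ fC1]] := fC; have [_ /(_ j)[_ gC1]] := gC.
  rewrite -(pderivD _ fC1 gC1 Ux) /pderiv; apply: near_eq_derive.
  apply: filterS (near_open Uo Ux) => y Uy.
  by rewrite -!/(pderiv _ _ _) (pderivD _ (Ck_le fC) (Ck_le gC) Uy).
apply: eq_bigr => i _.
by rewrite (pderivD _ (Ck_le fC) (Ck_le gC) Ux) mulrDr.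
Qed.

End EllipticOperator.

(** The superlevel sets through points of [K] are nested and generate a proper filter; by
    compactness it has a cluster point [x]. A larger value [g y] would, by semicontinuity, exclude
    [g z >= g y] near [x]. *)
Lemma usc_max (R : realType) (T : topologicalType) (K : set T) (g : T -> \bar R) : compact K -> K !=set0 ->
  (forall x, K x -> (g x < +oo)%E /\
    forall r : R, (g x < r%:E)%E -> \forall y \near x, K y -> (g y < r%:E)%E) ->
  exists2 x, K x & forall y, K y -> (g y <= g x)%E.
Proof.
move=> Kc [x0 Kx0] gu; apply: contrapT => nex.
have nmax x : K x -> exists2 y, K y & (g x < g y)%E.
  move=> Kx; apply: contrapT => ney; apply: nex; exists x => // y Ky.
  by rewrite leNgt; apply/negP => xy; apply: ney; exists y.
pose F := filter_from K (fun y => [set z | K z /\ (g y <= g z)%E]).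
have FF : ProperFilter F.
  apply: filter_from_proper; last by move=> y Ky; exists y.
  apply: filter_from_filter; first by exists x0.
  move=> y z Ky Kz; have [yz|zy] := leP (g y) (g z).
    by exists z => // t [Kt zt]; do 2 split => //; exact: le_trans zt.
  by exists y => // t [Kt yt]; do 2 split => //; exact: le_trans (ltW zy) yt.
have FK : F K by exists x0 => // t [].
have [x [Kx xcl]] := Kc F FF FK.
have [y Ky xy] := nmax x Kx.
have [gy _] := gu y Ky; have [_ gx] := gu x Kx.
case gyE : (g y) xy gy => [r| |] xr gy; last 2 first.
- by rewrite ltxx in gy.
- by rewrite ltNge leNye in xr.
have Fy : F [set z | K z /\ (g y <= g z)%E] by exists y.
have [z [[Kz yz] zr]] := xcl _ _ Fy (gx r xr).
by have := zr Kz; rewrite -gyE ltNge yz.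
Qed.

(** * Viscosity subharmonic functions are classically subharmonic *)

Section ViscosityToClassical.
Variables (R : realType) (n : nat).
Implicit Types (x y : 'rV[R]_n).

Lemma expR_coord_derive (i0 i : 'I_n) (L c : R) x :
  is_derive x (delta_mx 0 i) (fun y : 'rV[R]_n => c * expR (L * y 0 i0))
    (c * L * (i == i0)%:R * expR (L * x 0 i0)).
Proof.
have -> : c * L * (i == i0)%:R * expR (L * x 0 i0) =
    c * (expR (L * x 0 i0) * (L * (i == i0)%:R)) by ring.
apply: is_derive_mulc.
rewrite -[x in is_derive x]addr0 -[X in _ + X](scale0r (delta_mx 0 i)).
apply/is_derive_line.
pose a := L * (i == i0)%:R; pose b := L * x 0 i0.
have -> : (fun s : R => expR (L * (x + s *: delta_mx 0 i) 0 i0)) =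
   (fun s : R => expR (s * a + b)).
  by apply/funext => s; rewrite !mxE eqxx /= eq_sym /a /b; congr expR; ring.
have d1 : is_derive (0 : R) 1 (fun s : R => s * a + b) a.
  rewrite -[X in is_derive _ _ _ X]addr0; apply: is_deriveD.
  rewrite (_ : (fun _ => _) = (fun s : R => a * id s)); last first.
    by apply/funext => s; rewrite mulrC.
  by rewrite -[X in is_derive _ _ _ X]mulr1; apply: is_derive_mulc.
have := @is_derive1_comp _ expR (fun s : R => s * a + b) 0 _ _ (is_derive_expR _) d1.
by rewrite mul0r add0r.
Qed.

Lemma expR_coord_continuous (i0 : 'I_n) (L c : R) x :
  {for x, continuous (fun y : 'rV[R]_n => c * expR (L * y 0 i0))}.
Proof.
apply: (@cvgM _ _ (nbhs x) _ (fun=> c)); first exact: cvg_cst.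
apply: (@continuous_comp _ _ _ (fun y : 'rV[R]_n => L * y 0 i0) expR).
  by apply: (@cvgM _ _ (nbhs x) _ (fun=> L)); [exact: cvg_cst|exact: coord_continuous].
exact: continuous_expR.
Qed.

(** Depending on the coordinate [i0] alone, [psi] involves only [a i0 i0] and [b i0]. For positive
    [eps] and [L] it is strictly superharmonic where [L * a i0 i0 + b i0 > 0]. *)
Lemma exp_barrier (i0 : 'I_n) (L eps c : R) (a : 'rV[R]_n -> 'M[R]_n) (b : 'rV[R]_n -> 'rV[R]_n)
    (U : set 'rV[R]_n) :
  let psi := fun y : 'rV[R]_n => c - eps * expR (L * y 0 i0) in
  Ck_on 2 U psi /\ forall x,
    Lop a b psi x = - (eps * L * expR (L * x 0 i0) * (L * a x i0 i0 + b x 0 i0)).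
Proof.
move=> psi.
pose p1 j (y : 'rV[R]_n) := - eps * L * (j == i0)%:R * expR (L * y 0 i0).
pose p2 i j (y : 'rV[R]_n) := - eps * L * (j == i0)%:R * L * (i == i0)%:R * expR (L * y 0 i0).
have [C2p e1 e2] : [/\ Ck_on 2 U psi, (forall j, pderiv j psi = p1 j) &
    forall i j, pderiv i (pderiv j psi) = p2 i j].
  apply: Ck2_intro.
  - move=> x; rewrite /psi; apply: (@cvgB _ _ _ (nbhs x) _ (fun=> c)); first exact: cvg_cst.
    exact: expR_coord_continuous.
  - by move=> j x; exact: expR_coord_continuous.
  - by move=> i j x; exact: expR_coord_continuous.
  - move=> j x.
    rewrite (_ : p1 j x = 0 - eps * L * (j == i0)%:R * expR (L * x 0 i0)); last by rewrite /p1; ring.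
    exact: (is_deriveB (is_derive_cst c x (delta_mx 0 j)) (expR_coord_derive i0 j L eps x)).
  - by move=> i j x; exact: expR_coord_derive.
split => // x; rewrite /Lop.
have -> : \sum_i \sum_j a x i j * pderiv i (pderiv j psi) x =
    a x i0 i0 * (- eps * L * L * expR (L * x 0 i0)).
  rewrite (bigD1 i0)//= [X in _ + X]big1 => [|i ii0].
    rewrite addr0 (bigD1 i0)//= big1 => [|j ji0].
      by rewrite addr0 e2 /p2 eqxx !mulr1.
    by rewrite e2 /p2 (negPf ji0) mulr0 !mul0r mulr0.
  by rewrite big1// => j _; rewrite e2 /p2 (negPf ii0) mulr0 mul0r mulr0.
rewrite (bigD1 i0)//= big1 => [|i ii0].
  by rewrite addr0 e1 /p1 eqxx mulr1; ring.
by rewrite e1 /p1 (negPf ii0) mulr0 mul0r mulr0.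
Qed.

Lemma SHvisc_SHclass (X : set 'rV[R]_n) (a : 'rV[R]_n -> 'M[R]_n)
    (b : 'rV[R]_n -> 'rV[R]_n) (u : 'rV[R]_n -> \bar R) (i0 : 'I_n) :
  (forall x, X x -> {for x, continuous (fun y => a y i0 i0)}) ->
  (forall x, X x -> {for x, continuous (fun y => b y 0 i0)}) ->
  (forall x, X x -> 0 < a x i0 i0) ->
  usc_on X u -> SHvisc a b X u -> SHclass a b X u.
Proof.
move=> ca cb a0 uu uv K V h Kc Vo KV VX [hC hL] hb x1 Kx1.
rewrite leNgt; apply/negP => hx1.
have KX x : K x -> X x by move=> /KV/VX.
have K0 : K !=set0 by exists x1.
have Kcl : closed K by apply: compact_closed => //; exact: norm_hausdorff.
have [c Kcc cmax] : exists2 c, c \in K & forall t, t \in K ->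
    - b t 0 i0 / a t i0 i0 <= - b c 0 i0 / a c i0 i0.
  apply: (@EVT_max_rV R n (fun t => - b t 0 i0 / a t i0 i0)) => //.
  apply: continuous_in_subspaceT => x; rewrite inE => Kx.
  apply: (@cvgM _ _ (nbhs x)).
    by apply: cvgN; apply: cb; exact: KX.
  apply: cvgV; first by rewrite gt_eqF// a0//; exact: KX.
  by apply: ca; exact: KX.
(* Positive, and above the maximum over [K] of the ratio [- b / a], so that [L * a + b > 0] on all
   of [K]. *)
pose L := Num.max 0 (- b c 0 i0 / a c i0 i0) + 1.
have L0 : 0 < L by rewrite ltr_wpDl// le_max lexx.
have Lpos x : K x -> 0 < L * a x i0 i0 + b x 0 i0.
  move=> Kx; have ax := a0 x (KX x Kx).
  have : - b x 0 i0 / a x i0 i0 < L.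
    apply: le_lt_trans (cmax x _) _; first by rewrite inE.
    by apply: (@le_lt_trans _ _ (Num.max 0 (- b c 0 i0 / a c i0 i0))); rewrite ?le_max ?lexx ?orbT ?ltrDl.
  by rewrite ltr_pdivrMr//; lra.
have [d Kd dmax] : exists2 d, d \in K & forall t, t \in K ->
    1 * expR (L * t 0 i0) <= 1 * expR (L * d 0 i0).
  apply: (@EVT_max_rV R n (fun t => 1 * expR (L * t 0 i0))) => //.
  by apply: continuous_subspaceT => x; exact: expR_coord_continuous.
have [ux1 _] := uu x1 (KX _ Kx1).
have [u1 u1E] : exists u1 : R, u x1 = u1%:E.
  by case: (u x1) hx1 ux1 => [t| |] //; exists t.
pose del := u1 - h x1.
have del0 : 0 < del by rewrite subr_gt0 -lte_fin -u1E.
pose B := expR (L * d 0 i0).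
have B0 : 0 < B by exact: expR_gt0.
(* Keeps the perturbation at most [del / 2] on [K]: on the boundary [u - h + psi <= del / 2],
   whereas at [x1] it exceeds [del], so the maximum is interior. *)
pose eps := del / (2 * B).
have eps0 : 0 < eps by rewrite divr_gt0// mulr_gt0.
pose psi (y : 'rV[R]_n) := eps * expR (L * y 0 i0).
have psi0 y : 0 < psi y by rewrite mulr_gt0// expR_gt0.
have psiB y : K y -> psi y <= del / 2.
  move=> Ky; have := dmax y; rewrite inE !mul1r => /(_ Ky) h1.
  apply: (@le_trans _ _ (eps * B)); first by rewrite ler_wpM2l// ltW.
  by rewrite /eps le_eqVlt; apply/orP; left; apply/eqP; field; rewrite gt_eqF.
have cpsi x : {for x, continuous psi} by exact: expR_coord_continuous.
pose g y := (u y + (psi y - h y)%:E)%E.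
have [y0 Ky0 y0max] : exists2 x, K x & forall y, K y -> (g y <= g x)%E.
  apply: usc_max => // x Kx; have [uxy uxn] := uu x (KX x Kx); split.
    by rewrite /g; case: (u x) uxy => [t| |] // _; rewrite ?ltry// -EFinD ltry.
  move=> t; rewrite /g -lteBrDr// => gx.
  have [s us st] : exists2 s : R, (u x < s%:E)%E & s < t - (psi x - h x).
    move: gx; rewrite -EFinB; case: (u x) uxy => [s| |] // _.
      rewrite lte_fin => st; exists ((s + (t - (psi x - h x))) / 2); first by rewrite lte_fin; lra.
      by lra.
    by move=> _; exists (t - (psi x - h x) - 1); [rewrite ltNyr|lra].
  have e0 : 0 < t - (psi x - h x) - s by rewrite subr_gt0.
  have [d1 d10 H1] : exists2 del, 0 < del & forall y, `|y - x| < del ->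
      `|(psi y - h y) - (psi x - h x)| <= t - (psi x - h x) - s.
    apply: (@cont_close _ _ (fun y => psi y - h y) x _ e0).
    by apply: (@cvgB _ _ _ (nbhs x) _ psi h); [exact: cpsi|exact: (Ck_cont hC (KV _ Kx))].
  have /nbhs_ballP[d2 /= d20 H2] := uxn s us.
  apply/nbhs_ballP; exists (Num.min d1 d2); first by rewrite /= lt_min d10.
  move=> y; rewrite ball_subE lt_min => /andP[y1 y2] Ky.
  have us' : (u y < s%:E)%E by apply: H2; rewrite ball_subE.
  have := H1 y y1; rewrite ler_norml => /andP[_ h2].
  rewrite -lteBrDr// -EFinB; apply: lt_le_trans us' _; rewrite lee_fin.
  by lra.
have gy0 : (del%:E <= g y0)%E.
  apply: le_trans (y0max x1 Kx1); rewrite /g u1E -EFinD lee_fin /del.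
  by have := psi0 x1; lra.
have uy0 : (u y0 < +oo)%E by have [] := uu y0 (KX _ Ky0).
have [U UE] : exists U : R, u y0 = U%:E.
  by move: gy0; rewrite /g; case: (u y0) uy0 => [t| |] // _ _; exists t.
have Ky0i : interior K y0.
  apply: contrapT => nint.
  have : boundary K y0 by split; [exact: subset_closure|].
  move=> /hb; rewrite UE lee_fin => Uh.
  move: gy0; rewrite /g UE -EFinD lee_fin => h1.
  by have := psiB y0 Ky0; lra.
(* Normalizes the test function [h + (cc - psi)] to equal [u] at [y0]. *)
pose cc := U - h y0 + psi y0.
have [C2p Lp] := exp_barrier i0 L eps cc a b V.
have CV : Ck_on 2 V (fun y => h y + (cc - psi y)).
  by apply: Ck_onD; [exact: Vo|exact: hC|exact: C2p].
have Vy0 := KV _ Ky0.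
have := uv y0 (fun y => h y + (cc - psi y)) (KX _ Ky0).
rewrite (LopD a b Vo hC C2p Vy0) hL// Lp add0r => H.
have : 0 <= - (eps * L * expR (L * y0 0 i0) * (L * a y0 i0 i0 + b y0 0 i0)).
  apply: H.
  - by exists V; split; [exact: Vo|exact: Vy0|exact: CV].
  - apply: filterS Ky0i => y Ky; have := y0max y Ky.
    have [uy _] := uu y (KX _ Ky); rewrite /g UE.
    case: (u y) uy => [t| |] // _; last by move=> _; exact: leNye.
    by rewrite -!EFinD !lee_fin /cc; lra.
  - by rewrite UE /cc; congr (_%:E); ring.
rewrite oppr_ge0 leNgt => /negP; apply.
apply: mulr_gt0; last exact: Lpos.
by apply: mulr_gt0; [exact: mulr_gt0|exact: expR_gt0].
Qed.

End ViscosityToClassical.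

(** * Classically subharmonic functions are viscosity subharmonic *)

Section ClassicalToViscosity.
Variables (R : realType) (n : nat).
Implicit Types (x y : 'rV[R]_n).

Lemma uniform_scale (K : nat) (Q : 'I_K -> R -> R -> Prop) :
  (forall k C C' r, C <= C' -> 0 < r -> Q k C r -> Q k C' r) ->
  (forall k, exists C rho : R, [/\ 0 <= C, 0 < rho & forall r, 0 < r -> r < rho -> Q k C r]) ->
  exists C rho : R, [/\ 0 <= C, 0 < rho & forall r, 0 < r -> r < rho -> forall k, Q k C r].
Proof.
move=> Qm /choice[C /choice[rho H]].
have [d d0 dmin] := fin_min_pos (fun k => let: And3 _ h _ := H k in h).
have C0 k : 0 <= C k by have [] := H k.
exists (\sum_k C k), d; split; rewrite ?sumr_ge0// => r r0 rd k.
apply: (Qm k (C k)) => //; first by rewrite (bigD1 k)//= lerDl sumr_ge0.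
by have [_ _ h] := H k; apply: h => //; exact: lt_le_trans (dmin k).
Qed.

(** * Quadratic polynomials under the operator *)

Section Quadratic.
Variables (x0 : 'rV[R]_n) (c : R) (l : 'I_n -> R) (N : 'I_n -> 'I_n -> R).

Definition quad x : R := c + \sum_i l i * (x 0 i - x0 0 i) +
  2^-1 * \sum_i \sum_j N i j * ((x 0 i - x0 0 i) * (x 0 j - x0 0 j)).

Definition quad_op (a : 'rV[R]_n -> 'M[R]_n) (b : 'rV[R]_n -> 'rV[R]_n) x : R :=
  \sum_i \sum_j a x i j * N i j +
  \sum_i b x 0 i * (l i + \sum_k N k i * (x 0 k - x0 0 k)).

Hypothesis Nsym : forall i j, N i j = N j i.

Lemma is_derive_shift_coord i k x :
  is_derive x (delta_mx 0 i) (fun y : 'rV[R]_n => y 0 k - x0 0 k) (i == k)%:R.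
Proof.
rewrite -[(i == k)%:R]subr0.
by apply: is_deriveB; exact: is_derive_coord.
Qed.

Lemma shift_coord_continuous k x : {for x, continuous (fun y : 'rV[R]_n => y 0 k - x0 0 k)}.
Proof.
by apply: (@cvgB _ _ _ (nbhs x)); [exact: coord_continuous|exact: cvg_cst].
Qed.

Lemma sum_delta (f : 'I_n -> R) j : \sum_i f i * (j == i)%:R = f j.
Proof.
rewrite (bigD1 j)//= eqxx mulr1 big1 ?addr0// => i ij.
by rewrite eq_sym (negPf ij) mulr0.
Qed.

Lemma quadP (V : set 'rV[R]_n) a b : Ck_on 2 V quad /\ forall x, Lop a b quad x = quad_op a b x.
Proof.
pose p1 j x := l j + \sum_k N k j * (x 0 k - x0 0 k).
have [C2q e1 e2] : [/\ Ck_on 2 V quad, (forall j, pderiv j quad = p1 j) &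
    forall i j, pderiv i (pderiv j quad) = (fun=> N i j)].
  apply: Ck2_intro.
  - move=> x; apply: (@cvgD _ _ _ (nbhs x)); first apply: (@cvgD _ _ _ (nbhs x)).
    + exact: cvg_cst.
    + apply: (@cvg_bigsum R _ (nbhs x) (nbhs_filter x)) => i.
      by apply: (@cvgM _ _ (nbhs x)); [exact: cvg_cst|exact: shift_coord_continuous].
    + apply: (@cvgM _ _ (nbhs x)); first exact: cvg_cst.
      apply: (@cvg_bigsum R _ (nbhs x) (nbhs_filter x)) => i.
      apply: (@cvg_bigsum R _ (nbhs x) (nbhs_filter x)) => j.
      apply: (@cvgM _ _ (nbhs x)); first exact: cvg_cst.
      by apply: (@cvgM _ _ (nbhs x)); exact: shift_coord_continuous.
  - move=> j x; apply: (@cvgD _ _ _ (nbhs x)); first exact: cvg_cst.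
    apply: (@cvg_bigsum R _ (nbhs x) (nbhs_filter x)) => i.
    by apply: (@cvgM _ _ (nbhs x)); [exact: cvg_cst|exact: shift_coord_continuous].
  - by move=> i j x; exact: cst_continuous.
  - move=> j x.
    have h1 : is_derive x (delta_mx 0 j) (fun y : 'rV[R]_n => c + \sum_i l i * (y 0 i - x0 0 i))
        (0 + \sum_i l i * (j == i)%:R).
      apply: is_deriveD; apply: is_derive_bigsum => i; apply: is_derive_mulc.
      exact: is_derive_shift_coord.
    have h2 : is_derive x (delta_mx 0 j)
        (fun y : 'rV[R]_n => 2^-1 * \sum_i \sum_k N i k * ((y 0 i - x0 0 i) * (y 0 k - x0 0 k)))
        (2^-1 * \sum_i \sum_k N i k *
          ((x 0 i - x0 0 i) * (j == k)%:R + (x 0 k - x0 0 k) * (j == i)%:R)).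
      apply: is_derive_mulc; apply: is_derive_bigsum => i; apply: is_derive_bigsum => k.
      apply: is_derive_mulc.
      exact: (is_deriveM (is_derive_shift_coord j i x) (is_derive_shift_coord j k x)).
    have h := is_deriveD h1 h2.
    rewrite (_ : p1 j x = 0 + \sum_i l i * (j == i)%:R + 2^-1 * \sum_i \sum_k N i k *
          ((x 0 i - x0 0 i) * (j == k)%:R + (x 0 k - x0 0 k) * (j == i)%:R)); first exact: h.
    rewrite /p1 sum_delta add0r; congr (_ + _).
    have -> : \sum_i \sum_k N i k *
        ((x 0 i - x0 0 i) * (j == k)%:R + (x 0 k - x0 0 k) * (j == i)%:R) =
        \sum_i N i j * (x 0 i - x0 0 i) + \sum_k N j k * (x 0 k - x0 0 k).
      transitivity (\sum_i (N i j * (x 0 i - x0 0 i) +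
          (\sum_k N i k * (x 0 k - x0 0 k)) * (j == i)%:R)).
        apply: eq_bigr => i _; rewrite -(sum_delta (fun k => N i k * (x 0 i - x0 0 i)) j).
        rewrite mulr_suml -big_split /=; apply: eq_bigr => k _; ring.
      by rewrite big_split /= (sum_delta (fun i => \sum_k N i k * (x 0 k - x0 0 k))).
    have -> : \sum_k N j k * (x 0 k - x0 0 k) = \sum_k N k j * (x 0 k - x0 0 k).
      by apply: eq_bigr => k _; rewrite Nsym.
    by field.
  - move=> i j x.
    rewrite (_ : N i j = 0 + \sum_k N k j * (i == k)%:R); last first.
      by rewrite add0r (sum_delta (fun k => N k j)).
    apply: is_deriveD; apply: is_derive_bigsum => k; apply: is_derive_mulc.
    exact: is_derive_shift_coord.
split => // x; rewrite /Lop /quad_op; congr (_ + _).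
  by apply: eq_bigr => i _; apply: eq_bigr => j _; rewrite e2.
by apply: eq_bigr => i _; rewrite e1.
Qed.

End Quadratic.

(** * Correcting a quadratic polynomial to an L-harmonic function on small cubes *)

Section LocalSolution.
Variables (X : set 'rV[R]_n) (a : 'rV[R]_n -> 'M[R]_n) (b : 'rV[R]_n -> 'rV[R]_n)
  (x0 : 'rV[R]_n) (i0 : 'I_n) (l : 'I_n -> R) (N : 'I_n -> 'I_n -> R).
Hypotheses (Xo : open X) (Xx0 : X x0).
Hypothesis aC : forall i j, Ck_on (2 * n).+1 X (fun x => a x i j).
Hypothesis bC : forall i, Ck_on (2 * n).+1 X (fun x => b x 0 i).

Lemma coef_a_wiener : exists C rho : R, [/\ 0 <= C, 0 < rho & forall r, 0 < r -> r < rho ->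
  forall i j, wiener r (corner x0 r) 0 (C * r) (fun x => a x i j - a x0 i j)].
Proof.
apply: (@uniform_scale n (fun i C r => forall j,
   wiener r (corner x0 r) 0 (C * r) (fun x => a x i j - a x0 i j))).
  move=> i C C' r CC r0 h j; apply: wiener_weaken (h j).
  by rewrite ler_wpM2r// ltW.
move=> i; apply: (@uniform_scale n (fun j C r =>
   wiener r (corner x0 r) 0 (C * r) (fun x => a x i j - a x0 i j))).
  by move=> j C C' r CC r0; apply: wiener_weaken; rewrite ler_wpM2r// ltW.
by move=> j; exact: (wiener_of_Ck Xo Xx0 (aC i j)).
Qed.

Lemma coef_b_wiener : exists C rho : R, [/\ 0 <= C, 0 < rho & forall r, 0 < r -> r < rho ->
  forall i, wiener r (corner x0 r) 0 (C * r) (fun x => b x 0 i - b x0 0 i)].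
Proof.
apply: (@uniform_scale n (fun i C r =>
   wiener r (corner x0 r) 0 (C * r) (fun x => b x 0 i - b x0 0 i))).
  by move=> j C C' r CC r0; apply: wiener_weaken; rewrite ler_wpM2r// ltW.
by move=> i; exact: (wiener_of_Ck Xo Xx0 (bC i)).
Qed.

Hypothesis apos : posdefmx (a x0).
Hypothesis op0 : \sum_i \sum_j a x0 i j * N i j + \sum_i b x0 0 i * l i = 0.

(** Subtracting the value at [x0], zero by [op0], leaves in every term a factor that vanishes at
    [x0] and is therefore [O(r)]. *)
Lemma quad_op_split x : quad_op x0 l N a b x =
  \sum_i \sum_j (a x i j - a x0 i j) * N i j +
  \sum_i ((b x 0 i - b x0 0 i) * l i + \sum_k b x 0 i * (x 0 k - x0 0 k) * N k i).
Proof.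
transitivity (quad_op x0 l N a b x -
    (\sum_i \sum_j a x0 i j * N i j + \sum_i b x0 0 i * l i)); first by rewrite op0 subr0.
rewrite /quad_op opprD addrACA; congr (_ + _); rewrite -sumrB; apply: eq_bigr => i _.
  by rewrite -sumrB; apply: eq_bigr => j _; rewrite mulrBl.
rewrite mulrDr addrAC mulrBl; congr (_ + _).
by rewrite mulr_sumr; apply: eq_bigr => k _; ring.
Qed.

(** By [quad_op_split] the right-hand side has norm [O(r)], and [gain0] contributes [r ^ 2]. *)
Lemma local_solution : exists C rho : R, [/\ 0 <= C, 0 < rho & forall r, 0 < r -> r < rho ->
  exists w : 'rV[R]_n -> R, [/\ Ck_on 2 setT w, (forall x, `|w x| <= C * r ^+ 3) &
    forall x, open_cube r (corner x0 r) x -> Lop a b w x = - quad_op x0 l N a b x]].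
Proof.
have [Ca [ra [Ca0 ra0 Ha]]] := coef_a_wiener.
have [Cb [rb [Cb0 rb0 Hb]]] := coef_b_wiener.
have [lam lam0 lamP] := posdefmx_coercive i0 apos.
pose B := \sum_i `|b x0 0 i|.
have B0 : 0 <= B by apply: sumr_ge0.
pose E : R := 54 ^+ n.
have E0 : 0 <= E by rewrite exprn_ge0.
pose Cf := \sum_i \sum_j Ca * `|N i j| +
  \sum_i (Cb * `|l i| + \sum_k (Cb + B) * E * `|N k i|).
have Cf0 : 0 <= Cf.
  apply: addr_ge0; apply: sumr_ge0 => i _; first by apply: sumr_ge0 => j _; exact: mulr_ge0.
  apply: addr_ge0; first exact: mulr_ge0.
  by apply: sumr_ge0 => k _; rewrite mulr_ge0// mulr_ge0// addr_ge0.
(* [S * r] is the contraction constant of the Neumann step; the radius below makes it at most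
   1/2. *)
pose S := lam^-1 * (n%:R * n%:R * Ca) + 4 / lam * (n%:R * (Cb + B)).
have S0 : 0 <= S.
  apply: addr_ge0; apply: mulr_ge0.
  - by rewrite invr_ge0 ltW.
  - by apply: mulr_ge0 => //; exact: mulr_ge0.
  - by rewrite divr_ge0// ltW.
  - by apply: mulr_ge0 => //; exact: addr_ge0.
(* In order: [gain0] without [r ^ 2], the sum 2 of the geometric series, the cost [4 * E] of the
   shifted coset, and the size of the right-hand side. *)
pose C := 16 / lam * (2 * (4 * E * Cf)).
exists C, (Num.min (Num.min ra rb) (Num.min 1 (2 * (S + 1))^-1)); split.
- by rewrite /C mulr_ge0 ?divr_ge0 ?(ltW lam0)// mulr_ge0// mulr_ge0// mulr_ge0.
- by rewrite !lt_min ra0 rb0 ltr01 invr_gt0 mulr_gt0// ltr_wpDl.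
move=> r r0; rewrite !lt_min => /andP[/andP[r1 r2] /andP[r3 r4]].
pose p := corner x0 r.
have wa i j : wiener r p 0 (Ca * r) (fun x => a x i j - a x0 i j) by exact: Ha.
have wb i : wiener r p 0 (Cb * r) (fun x => b x 0 i - b x0 0 i) by exact: Hb.
have wbi i : wiener r p 0 (Cb + B) (fun x => b x 0 i).
  apply: (@wiener_weaken _ _ _ _ _ (Cb * r + `|b x0 0 i|)).
    apply: lerD; first by rewrite ler_piMr// ltW.
    by rewrite /B (bigD1 i)//= lerDl sumr_ge0.
  apply: (@wiener_ext _ _ _ _ _ _ (fun x => b x 0 i - b x0 0 i + b x0 0 i)).
    by move=> x _; rewrite subrK.
  by apply: wienerD => //; exact: wiener_cst.
have ws k : wiener r p 0 (E * r) (fun x => x 0 k - x0 0 k).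
  apply: wiener_of_scaled_bound => //; first exact: ltW.
    apply: scaled_bound_coord => //; rewrite !mxE.
    by apply/andP; split; lra.
  by move=> x _; exact: shift_coord_continuous.
have wf0 : wiener r p 0 (Cf * r) (fun x => quad_op x0 l N a b x).
  apply: (@wiener_ext _ _ _ _ _ _ (fun x => \sum_i \sum_j (a x i j - a x0 i j) * N i j +
    \sum_i ((b x 0 i - b x0 0 i) * l i + \sum_k b x 0 i * (x 0 k - x0 0 k) * N k i))).
    by move=> x _; rewrite quad_op_split.
  have -> : Cf * r = \sum_i \sum_j (Ca * r) * `|N i j| +
      \sum_i ((Cb * r) * `|l i| + \sum_k (Cb + B) * (E * r) * `|N k i|).
    rewrite /Cf mulrDl !mulr_suml; congr (_ + _); apply: eq_bigr => i _.
      by rewrite mulr_suml; apply: eq_bigr => j _; ring.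
    by rewrite mulrDl mulr_suml; congr (_ + _); [ring|apply: eq_bigr => k _; ring].
  apply: wienerD; apply: wiener_sum => i.
    by apply: wiener_sum => j; apply: wienerM => //; exact: wiener_cst.
  apply: wienerD; first by apply: wienerM => //; exact: wiener_cst.
  apply: wiener_sum => k; apply: wienerM; last exact: wiener_cst.
  exact: wienerM.
(* The factor 1, taken in the shifted class, carries the right-hand side into it. *)
have wf : wiener r p (quarter_shift R i0) (4 * E * (Cf * r * `|-1|)) (fun x => - quad_op x0 l N a b x).
  apply: (@wiener_ext _ _ _ _ _ _ (fun x => 1 * (quad_op x0 l N a b x * -1))).
    by move=> x _; rewrite mul1r mulrN1.
  apply: wienerM; first exact: wiener_one_shift.
  by apply: wienerM => //; exact: wiener_cst.
rewrite normrN1 mulr1 in wf.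
have small : gain2 lam * (n%:R * n%:R * (Ca * r)) + gain1 r lam * (n%:R * (Cb + B)) <= 2^-1.
  have -> : gain2 lam * (n%:R * n%:R * (Ca * r)) + gain1 r lam * (n%:R * (Cb + B)) = S * r.
    by rewrite /gain2 /gain1 /S; ring.
  have S1 : 0 < S + 1 by rewrite ltr_wpDl.
  have : r * (2 * (S + 1)) < 1 by rewrite -ltr_pdivlMr ?mulr_gt0// mul1r.
  by have := mulr_ge0 S0 (ltW r0); lra.
have [w [w1 w2 w3]] := elliptic_solution r0 lam0 lamP wa wbi wf small.
exists w; split => // x; apply: le_trans (w2 x) _.
rewrite /gain0 /C le_eqVlt; apply/orP; left; apply/eqP; ring.
Qed.

End LocalSolution.

Lemma norm_sqr_le_sum x : `|x| ^+ 2 <= \sum_i x 0 i ^+ 2.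
Proof.
have s0 : 0 <= \sum_i x 0 i ^+ 2 by apply: sumr_ge0 => i _; exact: sqr_ge0.
rewrite -[leRHS]sqr_sqrtr// ler_sqr ?nnegrE ?sqrtr_ge0//.
apply: norm_row_le => [|i]; first exact: sqrtr_ge0.
rewrite -sqrtr_sqr ler_sqrt// (bigD1 i)//= lerDl sumr_ge0// => j _.
exact: sqr_ge0.
Qed.

Lemma SHclass_SHvisc (X : set 'rV[R]_n) (a : 'rV[R]_n -> 'M[R]_n)
    (b : 'rV[R]_n -> 'rV[R]_n) (u : 'rV[R]_n -> \bar R) (i0 : 'I_n) : open X ->
  (forall i j, Ck_on (2 * n).+1 X (fun x => a x i j)) ->
  (forall i, Ck_on (2 * n).+1 X (fun x => b x 0 i)) ->
  (forall x, X x -> (a x)^T = a x) -> (forall x, X x -> posdefmx (a x)) ->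
  SHclass a b X u -> SHvisc a b X u.
Proof.
move=> Xo aC bC asym apos uc x0 phi Xx0 [U [Uo Ux0 phiC]] uphi ux0.
rewrite leNgt; apply/negP => Lneg.
have [H HE] : exists H : 'I_n -> 'I_n -> R, forall i j, pderiv i (pderiv j phi) x0 = H i j.
  by exists (fun i j => pderiv i (pderiv j phi) x0).
have [l lE] : exists l : 'I_n -> R, forall i, pderiv i phi x0 = l i.
  by exists (fun i => pderiv i phi x0).
have LE : Lop a b phi x0 = \sum_i \sum_j a x0 i j * H i j + \sum_i b x0 0 i * l i.
  rewrite /Lop; congr (_ + _); last by apply: eq_bigr => i _; rewrite lE.
  by apply: eq_bigr => i _; apply: eq_bigr => j _; rewrite HE.
pose tr := \sum_i a x0 i i.
have aii i : 0 < a x0 i i.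
  rewrite -qform_delta -posdefmx_qform; apply: (apos x0 Xx0); exact: delta_neq0.
have tr0 : 0 < tr.
  by rewrite /tr (bigD1 i0)//= ltr_wpDr// sumr_ge0// => i _; rewrite ltW.
(* Adding [sig / 2] times the squared Euclidean distance raises the operator at [x0] by [sig * tr],
   exactly up to 0. *)
pose sig := - Lop a b phi x0 / tr.
have sig0 : 0 < sig by rewrite divr_gt0// oppr_gt0.
(* The Hessian is symmetrized, as [quadP] requires; pairing with the symmetric [a x0] does not see
   the difference. *)
pose N i j := 2^-1 * (H i j + H j i) + sig * (i == j)%:R.
have Nsym i j : N i j = N j i by rewrite /N (addrC (H i j)) (eq_sym i).
have symE i j : a x0 i j = a x0 j i by rewrite -{1}(asym x0 Xx0) mxE.
have op0 : \sum_i \sum_j a x0 i j * N i j + \sum_i b x0 0 i * l i = 0.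
  have -> : \sum_i \sum_j a x0 i j * N i j =
      \sum_i \sum_j a x0 i j * H i j + sig * tr.
    transitivity (\sum_i \sum_j 2^-1 * (a x0 i j * H i j) + \sum_i \sum_j 2^-1 * (a x0 i j * H j i)
        + \sum_i \sum_j sig * a x0 i j * (i == j)%:R).
      rewrite -!big_split /=; apply: eq_bigr => i _; rewrite -!big_split /=.
      by apply: eq_bigr => j _; rewrite /N; ring.
    have -> : \sum_i \sum_j 2^-1 * (a x0 i j * H j i) = \sum_i \sum_j 2^-1 * (a x0 i j * H i j).
      rewrite exchange_big /=; apply: eq_bigr => i _; apply: eq_bigr => j _.
      by rewrite symE.
    congr (_ + _).
      rewrite -big_split /=; apply: eq_bigr => i _; rewrite -big_split /=.
      by apply: eq_bigr => j _; field.
    rewrite /tr mulr_sumr; apply: eq_bigr => i _.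
    exact: (sum_delta (fun j => sig * a x0 i j)).
  rewrite addrAC -LE /sig mulrAC mulfK ?gt_eqF//.
  by rewrite addrN.
have [Cw [rw [Cw0 rw0 Hw]]] := local_solution i0 Xo Xx0 aC bC (apos x0 Xx0) op0.
(* Half of the added [sig / 2] pays for the Taylor remainder; the other half is the gap between the
   polynomial and [phi]. *)
pose tau := sig / 4.
have tau0 : 0 < tau by rewrite divr_gt0.
have [d1 d10 taylor] := taylor2 Uo phiC Ux0 tau0.
have Tl (v : 'rV[R]_n) : \sum_i v 0 i * pderiv i phi x0 = \sum_i v 0 i * l i.
  by apply: eq_bigr => i _; rewrite lE.
have TH (v : 'rV[R]_n) : \sum_i \sum_j v 0 i * v 0 j * pderiv i (pderiv j phi) x0 =
    \sum_i \sum_j v 0 i * v 0 j * H i j.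
  by apply: eq_bigr => i _; apply: eq_bigr => j _; rewrite HE.
have quad_ge x : `|x - x0| < d1 -> phi x + tau * `|x - x0| ^+ 2 <= quad x0 (phi x0) l N x.
  move=> xd; have := taylor (x - x0) xd; rewrite Tl TH (addrC x0) subrK ler_norml => /andP[_ h].
  have e : quad x0 (phi x0) l N x = phi x0 + \sum_i (x - x0) 0 i * l i +
     2^-1 * \sum_i \sum_j (x - x0) 0 i * (x - x0) 0 j * H i j
     + sig / 2 * \sum_i (x - x0) 0 i ^+ 2.
    rewrite /quad -[RHS]addrA; congr (_ + _ + _).
      by apply: eq_bigr => i _; rewrite !mxE mulrC.
    pose s i := x 0 i - x0 0 i.
    have -> : \sum_i \sum_j N i j * (s i * s j) =
        \sum_i \sum_j 2^-1 * (s i * s j * H i j) + \sum_i \sum_j 2^-1 * (s i * s j * H j i)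
        + \sum_i \sum_j sig * (s i * s j) * (i == j)%:R.
      rewrite -!big_split /=; apply: eq_bigr => i _; rewrite -!big_split /=.
      by apply: eq_bigr => j _; rewrite /N; ring.
    have -> : \sum_i \sum_j 2^-1 * (s i * s j * H j i) = \sum_i \sum_j 2^-1 * (s i * s j * H i j).
      rewrite exchange_big /=; apply: eq_bigr => i _; apply: eq_bigr => j _.
      by rewrite (mulrC (s j)).
    have -> : \sum_i \sum_j sig * (s i * s j) * (i == j)%:R = sig * \sum_i (x - x0) 0 i ^+ 2.
      rewrite mulr_sumr; apply: eq_bigr => i _.
      by rewrite (sum_delta (fun j => sig * (s i * s j))) !mxE expr2.
    have -> : \sum_i \sum_j 2^-1 * (s i * s j * H i j) =
        2^-1 * \sum_i \sum_j (x - x0) 0 i * (x - x0) 0 j * H i j.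
      rewrite mulr_sumr; apply: eq_bigr => i _; rewrite mulr_sumr; apply: eq_bigr => j _.
      by rewrite !mxE.
    by field.
  have h2 := norm_sqr_le_sum (x - x0).
  have h3 : sig / 2 * `|x - x0| ^+ 2 <= sig / 2 * \sum_i (x - x0) 0 i ^+ 2.
    by rewrite ler_wpM2l// divr_ge0// ltW.
  have h4 : sig / 2 * `|x - x0| ^+ 2 = tau * `|x - x0| ^+ 2 + tau * `|x - x0| ^+ 2.
    by rewrite /tau; field.
  by rewrite e; lra.
have [dX dX0 inX] := open_close Xo Xx0.
have /nbhs_ballP[du /= du0 Hu] := uphi.
pose m := Num.min (Num.min rw d1) (Num.min dX du).
have m0 : 0 < m.
  by rewrite !lt_min rw0 d10 dX0; exact: du0.
have K1 : 0 < 32 * (Cw + 1) by rewrite mulr_gt0// ltr_wpDl.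
(* The first bound keeps [r] below all the radii, the second makes [Cw * r ^+ 3] smaller than
   [tau * r ^+ 2 / 32]. *)
pose r := Num.min (m / 2) (tau / (32 * (Cw + 1))).
have r0 : 0 < r by rewrite lt_min; apply/andP; split; exact: divr_gt0.
have rm : r < m.
  by apply: (@le_lt_trans _ _ (m / 2)); [rewrite ge_min lexx|lra].
have rtau : r * (32 * (Cw + 1)) <= tau.
  by rewrite -ler_pdivlMr// ge_min lexx orbT.
move: (rm); rewrite !lt_min => /andP[/andP[rrw rd1] /andP[rdX rdu]].
have [w [wC wb wL]] := Hw r r0 rrw.
(* Half of the gap [tau * (r / 4) ^+ 2] on the boundary of [K]. After lowering by [del], a surplus
   [del] remains there and a deficit [del] at [x0]; [w] is smaller than both. *)
pose del := tau * r ^+ 2 / 32.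
have Cwdel : Cw * r ^+ 3 < del.
  have r2 : 0 < r ^+ 2 by rewrite exprn_gt0.
  have -> : Cw * r ^+ 3 = r ^+ 2 * (Cw * r) by ring.
  have -> : del = r ^+ 2 * (tau / 32) by rewrite /del; ring.
  rewrite ltr_pM2l// ltr_pdivlMr//; apply: lt_le_trans rtau; lra.
(* In the sup norm [V] is the open cube on which [w] solves the equation; [K] is concentric with
   half its side. *)
pose V : set 'rV[R]_n := ball x0 (r / 2).
pose K : set 'rV[R]_n := [set x | `|x - x0| <= r / 4].
have Vo : open V by exact: ball_open.
have KV : K `<=` V.
  by move=> x /= xK; rewrite /V ball_subE; apply: le_lt_trans xK _; lra.
have VX : V `<=` X.
  by move=> x; rewrite /V ball_subE => xV; apply: inX; lra.
have Kcl : closed K.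
  rewrite (_ : K = (fun x : 'rV[R]_n => `|x - x0|) @^-1` [set t : R | t <= r / 4]); last by [].
  apply: preimage_closed; last exact: closed_le.
  move=> x _; apply: cont_of_close => e e0; exists e => // y yx.
  apply: le_trans (ler_dist_dist _ _) _.
  by rewrite opprB addrA subrK ltW.
have Kc : compact K.
  apply: bounded_closed_compact Kcl.
  exists (`|x0| + r / 4); split; first exact: num_real.
  move=> M hM x /= xK; rewrite -[x](subrK x0) addrC.
  apply: le_trans (ler_normD _ _) _; apply: ltW; apply: le_lt_trans hM.
  by rewrite lerD2l.
have [qC qL] := quadP x0 (phi x0 - del) l Nsym V a b.
have wCV : Ck_on 2 V w by apply: Ck_sub wC.
pose h x := quad x0 (phi x0 - del) l N x + w x.
have quadE x : quad x0 (phi x0 - del) l N x = quad x0 (phi x0) l N x - del.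
  by rewrite /quad; ring.
have hharm : Lharmonic_on a b V h.
  split; first exact: Ck_onD.
  move=> x Vx; rewrite (LopD a b Vo qC wCV Vx) qL wL; first exact: addrN.
  apply/open_cube_corner => i; have := norm_coord_le (x - x0) i.
  rewrite !mxE => /le_lt_trans; apply; by rewrite -ball_subE.
have := uc K V h Kc Vo KV VX hharm.
have bK x : boundary K x -> (u x <= (h x)%:E)%E.
  move=> [xc xi]; have Kx : K x by have := Kcl x xc.
  have xr : `|x - x0| = r / 4.
    apply/eqP; rewrite eq_le Kx /= leNgt; apply/negP => xlt; apply: xi.
    apply/nbhs_ballP; exists (r / 4 - `|x - x0|); first by rewrite /= subr_gt0.
    move=> y; rewrite ball_subE /K /= => yx.
    have -> : y - x0 = (y - x) + (x - x0) by rewrite addrA subrK.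
    by apply: le_trans (ler_normD _ _) _; lra.
  have xd1 : `|x - x0| < d1 by rewrite xr; lra.
  have xdu : ball x0 du x by rewrite ball_subE xr; lra.
  apply: le_trans (Hu x xdu) _; rewrite lee_fin /h quadE.
  have := quad_ge x xd1; rewrite xr.
  have -> : tau * (r / 4) ^+ 2 = 2 * del by rewrite /del; field.
  have := wb x; rewrite ler_norml => /andP[h1 _].
  by lra.
move=> /(_ bK x0); rewrite /K /= subrr normr0 => /(_ _).
have r40 : 0 <= r / 4 by rewrite divr_ge0// ltW.
move=> /(_ r40); rewrite ux0 lee_fin /h /quad.
rewrite big1 => [|i _]; last by rewrite subrr mulr0.
rewrite big1 => [|i _]; last by rewrite big1// => j _; rewrite subrr mul0r mulr0.
have := wb x0; rewrite ler_norml => /andP[_ h1].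
by lra.
Qed.

End ClassicalToViscosity.

Theorem theoremA4 (R : realType) (n : nat) (X : set 'rV[R]_n)
    (a : 'rV[R]_n -> 'M[R]_n) (b : 'rV[R]_n -> 'rV[R]_n)
    (u : 'rV[R]_n -> \bar R)
    (hn : (0 < n)%N)
    (hX : open X)
    (ha_smooth : forall i j : 'I_n, smooth_on X (fun x => a x i j))
    (hb_smooth : forall i : 'I_n, smooth_on X (fun x => b x 0 i))
    (ha_sym : forall x, X x -> (a x)^T = a x)
    (ha_pos : forall x, X x -> posdefmx (a x))
    (hu_usc : usc_on X u)
    (hu_ninfty : not_identically_ninfty X u) :
  SHvisc a b X u <-> SHclass a b X u.
Proof.
(* One coordinate serves as the direction of the exponential barrier and as that of the frequency
   shift. *)
pose i0 : 'I_n := Ordinal hn.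
split.
  apply: (@SHvisc_SHclass _ _ X a b u i0) => //.
  - by move=> x; exact: Ck_cont (ha_smooth i0 i0 0%N).
  - by move=> x; exact: Ck_cont (hb_smooth i0 0%N).
  - move=> x Xx; rewrite -qform_delta -posdefmx_qform; apply: (ha_pos x Xx); exact: delta_neq0.
exact: (SHclass_SHvisc i0 hX (fun i j => ha_smooth i j _) (fun i => hb_smooth i _) ha_sym ha_pos).
Qed.
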